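(* Let $\mathbb{T}$ be either $\mathbb{N}=\{1,2,\ldots\}$ or $[0,\infty)$, and let $\mu$ be the counting measure if $\mathbb{T}=\mathbb{N}$ and the Lebesgue measure if $\mathbb{T}=[0,\infty)$. Let $A(\cdot)$ be a non-negative correlation function and let $\{Z(t),t\in\mathbb{T}\}$ be a centered stationary Gaussian process with correlation function $A(\cdot)$ whose sample paths are almost surely continuous. For $r\in\mathbb{R}$ let $$\theta(A,r):=-\lim_{T\to\infty}\frac1T\log\mathbb{P}\Big(\sup_{t\in[0,T]\cap\mathbb{T}}Z(t)<r\Big).$$ (a) If $\int_{\mathbb{T}}A(t)\,\mu(dt)<\infty$, then $\theta(A,r)\in(0,\infty)$ for every $r\in\mathbb{R}$. (b) If $\int_{\mathbb{T}}A(t)\,\mu(dt)=\infty$, then $\theta(A,r)=0$ for every $r\in\mathbb{R}$.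
   Context: That $Z$ has correlation function $A$ means $\mathbb{E}[Z(s)Z(t)]=A(|s-t|)$ for $s,t\in\mathbb{T}$, with $A(0)=1$ (unit variance). The limit defining $\theta(A,r)$ exists by Slepian's lemma and subadditivity. When $\mathbb{T}=\mathbb{N}$, continuity of sample paths holds vacuously. *)

(* Defs.v *)
From HB Require Import structures.
From mathcomp Require Import all_boot all_order all_algebra.
From mathcomp Require Import all_classical all_reals all_analysis.
Import Order.TTheory GRing.Theory Num.Theory.
Import numFieldNormedType.Exports.

Set Implicit Arguments.
Unset Strict Implicit.
Unset Printing Implicit Defensive.

Local Open Scope classical_set_scope.
Local Open Scope ring_scope.

(* Index sets are subsets T of R. A process over T is a family of random
   variables Z : R -> {RV P >-> R} of which only the members Z t with t in T
   matter: every condition below is restricted to T. *)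

Definition positive_naturals (R : realType) : set R :=
  [set n%:R | n in [set n : nat | (0 < n)%N]].
Arguments positive_naturals R : clear implicits.

(* Normal law, possibly degenerate. The Dirac case is separate because the
   library's normal_prob m 0 is the uniform law on [0, 1]. Laws are compared on
   measurable sets only: the values of a measure elsewhere are meaningless. *)
Definition gaussian_law (R : realType) (nu : set R -> \bar R) : Prop :=
  (exists m : R, forall B, measurable B -> nu B = dirac m B) \/
  (exists m s : R, 0 < s /\ forall B, measurable B -> nu B = normal_prob m s B).

Section processes.
Context (d : measure_display) (Omega : measurableType d) (R : realType).
Context (P : probability Omega R).
Implicit Types (T : set R) (Z : R -> {RV P >-> R}) (A : R -> R).

Definition gaussian_process T Z : Prop :=
  forall (n : nat) (t : 'I_n -> R) (a : 'I_n -> R), (forall i, T (t i)) ->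
    gaussian_law (pushforward P (fun w => \sum_(i < n) a i * Z (t i) w)).

Definition centered_process T Z : Prop :=
  forall t, T t -> ('E_P[Z t] = 0)%E.

(* Invariance of the finite-dimensional laws under shifts; measurable boxes
   determine these laws. *)
Definition stationary_process T Z : Prop :=
  forall (n : nat) (t : 'I_n -> R) (h : R) (B : 'I_n -> set R),
    (forall i, T (t i)) -> T h -> (forall i, measurable (B i)) ->
    P [set w | forall i, B i (Z (t i + h) w)] =
    P [set w | forall i, B i (Z (t i) w)].

Definition has_correlation T Z A : Prop :=
  A 0 = 1 /\
  forall s t, T s -> T t -> ('E_P[fun w => (Z s w * Z t w)%R] = (A `|s - t|)%:E)%E.

Definition ae_continuous_paths T Z : Prop :=
  {ae P, forall w, {within T, continuous (fun t => Z t w)}}.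

(* The supremum is extended: it is +oo on unbounded paths and -oo when no
   index lies in [0, x]. *)
Definition below_event T Z (r x : R) : set Omega :=
  [set w | (ereal_sup [set (Z t w)%:E | t in (`[0, x] `&` T)%R] < r%:E)%E].

(* When T is uncountable and the paths are only almost surely continuous,
   below_event is measurable for the completion of P but not always for the
   given sigma-algebra; hence the completion (which agrees with P on
   measurable sets). lne is the extended logarithm, with lne 0 = -oo. *)
Definition log_persistence_rate T Z (r x : R) : \bar R :=
  ((x^-1)%:E * lne (@completed_measure_extension _ _ _ P (below_event T Z r x)))%E.

Definition theta T Z (r : R) : \bar R :=
  (- lim (log_persistence_rate T Z r x @[x --> +oo%R]))%E.

Definition theta_exists T Z (r : R) : Prop :=
  cvg (log_persistence_rate T Z r x @[x --> +oo%R]).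

End processes.

(* Main.v *)
(** Write p(x) for the probability that the process stays below r on [0, x].

    A Gaussian vector with non-negative correlations is associated (Pitt), so p
    is supermultiplicative and Fekete's lemma gives the limit theta.

    Integrable case: if the off-diagonal covariances of n standard Gaussian
    variables sum to at most eps in each row, adding suitable independent noise
    of variance eps makes them i.i.d. N(0, 1 + eps), and this bounds the
    probability that they are all below r by exp(- eps n). Some arithmetic
    progression of bounded step satisfies the hypothesis: averaging over the
    step h in [H, 2 H] bounds the mean of sum_k A(k h) by O(1 / H).

    Divergent case: let S be the sum of Z over a grid of 2 K points in [0, x].
    All covariances of Z(t) with S are at least about G = sum_(k < K) A(k delta),
    while Var S = O(K G). A Cameron-Martin shift along S therefore lowers the
    level from r + M to r at the cost of a factor exp(O(M^2 K / G)), and G can be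
    made as large as desired; as p at level r + M has a rate tending to 0 when
    M tends to infinity, theta = 0.

    Laws of Gaussian vectors are compared through characteristic functions:
    smoothing by a Gaussian expresses expectations of indicators of boxes in
    terms of them. *)

Require Import Defs.
From HB Require Import structures.
From mathcomp Require Import all_boot all_order all_algebra.
From mathcomp Require Import all_classical all_reals all_analysis.
From mathcomp Require Import measurable_realfun.
From mathcomp Require Import zify ring lra.
Import Order.TTheory GRing.Theory Num.Theory.
Import numFieldNormedType.Exports.

Set Implicit Arguments.
Unset Strict Implicit.
Unset Printing Implicit Defensive.
Set Bullet Behavior "Strict Subproofs".

Local Open Scope classical_set_scope.
Local Open Scope ring_scope.

(** * Normal distributions *)

(** Covariance matrices may be singular, so no joint density is ever used. Each probabilistic step
    is an equality in law between explicit linear images of independent families (resampling one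
    direction, rotating two copies, adding noise), which reduces to an identity between quadratic
    forms. In the integrable case the noise has to be cheap: its total variance over n points is eps
    n, so forcing it to be small costs at most a factor exp(- eps n), whereas the i.i.d. variables
    pay exp(- 2 eps n). The constant eps depends on the level r alone. In the divergent case the
    grid has 2 K points because each of them then has K consecutive grid points, itself included, on
    one side. With spacing delta and x = 2 K delta, the cost of the shift is exp(O(M^2 x / (delta
    G))): what must be large is delta G, a Riemann sum of the integral of A. Positivity of p,
    without which the rate could be infinite, comes from the same shift along a single variable.
    Events over uncountably many times are replaced by suprema along a dense sequence, with a margin
    below r because only non-strict bounds pass to limits. *)

Section bounded_integration.
Context (d : measure_display) (Y : measurableType d) (R : realType).
Variable P : probability Y R.

Lemma bounded_integrable (f : Y -> R) (M : R) :
  measurable_fun setT f -> (forall x, `|f x| <= M) ->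
  P.-integrable setT (EFin \o f).
Proof.
move=> mf fM; apply: measurable_bounded_integrable => //.
  by rewrite -ge0_fin_numE//; exact: fin_num_measure.
by exists M; split; [exact: num_real|] => x Mx y _ /=; rewrite (le_trans (fM y))// ltW.
Qed.

Lemma le_Rint (f g : Y -> R) :
  P.-integrable setT (EFin \o f) -> P.-integrable setT (EFin \o g) ->
  (forall x, f x <= g x) -> \int[P]_x f x <= \int[P]_x g x.
Proof. by move=> fi gi fg; apply: le_Rintegral. Qed.

Lemma Rint_cst (c : R) : \int[P]_x c = c.
Proof. by rewrite Rintegral_cst// [X in fine X](@probability_setT _ _ _ P) mulr1. Qed.

Lemma Rint_affine (f : Y -> R) (k c : R) : P.-integrable setT (EFin \o f) ->
  P.-integrable setT (EFin \o (fun w => k * f w + c)) /\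
  \int[P]_w (k * f w + c) = k * \int[P]_w f w + c.
Proof.
move=> fi; have kf := integrableZl measurableT k fi.
have ic := finite_measure_integrable_cst P c measurableT.
split; first exact: (integrableD measurableT kf ic).
by rewrite (RintegralD _ kf ic)// (RintegralZl _ _ fi)// Rint_cst.
Qed.

Lemma Rint_lin (I : finType) (f : I -> Y -> R) (a : I -> R) :
  (forall i, P.-integrable setT (EFin \o f i)) ->
  P.-integrable setT (EFin \o (fun w => \sum_i a i * f i w)) /\
  \int[P]_w (\sum_i a i * f i w) = \sum_i a i * \int[P]_w f i w.
Proof.
move=> fi.
have ai i : P.-integrable setT (fun w => (a i * f i w)%:E).
  exact: (integrableZl measurableT (a i) (fi i)).
split.
  have := @integrable_sum _ _ _ P setT measurableT I (index_enum I) predT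
    (fun i w => (a i * f i w)%:E) (fun i _ => ai i).
  by apply: eq_integrable => // w _; rewrite sumEFin.
have Ei i : (\int[P]_w (a i * f i w)%:E = (a i * \int[P]_w f i w)%:E)%E.
  rewrite -(RintegralZl _ _ (fi i))// fineK//.
  by apply: integrable_fin_num => //; exact: ai.
rewrite {1}/Rintegral; under eq_integral do rewrite -sumEFin.
rewrite (integral_sum _ ai)// (eq_bigr _ (fun i _ => Ei i)).
by rewrite sumEFin.
Qed.

End bounded_integration.

Section normal.
Context {R : realType}.
Local Notation mu := (@lebesgue_measure R).

(** The abstract Radon-Nikodym derivative of [normal_prob m s] has the same integral as
    [normal_pdf m s] over every measurable set, so the two agree almost everywhere and can be
    exchanged under the integral. *)
Lemma ge0_integral_normal_prob (m s : R) (f : measurableTypeR R -> \bar R) :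
  measurable_fun setT f -> (forall x, (0 <= f x)%E) ->
  (\int[normal_prob m s]_x f x = \int[mu]_x (f x * (normal_pdf m s x)%:E))%E.
Proof.
move=> mf f0.
have dom := normal_prob_dominates m s.
rewrite -(@Radon_Nikodym_SigmaFinite.change_of_variables _ _ _ _ mu dom)//.
have ifd := @Radon_Nikodym_SigmaFinite.f_integrable _ _ _ _ mu dom.
apply: ae_eq_integral => //.
- by apply: emeasurable_funM => //; exact: measurable_int ifd.
- apply: emeasurable_funM => //.
  exact: (measurable_int mu (integrable_normal_pdf m s)).
- apply: ae_eqe_mul2l; apply: integral_ae_eq => //.
    exact: (measurable_int mu (integrable_normal_pdf m s)).
  by move=> E _ mE; rewrite -Radon_Nikodym_SigmaFinite.f_integral.
Qed.

Lemma integrable_normal_probP (m s : R) (f : measurableTypeR R -> R) :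
  measurable_fun setT f ->
  mu.-integrable setT (EFin \o (fun x => f x * normal_pdf m s x)) <->
  (normal_prob m s).-integrable setT (EFin \o f).
Proof.
move=> mf.
have E : (\int[normal_prob m s]_x `|(EFin \o f) x| =
          \int[mu]_x `|(EFin \o (fun x => f x * normal_pdf m s x)%R) x|)%E.
  rewrite ge0_integral_normal_prob//; last first.
    by apply: measurableT_comp => //; exact/measurable_EFinP.
  apply: eq_integral => x _ /=.
  by rewrite normrM EFinM (ger0_norm (normal_pdf_ge0 _ _ _)).
split => /integrableP[_ i]; apply/integrableP; split.
- exact/measurable_EFinP.
- by rewrite E.
- apply/measurable_EFinP/measurable_funM => //.
  exact: measurable_normal_pdf.
- by rewrite -E.
Qed.

Lemma Rintegral_normal_prob (m s : R) (f : measurableTypeR R -> R) :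
  measurable_fun setT f ->
  (normal_prob m s).-integrable setT (EFin \o f) ->
  \int[normal_prob m s]_x f x = \int[mu]_x (f x * normal_pdf m s x).
Proof.
move=> mf fi; rewrite /Rintegral; congr fine.
rewrite [LHS]integralE [RHS]integralE; congr (_ - _)%E.
- rewrite ge0_integral_normal_prob//; last first.
    by apply: measurable_funepos; exact/measurable_EFinP.
  apply: eq_integral => x _; rewrite !funeposE /=.
  by rewrite -!EFin_max -EFinM maxr_pMl ?mul0r ?normal_pdf_ge0.
- rewrite ge0_integral_normal_prob//; last first.
    by apply: measurable_funeneg; exact/measurable_EFinP.
  apply: eq_integral => x _; rewrite !funenegE /=.
  by rewrite -!EFin_max -EFinM maxr_pMl ?mul0r ?mulNr ?normal_pdf_ge0.
Qed.

End normal.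

(** * Gaussian integration by parts on the line *)

Section gauss_calculus.
Context {R : realType}.
Local Notation mu := (@lebesgue_measure R).

Definition gauss (x : R) : R := expR (- (x ^+ 2 / 2)).

Lemma gauss_gt0 x : 0 < gauss x. Proof. exact: expR_gt0. Qed.

Lemma normal_pdf01E x : normal_pdf 0 1 x = normal_peak 1 * gauss x.
Proof.
by rewrite normal_pdfE ?oner_neq0// /normal_fun /gauss subr0 expr1n mulNr.
Qed.

Lemma is_derive_gauss (x : R) : is_derive x 1 gauss (- x * gauss x).
Proof.
rewrite /gauss.
have h : is_derive x 1 (fun y : R => - (y ^+ 2 / 2)) (- x).
  apply: is_derive_eq.
  by rewrite /GRing.scale /=; field.
have := @is_derive1_comp _ expR (fun y : R => - (y ^+ 2 / 2)) x _ _ (is_derive_expR _) h.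
by rewrite mulrC.
Qed.

Lemma gauss_le (x : R) : x ^+ 2 * expR (- (x ^+ 2 / 4)) <= 4.
Proof.
have h : 1 + x ^+ 2 / 4 <= expR (x ^+ 2 / 4) by apply: expR_ge1Dx.
rewrite expRN ler_pdivrMr ?expR_gt0//.
by have := sqr_ge0 x; nra.
Qed.

Lemma gaussE2 (x : R) : gauss x = expR (- (x ^+ 2 / 4)) * expR (- (x ^+ 2 / 4)).
Proof. by rewrite /gauss -expRD; congr expR; field. Qed.

Lemma expN_le1 (x : R) : expR (- (x ^+ 2 / 4)) <= 1.
Proof. by rewrite -[leRHS]expR0 ler_expR oppr_le0 divr_ge0// sqr_ge0. Qed.

(** Half of the exponent absorbs the polynomial, which is at most [2 + 2 * x ^+ 2]: this gives 2 + 2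
    * 4 = 10. The other half is kept as an integrable majorant. *)
Lemma norm_gauss_le (x : R) : (1 + `|x| + x ^+ 2) * gauss x <= 10 * expR (- (x ^+ 2 / 4)).
Proof.
have h1 := gauss_le x; have h2 := expN_le1 x.
have h3 : 0 < expR (- (x ^+ 2 / 4)) by exact: expR_gt0.
rewrite gaussE2 mulrA ler_pM2r//.
have : `|x| <= 1 + x ^+ 2.
  rewrite -real_normK ?num_real//; have := normr_ge0 x.
  by move: `|x| => y; nra.
nra.
Qed.

Lemma integrable_expN : mu.-integrable setT (EFin \o (fun x : R => expR (- (x ^+ 2 / 4)))).
Proof.
have s0 : Num.sqrt 2 != 0 :> R by rewrite gt_eqF// sqrtr_gt0.
have := integrable_normal_pdf (0 : R) (Num.sqrt 2).
rewrite normal_pdfE// => /(integrableZl measurableT (normal_peak (Num.sqrt 2))^-1).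
apply: eq_integrable => // x _ /=.
rewrite -EFinM mulrA mulVf ?gt_eqF ?normal_peak_gt0// mul1r /normal_fun subr0.
by rewrite sqr_sqrtr// mulNr -[_ *+ 2]mulr_natr -natrM.
Qed.

Lemma integrable_le_expN (g : R -> R) (C : R) : measurable_fun setT g ->
  (forall x, `|g x| <= C * expR (- (x ^+ 2 / 4))) ->
  mu.-integrable setT (EFin \o g).
Proof.
move=> mg gC.
have := integrableZl measurableT C integrable_expN.
apply: le_integrable => //; first exact/measurable_EFinP.
by move=> x _ /=; rewrite lee_fin (le_trans (gC x))// ler_norm.
Qed.

Lemma is_derive_continuous (G g : R -> R) : (forall x : R, is_derive x 1 G (g x)) -> continuous G.
Proof.
move=> dG x; apply/differentiable_continuous/derivable1_diffP.
exact: (@ex_derive _ _ _ _ _ _ _ (dG x)).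
Qed.

(** Fundamental theorem of calculus on growing symmetric intervals: the bound on [|G x| * |x|] makes
    the boundary terms O(1/n), and the Gaussian bound on [g] lets the truncated integrals converge
    by domination. *)
Lemma Rintegral_derive0 (G g : R -> R) (C : R) :
  (forall x : R, is_derive x 1 G (g x)) -> continuous g ->
  (forall x, `|g x| <= C * expR (- (x ^+ 2 / 4))) ->
  (forall x, `|G x| * `|x| <= C) ->
  \int[mu]_x g x = 0.
Proof.
move=> dG cg gC GC.
have mg : measurable_fun setT g by exact: continuous_measurable_fun.
have ig := integrable_le_expN mg gC.
pose I (n : nat) := `[- n.+1%:R, n.+1%:R]%classic : set R.
have cvgG : (\int[mu]_x ((EFin \o g) \_ (I n)) x @[n --> \oo] -->
             \int[mu]_x (EFin \o g) x)%E.
{ apply: (@dominated_cvg _ _ _ mu _ measurableT (fun n => (EFin \o g) \_ (I n)) (EFin \o g) (abse \o (EFin \o g))).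
  - move=> n; apply/(measurable_restrictT _ _).1; first exact: measurable_itv.
    by apply: measurable_funTS; apply/measurable_EFinP.
  - move=> x _.
    apply: cvg_near_cst.
    near=> n; rewrite patchE mem_set// /I /= in_itv /= -ler_norml.
    apply: le_trans (_ : n%:R <= _); last by rewrite ler_nat.
    by near: n; exact: nbhs_infty_ger.
  - by [].
  - by apply: integrable_abse.
  - move=> n x _; rewrite patchE; case: ifPn => //= _.
    by rewrite lee_fin normr0. }
have E n : (\int[mu]_x ((EFin \o g) \_ (I n)) x = (G n.+1%:R - G (- n.+1%:R))%:E)%E.
{ rewrite -integral_mkcond (@continuous_FTC2 _ g G)//.
  - by rewrite gtrN.
  - exact: continuous_subspaceT.
  - split.
    + by move=> x _; exact: (@ex_derive _ _ _ _ _ _ _ (dG x)).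
    + by apply: cvg_at_right_filter; exact: is_derive_continuous dG _.
    + by apply: cvg_at_left_filter; exact: is_derive_continuous dG _.
  - by move=> x _; rewrite derive1E; exact: (@derive_val _ _ _ _ _ _ _ (dG x)). }
have cvg0 : ((G n.+1%:R - G (- n.+1%:R))%:E @[n --> \oo] --> (0 : R)%:E)%E.
{ apply: cvg_EFin; first exact: nearW.
  apply: norm_cvg0.
  apply: (@squeeze_cvgr _ _ _ _ (cst 0) (fun n : nat => (2 * C) / n.+1%:R)).
  - near=> n; rewrite normr_ge0 /= ler_pdivlMr//.
    apply: le_trans (_ : (`|G n.+1%:R| + `|G (- n.+1%:R)|) * n.+1%:R <= _).
      by rewrite ler_pM2r// ler_normB.
    have := GC n.+1%:R; have := GC (- n.+1%:R).
    by rewrite normrN (ger0_norm (ler0n _ _)); lra.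
  - exact: cvg_cst.
  - rewrite -[X in _ --> X](mulr0 (2 * C)); apply: cvgM; first exact: cvg_cst.
    exact: cvg_harmonic. }
rewrite /Rintegral; have -> // : (\int[mu]_x (EFin \o g) x = 0)%E.
move: cvgG; rewrite (funext E) => cvgG.
exact: (cvg_unique _ cvgG cvg0).
Unshelve. all: by end_near. Qed.

Lemma is_derive_sin_comp (a b x : R) :
  is_derive x 1 (fun y => sin (a * y + b)) (a * cos (a * x + b)).
Proof.
have h : is_derive x 1 (fun y : R => a * y + b) a.
  by apply: is_derive_eq; rewrite /GRing.scale /=; ring.
have := @is_derive1_comp _ sin (fun y : R => a * y + b) x _ _ (is_derive_sin _) h.
by rewrite mulrC.
Qed.

Lemma continuous_cos_comp (a b : R) : continuous (fun y : R => cos (a * y + b)).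
Proof.
move=> y; apply: continuous_comp; last exact: continuous_cos.
by apply: cvgD; [apply: cvgM; [exact: cvg_cst|exact: cvg_id]|exact: cvg_cst].
Qed.

Lemma continuous_sin_comp (a b : R) : continuous (fun y : R => sin (a * y + b)).
Proof.
move=> y; apply: continuous_comp; last exact: continuous_sin.
by apply: cvgD; [apply: cvgM; [exact: cvg_cst|exact: cvg_id]|exact: cvg_cst].
Qed.

Lemma continuous_gauss : continuous gauss.
Proof.
move=> x; apply: continuous_comp; last exact: continuous_expR.
by apply: (@cvgN _ R^o); apply: cvgM; [exact: exprn_continuous|exact: cvg_cst].
Qed.

Lemma gauss_bound (f : R -> R) (c : R) : 0 <= c ->
  (forall x, `|f x| <= c * (1 + `|x| + x ^+ 2)) ->
  forall x, `|f x * gauss x| <= (10 * c) * expR (- (x ^+ 2 / 4)).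
Proof.
move=> c0 fc x; rewrite normrM (gtr0_norm (gauss_gt0 x)).
have h := ler_wpM2l c0 (norm_gauss_le x).
by have := ler_wpM2r (ltW (gauss_gt0 x)) (fc x); lra.
Qed.

Lemma integrable_gauss (f : R -> R) (c : R) : measurable_fun setT f -> 0 <= c ->
  (forall x, `|f x| <= c * (1 + `|x| + x ^+ 2)) ->
  mu.-integrable setT (EFin \o (fun x => f x * gauss x)).
Proof.
move=> mf c0 fc; apply: integrable_le_expN (gauss_bound c0 fc).
apply: measurable_funM => //; exact: continuous_measurable_fun continuous_gauss.
Qed.

(** The difference of the two integrands is the derivative of [G * gauss], whose integral
    vanishes. *)
Lemma Rint_gauss_ibp (G g : R -> R) (c : R) : 0 <= c ->
  (forall x : R, is_derive x 1 G (g x)) -> continuous g ->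
  (forall x, `|g x| <= c * (1 + `|x| + x ^+ 2)) ->
  (forall x, `|G x| <= c * (1 + `|x|)) ->
  \int[mu]_x (x * G x * gauss x) = \int[mu]_x (g x * gauss x).
Proof.
move=> c0 dG cg gc Gc.
have cG := is_derive_continuous dG.
have mG : measurable_fun setT G by exact: continuous_measurable_fun.
have mg : measurable_fun setT g by exact: continuous_measurable_fun.
have dGg (x : R) : is_derive x 1 (G * gauss)%R (g x * gauss x - x * G x * gauss x).
  have := is_deriveM (dG x) (is_derive_gauss x).
  by move/is_derive_eq; apply; rewrite /GRing.scale /=; ring.
have xG (x : R) : `|x * G x| <= (2 * c) * (1 + `|x| + x ^+ 2).
  rewrite normrM -[x ^+ 2]real_normK ?num_real//.
  have := Gc x; have := normr_ge0 x; have := normr_ge0 (G x).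
  move: `|x| `|G x| => u v; move=> v0 u0 vu.
  apply: le_trans (_ : u * (c * (1 + u)) <= _); first by rewrite ler_wpM2l.
  by have := mulr_ge0 c0 u0; have := mulr_ge0 c0 (sqr_ge0 u); nra.
have i1 : mu.-integrable setT (EFin \o (fun x => x * G x * gauss x)).
  apply: (@integrable_gauss _ (2 * c)) => //; last by rewrite mulr_ge0.
  by apply: measurable_funM.
have i2 := integrable_gauss mg c0 gc.
apply/esym/eqP; rewrite -subr_eq0 -RintegralB//; apply/eqP.
(* [10 * c] bounds the term in [g] and [10 * (2 * c)] the term in [x * G x]; the boundary condition
   needs only the latter. *)
apply: (@Rintegral_derive0 (G * gauss)%R _ (30 * c)) => //.
- move=> x; apply: (@cvgB _ R^o).
    by apply: cvgM; [exact: cg|exact: continuous_gauss].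
  by apply: cvgM; [apply: cvgM; [exact: cvg_id|exact: cG]|exact: continuous_gauss].
- move=> x; rewrite (le_trans (ler_normB _ _))//.
  have := gauss_bound (mulr_ge0 (ler0n _ 2) c0) xG x.
  by have := gauss_bound c0 gc x; lra.
- move=> x; rewrite normrM mulrAC -normrM (mulrC (G x)) -normrM.
  rewrite (le_trans (gauss_bound (mulr_ge0 (ler0n _ 2) c0) xG x))//.
  have := mulr_ge0 (mulr_ge0 (ler0n R 20) c0) (expR_ge0 (- (x ^+ 2 / 4))).
  by have := ler_wpM2l (mulr_ge0 (ler0n R 20) c0) (expN_le1 x); lra.
Qed.

End gauss_calculus.

Notation N01 R := (normal_prob (0 : R) 1).

Lemma measurable_cos_comp d (Y : measurableType d) (R : realType) (f : Y -> R) :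
  measurable_fun setT f -> measurable_fun setT (fun y => cos (f y)).
Proof.
by move=> mf; apply: measurableT_comp => //; apply: continuous_measurable_fun; exact: continuous_cos.
Qed.

Lemma cos_le1n (R : realType) (x : R) : `|cos x| <= 1.
Proof. by rewrite ler_norml cos_geN1 cos_le1. Qed.

Lemma sin_le1n (R : realType) (x : R) : `|sin x| <= 1.
Proof. by rewrite ler_norml sin_geN1 sin_le1. Qed.

Lemma integrable_cos d (Y : measurableType d) (R : realType) (P : probability Y R) (f : Y -> R) :
  measurable_fun setT f -> P.-integrable setT (EFin \o (fun w => cos (f w))).
Proof.
move=> mf; apply: (@bounded_integrable _ _ _ _ _ 1); first exact: measurable_cos_comp.
by move=> w; exact: cos_le1n.
Qed.

Section standard_normal.
Context {R : realType}.
Local Notation mu := (@lebesgue_measure R).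

Lemma integrable_N01 (f : R -> R) (c : R) : measurable_fun setT f -> 0 <= c ->
  (forall x, `|f x| <= c * (1 + `|x| + x ^+ 2)) ->
  (N01 R).-integrable setT (EFin \o f).
Proof.
move=> mf c0 fc; apply/integrable_normal_probP => //.
have := integrableZl measurableT (normal_peak 1) (integrable_gauss mf c0 fc).
apply: eq_integrable => // x _ /=.
by rewrite normal_pdf01E mulrCA EFinM.
Qed.

Lemma Rintegral_N01 (f : R -> R) (c : R) : measurable_fun setT f -> 0 <= c ->
  (forall x, `|f x| <= c * (1 + `|x| + x ^+ 2)) ->
  \int[N01 R]_x f x = normal_peak 1 * \int[mu]_x (f x * gauss x).
Proof.
move=> mf c0 fc; rewrite Rintegral_normal_prob//; last exact: integrable_N01 fc.
rewrite -RintegralZl//; last exact: integrable_gauss fc.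
by apply: eq_Rintegral => x _; rewrite normal_pdf01E mulrCA.
Qed.

(** Stein's identity. With [G] the identity or a constant it yields the first two moments, with [G]
    a sine the differential equation of the characteristic function. *)
Lemma N01_ibp (G g : R -> R) (c : R) : 0 <= c ->
  (forall x : R, is_derive x 1 G (g x)) -> continuous g ->
  (forall x, `|g x| <= c * (1 + `|x|)) ->
  (forall x, `|G x| <= c * (1 + `|x|)) ->
  \int[N01 R]_x (x * G x) = \int[N01 R]_x g x.
Proof.
move=> c0 dG cg gc Gc.
have gc' (x : R) : `|g x| <= c * (1 + `|x| + x ^+ 2).
  by rewrite (le_trans (gc x))// ler_wpM2l// lerDl sqr_ge0.
have cG := is_derive_continuous dG.
have mG : measurable_fun setT G by exact: continuous_measurable_fun.
have mg : measurable_fun setT g by exact: continuous_measurable_fun.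
rewrite (Rintegral_N01 mg c0 gc') -(Rint_gauss_ibp c0 dG cg gc' Gc).
apply: (@Rintegral_N01 _ (2 * c)) => //; first exact: measurable_funM.
  by rewrite mulr_ge0.
move=> x; rewrite normrM -[x ^+ 2]real_normK ?num_real//.
have := ler_wpM2l (normr_ge0 x) (Gc x).
have := mulr_ge0 c0 (normr_ge0 x); have := mulr_ge0 c0 (sqr_ge0 `|x|); nra.
Qed.

Lemma N01_sq : \int[N01 R]_x (x ^+ 2) = 1.
Proof.
under eq_Rintegral do rewrite expr2.
rewrite (@N01_ibp id (cst 1) 1)//.
- by rewrite Rint_cst.
- exact: cst_continuous.
- by move=> x; rewrite normr1 mul1r lerDl.
- by move=> x; rewrite mul1r lerDr.
Qed.

Lemma N01_id : \int[N01 R]_x x = 0.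
Proof.
transitivity (\int[N01 R]_x (x * 1)); first by under [RHS]eq_Rintegral do rewrite mulr1.
rewrite (@N01_ibp (cst 1) (cst 0) 1)//.
- by rewrite Rint_cst.
- exact: cst_continuous.
- by move=> x; rewrite normr0 mul1r addr_ge0.
- by move=> x; rewrite normr1 mul1r lerDl.
Qed.

Lemma integrable_N01_id : (N01 R).-integrable setT (EFin \o (fun x : R => x)).
Proof.
by apply: (@integrable_N01 _ 1) => // x; rewrite mul1r; have := sqr_ge0 x; lra.
Qed.

Lemma integrable_N01_sq : (N01 R).-integrable setT (EFin \o (fun x : R => x ^+ 2)).
Proof.
apply: (@integrable_N01 _ 1) => //.
by move=> x; rewrite mul1r ger0_norm ?sqr_ge0// lerDr addr_ge0.
Qed.

Lemma N01_xsin (a p : R) :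
  \int[N01 R]_x (x * sin (a * x + p)) = a * \int[N01 R]_x cos (a * x + p).
Proof.
have dG (x : R) := is_derive_sin_comp a p x.
have c0 : 0 <= 1 + `|a| by rewrite addr_ge0.
rewrite (_ : _ * _ = \int[N01 R]_x (a * cos (a * x + p))); last first.
  by rewrite RintegralZl//; apply: integrable_cos; apply: measurable_funD => //; exact: measurable_funM.
apply: (@N01_ibp _ _ _ c0 dG).
- by move=> x; apply: cvgM; [exact: cvg_cst|exact: continuous_cos_comp].
- move=> x; rewrite normrM.
  have := ler_wpM2l (normr_ge0 a) (cos_le1n (a * x + p)).
  have := mulr_ge0 (normr_ge0 a) (normr_ge0 x).
  by have := normr_ge0 x; nra.
- move=> x; have := sin_le1n (a * x + p).
  have := mulr_ge0 (normr_ge0 a) (normr_ge0 x).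
  by have := normr_ge0 x; have := normr_ge0 a; nra.
Qed.

(** Differentiating under the integral, with the dominating function [|x|], and integrating by parts
    gives F' = - b F for the left-hand side [F] as a function of the frequency b. Hence F(b) exp(b^2
    / 2) is constant, equal to its value [cos p] at 0. *)
Lemma N01_cos (a p : R) :
  \int[N01 R]_x cos (a * x + p) = cos p * expR (- (a ^+ 2 / 2)).
Proof.
pose F (b : R) := \int[N01 R]_x cos (b * x + p).
pose f (b x : R) := cos (b * x + p).
have df (b x : R) : is_derive b 1 (f ^~ x) (- x * sin (b * x + p)).
{ have h : is_derive b 1 (fun y : R => y * x + p) x.
    by apply: is_derive_eq; rewrite /GRing.scale /=; ring.
  have := @is_derive1_comp _ cos (fun y : R => y * x + p) b _ _ (is_derive_cos _) h.
  by rewrite !mulNr (mulrC (sin _)). }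
have d1f (b x : R) : partial1of2 f b x = - x * sin (b * x + p).
  by rewrite partial1of2E; exact: (@derive_val _ _ _ _ _ _ _ (df b x)).
have mid : measurable_fun setT (@id R) by exact: measurable_id.
have iabs := integrable_abse integrable_N01_id.
have fi (b : R) : (N01 R).-integrable setT (EFin \o f b).
  by apply: integrable_cos; apply: measurable_funD => //; exact: measurable_funM.
have dF (b : R) : is_derive b 1 F (- b * F b).
{ have bI : `]b - 1, b + 1[%classic b by rewrite /= in_itv /= ltrBlDr ltrDl ltr01.
  have gub (x y : R) : `]b - 1, b + 1[%classic x -> setT y -> `|partial1of2 f x y| <= `|y|.
    move=> _ _; rewrite d1f normrM normrN ler_piMr//; exact: sin_le1n.
  have der : forall x y : R, `]b - 1, b + 1[%classic x -> setT y -> derivable (f ^~ y) x 1.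
    by move=> x y _ _; exact: (@ex_derive _ _ _ _ _ _ _ (df x y)).
  have i1 : forall x, `]b - 1, b + 1[%classic x -> (N01 R).-integrable setT (EFin \o f x).
    by move=> x _; exact: fi.
  have D := derivable_under_integral measurableT bI i1 der
    (fun y : R => normr_ge0 y) iabs gub.
  have E := differentiation_under_integral measurableT bI i1 der
    (fun y : R => normr_ge0 y) iabs gub.
  apply: DeriveDef; first exact: D.
  rewrite -derive1E E.
  under eq_Rintegral do rewrite d1f mulNr -mulN1r.
  rewrite RintegralZl//; first by rewrite N01_xsin mulN1r mulNr.
  apply: le_integrable iabs => //.
    apply/measurable_EFinP; apply: measurable_funM => //.
    by apply: continuous_measurable_fun; exact: continuous_sin_comp.
  move=> x _ /=; rewrite lee_fin normr_id normrM ler_piMr//; exact: sin_le1n. }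
pose D (b : R) := F b * expR (b ^+ 2 / 2).
have dD (b : R) : is_derive b 1 D 0.
{ have h : is_derive b 1 (fun y : R => y ^+ 2 / 2) b.
    by apply: is_derive_eq; rewrite /GRing.scale /=; field.
  have h2 := @is_derive1_comp _ expR (fun y : R => y ^+ 2 / 2) b _ _ (is_derive_expR _) h.
  have := is_deriveM (dF b) h2.
  by move/is_derive_eq; apply; rewrite /GRing.scale /=; ring. }
have := @is_derive_0_is_cst _ D a 0 dD.
rewrite /D expr0n /= mul0r expR0 mulr1.
have -> : F 0 = cos p.
  rewrite /F; under eq_Rintegral do rewrite mul0r add0r.
  by rewrite Rint_cst.
by move=> <-; rewrite -mulrA -expRD subrr expR0 mulr1.
Qed.

Lemma ge0_integral_normal_affine (m s : R) (f : R -> R) : 0 < s ->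
  continuous f -> (forall x, 0 <= f x) ->
  (\int[normal_prob m s]_x (f x)%:E = \int[N01 R]_x (f (m + s * x))%:E)%E.
Proof.
move=> s0 cf f0.
have mf : measurable_fun setT f by exact: continuous_measurable_fun.
have ca : continuous (fun x : R => m + s * x).
  by move=> x; apply: cvgD; [exact: cvg_cst|apply: cvgM; [exact: cvg_cst|exact: cvg_id]].
have cfa : continuous (fun x : R => f (m + s * x)).
  by move=> x; apply: continuous_comp; [exact: ca|exact: cf].
have mfa : measurable_fun setT (fun x : R => f (m + s * x)) by exact: continuous_measurable_fun.
rewrite ge0_integral_normal_prob; [|exact/measurable_EFinP|by move=> x; rewrite lee_fin].
rewrite ge0_integral_normal_prob; [|exact/measurable_EFinP|by move=> x; rewrite lee_fin].
have cG : continuous (f \* normal_pdf m s).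
  move=> x; apply: cvgM; [exact: cf|apply: continuous_normal_pdf].
  by rewrite gt_eqF.
have da (x : R) : is_derive x 1 (fun x : R => m + s * x) s.
  by apply: is_derive_eq; rewrite /GRing.scale /=; ring.
have dE : derive1 (fun x : R => m + s * x) = cst s.
  by apply/funext => x; rewrite derive1E; exact: (@derive_val _ _ _ _ _ _ _ (da x)).
have affE : (fun x : R => m + s * x) = (fun x : R => (x + m / s) * s).
  by apply/funext => x; rewrite mulrDl divfK ?gt_eqF// addrC mulrC.
have := @increasing_ge0_integration_by_substitutionT _ (fun x : R => m + s * x) (f \* normal_pdf m s).
rewrite dE => h.
transitivity (\int[mu]_x ((f \* normal_pdf m s) x)%:E)%E.
  by apply: eq_integral => x _; rewrite -EFinM.
rewrite h.
- apply: eq_integral => x _; rewrite -EFinM; congr (_%:E).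
  change (f (m + s * x) * normal_pdf m s (m + s * x) * s =
          f (m + s * x) * normal_pdf 0 1 x).
  rewrite -mulrA; congr (_ * _).
  rewrite !normal_pdfE ?gt_eqF ?oner_neq0// /normal_fun /normal_peak.
  rewrite expr1n mul1r -mulrnAr sqrtrM ?sqr_ge0// sqrtr_sqr gtr0_norm//.
  have -> : - (m + s * x - m) ^+ 2 / (s ^+ 2 *+ 2) = - (x - 0) ^+ 2 / (1 *+ 2).
    by rewrite subr0; field; rewrite gt_eqF.
  by rewrite invfM mulrAC (mulrC s^-1) mulfVK ?gt_eqF.
- by move=> x y xy; rewrite ltrD2l ltr_pM2l.
- exact: cst_continuous.
- exact: is_cvg_cst.
- exact: is_cvg_cst.
- by move=> x; exact: (@ex_derive _ _ _ _ _ _ _ (da x)).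
- rewrite affE; apply/gt0_cvgMlNy => //; exact: cvg_addrr_Ny.
- rewrite affE; apply/gt0_cvgMly => //; exact: cvg_addrr.
- exact: cG.
- by move=> x; rewrite /= mulr_ge0// normal_pdf_ge0.
Qed.

Lemma maxr0_continuous (f : R -> R) : continuous f ->
  continuous (fun x => Num.max (f x) 0).
Proof.
move=> cf; rewrite (_ : (fun x => _) = (fun x => (f x + `|f x|) / 2)); last first.
  by apply/funext => x; rewrite maxr_absE addr0 subr0.
move=> x; apply: cvgM; last exact: cvg_cst.
by apply: (@cvgD _ R^o); [exact: cf|apply: cvg_norm; exact: cf].
Qed.

Lemma Rintegral_normal_affine (m s : R) (f : R -> R) : 0 < s -> continuous f ->
  \int[normal_prob m s]_x f x = \int[N01 R]_x f (m + s * x).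
Proof.
move=> s0 cf; rewrite /Rintegral.
suff -> : (\int[normal_prob m s]_x (f x)%:E = \int[N01 R]_x (f (m + s * x))%:E)%E by [].
have Ep : (\int[normal_prob m s]_x ((fun x => (f x)%:E)^\+ x) =
           \int[N01 R]_x ((fun x => (f (m + s * x))%:E)^\+ x))%E.
{ under [LHS]eq_integral do rewrite funeposE -EFin_max.
  under [RHS]eq_integral do rewrite funeposE -EFin_max.
  apply: (@ge0_integral_normal_affine m s (fun x => Num.max (f x) 0) s0).
  - exact: maxr0_continuous.
  - by move=> x; rewrite le_max lexx orbT. }
have En : (\int[normal_prob m s]_x ((fun x => (f x)%:E)^\- x) =
           \int[N01 R]_x ((fun x => (f (m + s * x))%:E)^\- x))%E.
{ under [LHS]eq_integral do rewrite funenegE -EFin_max.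
  under [RHS]eq_integral do rewrite funenegE -EFin_max.
  apply: (@ge0_integral_normal_affine m s (fun x => Num.max (- f x) 0) s0).
  - by apply: maxr0_continuous => x; apply: (@cvgN _ R^o); exact: cf.
  - by move=> x; rewrite le_max lexx orbT. }
by rewrite [LHS]integralE [RHS]integralE Ep En.
Qed.

End standard_normal.

(** * Characteristic functions determine laws *)

Section fubini.
Context {d1 d2 : measure_display} {Y1 : measurableType d1} {Y2 : measurableType d2}.
Context {R : realType} (P : probability Y1 R) (Q : probability Y2 R).

(** Integrability of every section, not just of almost every one, makes each inner integral finite,
    so that [fine] can be undone pointwise inside the outer integral. *)
Lemma Rfubini1 (f : Y1 * Y2 -> R) :
  (P \x Q)%E.-integrable setT (EFin \o f) ->
  (forall x, Q.-integrable setT (fun y => (f (x, y))%:E)) ->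
  \int[(P \x Q)%E]_z f z = \int[P]_x \int[Q]_y f (x, y).
Proof.
move=> fi fxi; rewrite /Rintegral -(integral12_prod_meas1 fi); congr fine.
by apply: eq_integral => x _; rewrite /fubini_F /= fineK// integrable_fin_num.
Qed.

Lemma Rfubini1_bounded (f : Y1 * Y2 -> R) (M : R) :
  measurable_fun setT f -> (forall z, `|f z| <= M) ->
  \int[(P \x Q)%E]_z f z = \int[P]_x \int[Q]_y f (x, y).
Proof.
move=> mf fM; apply: Rfubini1; first exact: (@bounded_integrable _ _ _ (P \x Q)%E _ M).
move=> x; apply: (@bounded_integrable _ _ _ _ (fun y => f (x, y)) M) => //.
exact: measurableT_comp.
Qed.

Lemma Rfubini2_bounded (f : Y1 * Y2 -> R) (M : R) :
  measurable_fun setT f -> (forall z, `|f z| <= M) ->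
  \int[(P \x Q)%E]_z f z = \int[Q]_y \int[P]_x f (x, y).
Proof.
move=> mf fM; have fi := @bounded_integrable _ _ _ (P \x Q)%E _ M mf fM.
rewrite /Rintegral -(integral21_prod_meas1 fi); congr fine.
apply: eq_integral => y _; rewrite /fubini_G /= fineK// integrable_fin_num//.
by apply: (@bounded_integrable _ _ _ _ (fun x => f (x, y)) M) => //; exact: measurableT_comp.
Qed.

Lemma measurable_fun_fst (f : Y1 -> R) : measurable_fun setT f ->
  measurable_fun setT (fun z : Y1 * Y2 => f z.1).
Proof. by move=> mf; apply: measurableT_comp. Qed.

Lemma measurable_fun_snd (f : Y2 -> R) : measurable_fun setT f ->
  measurable_fun setT (fun z : Y1 * Y2 => f z.2).
Proof. by move=> mf; apply: measurableT_comp. Qed.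

Lemma integrable_fst (f : Y1 -> R) : P.-integrable setT (EFin \o f) ->
  (P \x Q)%E.-integrable setT (EFin \o (fun w => f w.1)).
Proof.
move=> /integrableP[/measurable_EFinP mf fi]; apply/integrable12ltyP.
  by apply/measurable_EFinP; exact: measurable_fun_fst.
rewrite (_ : (fun x => _) = (fun x => `|(f x)%:E|%E))//.
apply/funext => x; rewrite -[RHS]mule1 -(@probability_setT _ _ _ Q).
by rewrite -integral_cst.
Qed.

Lemma integrable_snd (f : Y2 -> R) : Q.-integrable setT (EFin \o f) ->
  (P \x Q)%E.-integrable setT (EFin \o (fun w => f w.2)).
Proof.
move=> /integrableP[/measurable_EFinP mf fi]; apply/integrable21ltyP.
  by apply/measurable_EFinP; exact: measurable_fun_snd.
rewrite (_ : (fun x => _) = (fun x => `|(f x)%:E|%E))//.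
apply/funext => x; rewrite -[RHS]mule1 -(@probability_setT _ _ _ P).
by rewrite -integral_cst.
Qed.

End fubini.

Lemma measurable_lin d (Y : measurableType d) (R : realType) (I : finType)
    (a : I -> R) (X : I -> Y -> R) (p : R) : (forall i, measurable_fun setT (X i)) ->
  measurable_fun setT (fun y => \sum_i a i * X i y + p).
Proof.
move=> mX; apply: measurable_funD => //.
by apply: measurable_sum => i; apply: measurable_funM.
Qed.

Lemma measurable_prod_comp d (Y : measurableType d) (R : realType) (I : finType)
    (psi : I -> Y -> R) : (forall i, measurable_fun setT (psi i)) ->
  measurable_fun setT (fun y => \prod_i psi i y).
Proof. by move=> mX; apply: measurable_prod => i _; exact: mX. Qed.

Lemma prod_01 (R : realType) (I : finType) (f : I -> R) :
  (forall i, 0 <= f i <= 1) -> 0 <= \prod_i f i <= 1.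
Proof.
move=> h; apply/andP; split; first by apply: prodr_ge0 => i _; case/andP: (h i).
by apply: prodr_ile1 => i _; exact: h.
Qed.

Lemma norm01 (R : realType) (x : R) : 0 <= x <= 1 -> `|x| <= 1.
Proof. by case/andP => x0 x1; rewrite ger0_norm. Qed.

Lemma sum_unit (V : nmodType) (f : unit -> V) : \sum_i f i = f tt.
Proof. by rewrite (big_pred1 tt)//; case. Qed.

Lemma measurable_rays_in d (Y : measurableType d) (R : realType) (I : finType) (A : pred I)
    (X : I -> Y -> R) (r : I -> R) : (forall i, measurable_fun setT (X i)) ->
  measurable [set w | forall i, A i -> X i w < r i].
Proof.
move=> mX; rewrite [X in measurable X](_ : _ = \bigcap_(i in [set: I])
    (if A i then X i @^-1` `]-oo, r i[%classic else setT)).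
  apply: fin_bigcap_measurable => // i _; case: (A i) => //.
  rewrite -[X in measurable X]setTI; exact: mX.
apply/seteqP; split => w /= h i.
  by move=> _; case: ifP => // Ai; rewrite /= in_itv /=; exact: h.
by move=> Ai; have := h i Logic.I; rewrite Ai /= in_itv.
Qed.

Lemma measurable_rays d (Y : measurableType d) (R : realType) (I : finType)
    (X : I -> Y -> R) (r : I -> R) : (forall i, measurable_fun setT (X i)) ->
  measurable [set w | forall i, X i w < r i].
Proof.
move=> mX; have := measurable_rays_in predT r mX.
by congr measurable; apply/seteqP; split => w h i; [exact: h|move=> _; exact: h].
Qed.

(** The space is a product to which each induction step adds one factor [N01 R], read by the
    coordinate [ord0]. Independence is recorded in two forms: the joint characteristic function and
    the factorisation of expectations of products. *)
Lemma iid_normal_ord (R : realType) (n : nat) :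
  exists (d : measure_display) (Y : measurableType d) (P : probability Y R)
    (zeta : 'I_n -> Y -> R),
  [/\ forall i, measurable_fun setT (zeta i),
      forall (a : 'I_n -> R) (p : R),
        \int[P]_w cos (\sum_i a i * zeta i w + p) =
        cos p * expR (- ((\sum_i a i ^+ 2) / 2)) &
      forall psi : 'I_n -> R -> R, (forall i, measurable_fun setT (psi i)) ->
        (forall i x, 0 <= psi i x <= 1) ->
        \int[P]_w (\prod_i psi i (zeta i w)) = \prod_i \int[N01 R]_x psi i x].
Proof.
elim: n => [|n [d [Y [P [zeta [mz cz iz]]]]]].
- exists _, (measurableTypeR R), (N01 R), (fun _ _ => 0); split.
  + by case.
  + move=> a p; under eq_Rintegral do rewrite big_ord0 add0r.
    by rewrite Rint_cst big_ord0 mul0r oppr0 expR0 mulr1.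
  + move=> psi _ _; under eq_Rintegral do rewrite big_ord0.
    by rewrite Rint_cst big_ord0.
- pose zeta' (i : 'I_n.+1) (w : Y * measurableTypeR R) : R :=
    if unlift ord0 i is Some j then zeta j w.1 else w.2.
  have mz' i : measurable_fun setT (zeta' i).
  { rewrite /zeta'; case: (unlift ord0 i) => [j|]; first exact: measurable_fun_fst.
    exact: measurable_snd. }
  exists _, (Y * measurableTypeR R)%type, (P \x N01 R)%E, zeta'; split => //.
  + move=> a p.
    rewrite (@Rfubini2_bounded _ _ _ _ _ P (N01 R) _ 1).
    * under eq_Rintegral => y _.
        under eq_Rintegral => x _.
          rewrite big_ord_recl /zeta' /= unlift_none.
          under eq_bigr do rewrite liftK.
          rewrite addrAC addrC.
          over.
        rewrite cz.
        over.
      rewrite /= RintegralZr//; last first.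
        by apply: integrable_cos; apply: measurable_funD => //; exact: measurable_funM.
      rewrite N01_cos -mulrA -expRD big_ord_recl; congr (_ * expR _); lra.
    * by apply: measurable_cos_comp; apply: measurable_lin.
    * by move=> z; exact: cos_le1n.
  + move=> psi mpsi psi01.
    have mc i : measurable_fun setT (fun w => psi i (zeta' i w)) by exact: measurableT_comp.
    rewrite (@Rfubini2_bounded _ _ _ _ _ P (N01 R) _ 1).
    * under eq_Rintegral => y _.
        under eq_Rintegral => x _.
          rewrite big_ord_recl /zeta' /= unlift_none.
          under eq_bigr do rewrite liftK.
          over.
        rewrite /= RintegralZl//; last first.
          apply: (@bounded_integrable _ _ _ _ _ 1).
            by apply: measurable_prod_comp => i; exact: measurableT_comp.
          by move=> x; apply: norm01; apply: prod_01.
        rewrite (iz (fun i => psi (lift ord0 i)))//.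
        over.
      rewrite /= RintegralZr//; last first.
        apply: (@bounded_integrable _ _ _ _ _ 1); first exact: mpsi.
        by move=> x; apply: norm01.
      by rewrite [RHS]big_ord_recl.
    * exact: measurable_prod_comp.
    * by move=> z; apply: norm01; apply: prod_01.
Qed.

Lemma iid_normal (R : realType) (I : finType) :
  exists (d : measure_display) (Y : measurableType d) (P : probability Y R)
    (zeta : I -> Y -> R),
  [/\ forall i, measurable_fun setT (zeta i),
      forall (a : I -> R) (p : R),
        \int[P]_w cos (\sum_i a i * zeta i w + p) =
        cos p * expR (- ((\sum_i a i ^+ 2) / 2)) &
      forall psi : I -> R -> R, (forall i, measurable_fun setT (psi i)) ->
        (forall i x, 0 <= psi i x <= 1) ->
        \int[P]_w (\prod_i psi i (zeta i w)) = \prod_i \int[N01 R]_x psi i x].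
Proof.
have [d [Y [P [zeta [mz cz iz]]]]] := iid_normal_ord R #|I|.
exists d, Y, P, (fun i => zeta (enum_rank i)); split => //.
- move=> a p; have := cz (a \o enum_val) p.
  rewrite -(big_enum_val (fun i => a i ^+ 2)) => <-.
  apply: eq_Rintegral => w _; rewrite (reindex (fun j : 'I_#|I| => enum_val j))/=; last exact: onW_bij (@enum_val_bij I).
  by under eq_bigr do rewrite enum_valK.
- move=> psi mpsi psi01; have := iz (psi \o enum_val) (fun i => mpsi _) (fun i => psi01 _).
  rewrite -(big_enum_val (fun i => \int[N01 R]_x psi i x)) => <-.
  apply: eq_Rintegral => w _; rewrite (reindex (fun j : 'I_#|I| => enum_val j))/=; last exact: onW_bij (@enum_val_bij I).
  by under eq_bigr do rewrite enum_valK.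
Qed.
Lemma bounded_integrable01 d (Y : measurableType d) (R : realType) (P : probability Y R)
    (f : Y -> R) : measurable_fun setT f -> (forall x, 0 <= f x <= 1) ->
  P.-integrable setT (EFin \o f).
Proof. by move=> mf f01; apply: (@bounded_integrable _ _ _ _ _ 1) => // x; exact: norm01. Qed.

Lemma Rint01Zl d (Y : measurableType d) (R : realType) (P : probability Y R)
    (c : R) (f : Y -> R) : measurable_fun setT f -> (forall x, 0 <= f x <= 1) ->
  \int[P]_x (c * f x) = c * \int[P]_x f x.
Proof. by move=> mf f01; rewrite RintegralZl//; exact: bounded_integrable01. Qed.

Lemma Rint01Zr d (Y : measurableType d) (R : realType) (P : probability Y R)
    (c : R) (f : Y -> R) : measurable_fun setT f -> (forall x, 0 <= f x <= 1) ->
  \int[P]_x (f x * c) = (\int[P]_x f x) * c.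
Proof. by move=> mf f01; rewrite RintegralZr//; exact: bounded_integrable01. Qed.

Lemma gauss01 (R : realType) (x : R) : 0 <= gauss x <= 1.
Proof.
rewrite expR_ge0 /= -[leRHS]expR0 ler_expR oppr_le0 divr_ge0//; exact: sqr_ge0.
Qed.

Lemma measurable_gauss_comp d (Y : measurableType d) (R : realType) (f : Y -> R) :
  measurable_fun setT f -> measurable_fun setT (fun y => gauss (f y)).
Proof.
by move=> mf; apply: measurableT_comp => //; apply: continuous_measurable_fun; exact: continuous_gauss.
Qed.

Lemma cvg_sqr (R : realType) (u : nat -> R) (l : R) :
  u @ \oo --> l -> (u n ^+ 2) @[n --> \oo] --> l ^+ 2.
Proof.
move=> ul; have -> : (fun n => u n ^+ 2) = (fun n => u n * u n) by apply/funext => n; rewrite expr2.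
by rewrite expr2; apply: cvgM.
Qed.

Section characteristic_function.
Context {R : realType}.

(* The product of Gaussian bumps is an average of plane waves: its expectation
   is an average of the characteristic function. *)
Lemma bump_cf {d d' : measure_display} {Y : measurableType d} {V : measurableType d'}
    {I : finType} (P : probability Y R) (Q : probability V R)
    (X : I -> Y -> R) (zeta : I -> V -> R) (k c : I -> R) :
  (forall i, measurable_fun setT (X i)) ->
  (forall i, measurable_fun setT (zeta i)) ->
  (forall (a : I -> R) (p : R), \int[Q]_v cos (\sum_i a i * zeta i v + p) =
     cos p * expR (- ((\sum_i a i ^+ 2) / 2))) ->
  \int[P]_w (\prod_i gauss (k i * (X i w - c i))) =
  \int[Q]_v \int[P]_w cos (\sum_i (k i * zeta i v) * X i w +
                           - \sum_i k i * zeta i v * c i).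
Proof.
move=> mX mz cz.
pose f (u : Y * V) := cos (\sum_i (k i * zeta i u.2) * X i u.1 + - \sum_i k i * zeta i u.2 * c i).
have mf : measurable_fun setT f.
{ apply: measurable_cos_comp; apply: measurable_funB.
    apply: measurable_sum => i; apply: measurable_funM; last exact: measurable_fun_fst.
    by apply: measurable_funM => //; exact: measurable_fun_snd.
  apply: measurable_sum => i; apply: measurable_funM => //.
  by apply: measurable_funM => //; exact: measurable_fun_snd. }
have f1 z : `|f z| <= 1 by exact: cos_le1n.
rewrite -(@Rfubini2_bounded _ _ _ _ _ P Q f 1)// (@Rfubini1_bounded _ _ _ _ _ P Q f 1)//.
apply: eq_Rintegral => w _ /=.
(* [gauss] is its own characteristic function up to a constant: the product of bumps is the
   characteristic function of [zeta] at the frequencies [k i * (X i w - c i)], with phase 0. *)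
have -> : \prod_i gauss (k i * (X i w - c i)) =
    cos 0 * expR (- ((\sum_i (k i * (X i w - c i)) ^+ 2) / 2)).
  by rewrite cos0 mul1r mulr_suml -sumrN expR_sum.
rewrite -cz; apply: eq_Rintegral => v _; congr cos.
rewrite addr0 -sumrB; apply: eq_bigr => i _; ring.
Qed.

Lemma normal_pdf_gauss (m s c : R) : 0 < s ->
  normal_pdf m s c = normal_peak s * gauss (s^-1 * (m - c)).
Proof.
move=> s0; rewrite normal_pdfE ?gt_eqF// /normal_fun /gauss; congr (_ * expR _).
by rewrite -(mulr_natr (s ^+ 2)); field; rewrite gt_eqF.
Qed.

(** Chebyshev's inequality: [((c - m) / e) ^+ 2] is at least 1 on [A]. *)
Lemma normal_prob_tail (m s e : R) (A : set R) : 0 < s -> 0 < e -> measurable A ->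
  (forall c, A c -> e <= `|c - m|) -> (normal_prob m s A <= ((s / e) ^+ 2)%:E)%E.
Proof.
move=> s0 e0 mA Ae.
have mf : measurable_fun setT (fun c : R => ((c - m) / e) ^+ 2).
  by apply: measurable_funX; apply: measurable_funM => //; exact: measurable_funB.
have cf : continuous (fun c : R => ((c - m) / e) ^+ 2).
  move=> c; apply: (@continuous_comp _ _ _ (fun c : R => (c - m) / e) (fun x : R => x ^+ 2)).
    by apply: cvgM; [apply: (@cvgB _ R^o); [exact: cvg_id|exact: cvg_cst]|exact: cvg_cst].
  exact: exprn_continuous.
rewrite -[leLHS]mul1e -(integral_cst (normal_prob m s) mA).
apply: le_trans (_ : (\int[normal_prob m s]_(c in A) (((c - m) / e) ^+ 2)%:E <= _)%E).
{ apply: ge0_le_integral => //.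
  - by apply: measurable_funTS; apply/measurable_EFinP.
  - move=> x Ax; rewrite lee_fin -real_normK ?num_real// normf_div (gtr0_norm e0).
    rewrite -[leLHS](expr1n _ 2) ler_sqr ?nnegrE ?divr_ge0 ?(ltW e0)//.
    by rewrite ler_pdivlMr// mul1r; exact: Ae. }
apply: le_trans (_ : (\int[normal_prob m s]_c (((c - m) / e) ^+ 2)%:E <= _)%E).
{ apply: ge0_subset_integral => //.
  - by apply/measurable_EFinP.
  - by move=> x _; rewrite lee_fin sqr_ge0. }
rewrite (@ge0_integral_normal_affine _ m s (fun c : R => ((c - m) / e) ^+ 2))//; last first.
  by move=> x; exact: sqr_ge0.
under eq_integral => x _ do rewrite addrAC subrr add0r mulrAC exprMn.
have i2 := @integrable_N01_sq R.
under eq_integral do rewrite EFinM.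
rewrite integralZl// -[X in (_ * X)%E]fineK ?integrable_fin_num//.
by have := @N01_sq R; rewrite /Rintegral => ->; rewrite mule1.
Qed.

End characteristic_function.

Section smoothing.
Context {R : realType} {d : measure_display} {Y : measurableType d} (P : probability Y R).
Variables (h X : Y -> R).
Hypotheses (mh : measurable_fun setT h) (mX : measurable_fun setT X).
Hypothesis h01 : forall w, 0 <= h w <= 1.
Local Notation mu := (@lebesgue_measure R).

(** For fixed [w], [normal_prob (X w) s A] is the chance that [X w] plus an independent noise of
    standard deviation [s] falls in [A]. Tonelli's theorem turns its expectation into an integral,
    over centres in [A], of expectations of bumps. *)
Lemma smoothing_fubini (s : R) (A : set R) : 0 < s -> measurable A ->
  measurable_fun setT (fun w => (h w)%:E * normal_prob (X w) s A)%E /\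
  (\int[P]_w ((h w)%:E * normal_prob (X w) s A) =
  \int[mu]_(c in A) ((normal_peak s)%:E *
    (\int[P]_w (h w * gauss (s^-1 * (X w - c)))%:E)))%E.
Proof.
move=> s0 mA.
pose f (z : Y * measurableTypeR R) : \bar R :=
  (h z.1 * (\1_A z.2 * (normal_peak s * gauss (s^-1 * (X z.1 - z.2)))))%:E.
have h0 w : 0 <= h w by case/andP: (h01 w).
have mf : measurable_fun setT f.
{ apply/measurable_EFinP; apply: measurable_funM; first exact: measurable_fun_fst.
  apply: measurable_funM.
    by apply: measurable_fun_snd; exact: measurable_indic.
  apply: measurable_funM => //; apply: measurable_gauss_comp.
  apply: measurable_funM => //; apply: measurable_funB.
    exact: measurable_fun_fst.
  exact: measurable_snd. }
have f0 z : (0 <= f z)%E.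
  by rewrite lee_fin !mulr_ge0// ?normal_peak_ge0// ?ltW ?gauss_gt0.
have FE : (fun w => \int[mu]_c f (w, c))%E =
          (fun w => (h w)%:E * normal_prob (X w) s A)%E.
{ apply/funext => w; rewrite /f /=.
  under eq_integral do rewrite EFinM.
  rewrite ge0_integralZl//.
  - congr (_ * _)%E; rewrite /normal_prob [RHS]integral_mkcond.
    apply: eq_integral => c _; rewrite patchE indicE.
    by case: ifPn => cA; rewrite ?mul1r ?mul0r// normal_pdf_gauss.
  - apply/measurable_EFinP; apply: measurable_funM; first exact: measurable_indic.
    apply: measurable_funM => //; apply: measurable_gauss_comp.
    by apply: measurable_funM => //; apply: measurable_funB.
  - by move=> c _; rewrite lee_fin !mulr_ge0// ?normal_peak_ge0// ?ltW ?gauss_gt0.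
  - by rewrite lee_fin. }
split; first by rewrite -FE; exact: (@measurable_fun_fubini_tonelli_F _ _ _ _ _ mu).
rewrite -FE (@fubini_tonelli _ _ _ _ _ P mu f mf f0) [RHS]integral_mkcond.
apply: eq_integral => c _; rewrite patchE /f /=.
case: ifPn => cA; last first.
  by rewrite integral0_eq// => w _; rewrite indicE (negbTE cA) mul0r mulr0.
rewrite -ge0_integralZl//.
- by apply: eq_integral => w _; rewrite indicE cA mul1r mulrCA EFinM.
- apply/measurable_EFinP; apply: measurable_funM => //; apply: measurable_gauss_comp.
  by apply: measurable_funM => //; apply: measurable_funB.
- by move=> w _; rewrite lee_fin mulr_ge0// ltW ?gauss_gt0.
- by rewrite lee_fin normal_peak_ge0.
Qed.

(** The noise scale [n.+1%:R ^- 2] is much smaller than the distance [n.+1%:R^-1] by which the ray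
    is shortened, so Chebyshev's inequality decides every case. Without shortening, the limit at
    [X w = r] would be 1/2 instead of 0. *)
Lemma smoothing_cvg (r : R) :
  (\int[P]_w ((h w)%:E * normal_prob (X w) (n.+1%:R ^- 2) `]-oo, (r - n.+1%:R^-1)%R[%classic)
    @[n --> \oo] --> \int[P]_w (h w * \1_(`]-oo, r[%classic) (X w))%:E)%E.
Proof.
have h0 w : 0 <= h w by case/andP: (h01 w).
have n0 (n : nat) : 0 < n.+1%:R^-1 :> R by rewrite invr_gt0.
have n20 (n : nat) : 0 < n.+1%:R^-2 :> R by rewrite invr_gt0 exprn_gt0.
have cvg1 : n.+1%:R^-1 @[n --> \oo] --> (0 : R) by exact: cvg_harmonic.
have cvgk (k : R) : (n.+1%:R ^-2 / k) ^+ 2 @[n --> \oo] --> (0 : R).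
{ have -> : (fun n : nat => (n.+1%:R ^-2 / k) ^+ 2 : R) =
            (fun n => ((n.+1%:R^-1 * n.+1%:R^-1) / k) ^+ 2).
    by apply/funext => n; rewrite -expr2 exprVn.
  have : n.+1%:R^-1 * n.+1%:R^-1 / k @[n --> \oo] --> 0 * 0 / k.
    by apply: cvgM; [apply: cvgM|exact: cvg_cst].
  by move/cvg_sqr; rewrite !mul0r expr0n. }
apply: (@dominated_cvg _ _ _ P _ measurableT _ _ (cst 1%E)).
- move=> n; exact: (smoothing_fubini (n20 n) (measurable_itv _)).1.
- move=> w _; rewrite EFinM; apply: cvgeZl; first by [].
  rewrite indicE; have [Xr|rX] := ltP (X w) r.
  + rewrite mem_set /= ?in_itv//=.
    have e0 : 0 < (r - X w) / 2 by rewrite divr_gt0// subr_gt0.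
    apply: (@squeeze_cvge _ _ _ _ (fun n : nat => (1 - (n.+1%:R ^-2 / ((r - X w) / 2)) ^+ 2)%:E)
             _ (cst 1%E)).
    * near=> n; apply/andP; split; last exact: probability_le1.
      rewrite EFinB leeBlDr// -(@probability_setT _ _ _ (normal_prob (X w) (n.+1%:R ^- 2))).
      rewrite -(setUv `]-oo, (r - n.+1%:R^-1)[%classic).
      apply: le_trans (measureU2 _ _ _) _ => //; first exact: measurableC.
      rewrite leeD2l//; apply: normal_prob_tail => //; first exact: measurableC.
      move=> c /=; rewrite in_itv /= => /negP; rewrite -leNgt => rc.
      apply: le_trans (ler_norm _); rewrite lerBrDr; apply: le_trans rc.
      suff : n.+1%:R^-1 <= (r - X w) / 2 by move: (n.+1%:R^-1) => v; lra.
      by apply: ltW; near: n; apply: (cvgr_lt 0 cvg1).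
    * rewrite -[X in _ --> X%:E](subr0 1); apply: cvg_EFin; first exact: nearW.
      by apply: (@cvgB _ R^o); [exact: cvg_cst|exact: cvgk].
    * exact: cvg_cst.
  + rewrite memNset /= ?in_itv//=; last by rewrite ltNge rX.
    apply: (@squeeze_cvge _ _ _ _ (cst 0%E) _ (fun n : nat => ((n.+1%:R ^-2 / n.+1%:R^-1) ^+ 2)%:E)).
    * near=> n; rewrite measure_ge0 /=; apply: normal_prob_tail => //.
      move=> c /=; rewrite in_itv /= => cr; rewrite distrC; apply: le_trans (ler_norm _).
      by move: cr; move: (n.+1%:R^-1) => v; lra.
    * exact: cvg_cst.
    * apply: cvg_EFin; first exact: nearW.
      have E (n : nat) : (n.+1%:R ^-2 / n.+1%:R^-1) ^+ 2 = n.+1%:R^-1 ^+ 2 :> R.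
        by congr (_ ^+ 2); rewrite invrK expr2 invfM -mulrA mulVf ?mulr1 ?pnatr_eq0.
      under eq_fun do rewrite /= E.
      by have := cvg_sqr cvg1; rewrite expr0n.
- by [].
- exact: finite_measure_integrable_cst.
- move=> n w _; rewrite abseM gee0_abs ?lee_fin// gee0_abs ?measure_ge0//.
  rewrite -[leRHS]mule1; apply: lee_pmul => //; first by rewrite lee_fin.
    by rewrite lee_fin; case/andP: (h01 w).
  exact: probability_le1.
Unshelve. all: by end_near. Qed.

End smoothing.

Section law_determined_by_cf.
Context {R : realType} {d d' : measure_display} {Y : measurableType d} {Y' : measurableType d'}.
Variables (P : probability Y R) (P' : probability Y' R).
Local Notation mu := (@lebesgue_measure R).

(** The weight [h] carries the factors of all the other coordinates, so that one coordinate at a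
    time can pass from bumps to a ray. *)
Lemma smoothing_unique (h X : Y -> R) (h' X' : Y' -> R) (r : R) :
  measurable_fun setT h -> measurable_fun setT X -> (forall w, 0 <= h w <= 1) ->
  measurable_fun setT h' -> measurable_fun setT X' -> (forall w, 0 <= h' w <= 1) ->
  (forall k c, \int[P]_w (h w * gauss (k * (X w - c))) =
               \int[P']_w (h' w * gauss (k * (X' w - c)))) ->
  \int[P]_w (h w * \1_(`]-oo, r[%classic) (X w)) =
  \int[P']_w (h' w * \1_(`]-oo, r[%classic) (X' w)).
Proof.
move=> mh mX h01 mh' mX' h01' eqg.
have n20 (n : nat) : 0 < n.+1%:R^-2 :> R by rewrite invr_gt0 exprn_gt0.
rewrite /Rintegral; congr fine.
have cP := @smoothing_cvg _ _ _ P h X mh mX h01 r.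
have cP' := @smoothing_cvg _ _ _ P' h' X' mh' mX' h01' r.
suff E : (fun n : nat => \int[P]_w ((h w)%:E * normal_prob (X w) (n.+1%:R ^- 2) `]-oo, (r - n.+1%:R^-1)%R[%classic))%E =
  (fun n : nat => \int[P']_w ((h' w)%:E * normal_prob (X' w) (n.+1%:R ^- 2) `]-oo, (r - n.+1%:R^-1)%R[%classic))%E.
  by rewrite E in cP; exact: (cvg_unique _ cP cP').
  apply/funext => n; rewrite (smoothing_fubini P mh mX h01 (n20 n) (measurable_itv _)).2.
  rewrite (smoothing_fubini P' mh' mX' h01' (n20 n) (measurable_itv _)).2.
  apply: eq_integral => c _; congr (_ * _)%E.
  have ifin (d0 : measure_display) (Z : measurableType d0) (Q : probability Z R) (g V : Z -> R) :
      measurable_fun setT g -> measurable_fun setT V -> (forall w, 0 <= g w <= 1) ->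
      (\int[Q]_w (g w * gauss ((n.+1%:R ^- 2)^-1 * (V w - c)))%:E)%E \is a fin_num.
    move=> mg mV g01; apply: integrable_fin_num => //.
    apply: bounded_integrable01.
      apply: measurable_funM => //; apply: measurable_gauss_comp.
      by apply: measurable_funM => //; apply: measurable_funB.
    move=> w; have /andP[g0 g1] := g01 w; have /andP[e0 e1] := gauss01 ((n.+1%:R ^- 2)^-1 * (V w - c)).
    by rewrite mulr_ge0//= mulr_ile1.
  rewrite -[LHS]fineK ?ifin// -[RHS]fineK ?ifin//; congr (_%:E).
  exact: eqg.
Qed.

Context {I : finType}.
Variables (X : I -> Y -> R) (X' : I -> Y' -> R).
Hypotheses (mX : forall i, measurable_fun setT (X i)).
Hypotheses (mX' : forall i, measurable_fun setT (X' i)).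
Hypothesis eq_cf : forall (a : I -> R) (p : R),
  \int[P]_w cos (\sum_i a i * X i w + p) = \int[P']_w cos (\sum_i a i * X' i w + p).

(* Gaussian bumps are turned into rays one coordinate at a time; [s] lists the
   coordinates already treated. *)
Let bump_or_ray (s : seq I) (k c r : I -> R) (i : I) (x : R) : R :=
  if i \in s then \1_(`]-oo, r i[%classic) x else gauss (k i * (x - c i)).

Let bor01 s k c r i x : 0 <= bump_or_ray s k c r i x <= 1.
Proof.
rewrite /bump_or_ray; case: ifP => _; last exact: gauss01.
by rewrite indicE; case: (_ \in _); rewrite ?lexx ?ler01.
Qed.

Let measurable_bor s k c r i (d0 : measure_display) (V : measurableType d0) (f : V -> R) :
  measurable_fun setT f -> measurable_fun setT (fun w => bump_or_ray s k c r i (f w)).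
Proof.
move=> mf; rewrite /bump_or_ray; case: (i \in s).
  apply: (@measurableT_comp _ _ _ _ _ _ (\1_(`]-oo, r i[%classic) : R -> R)) => //.
apply: measurable_gauss_comp; apply: measurable_funM => //.
exact: measurable_funB.
Qed.

(** Without rays this is the plane-wave formula for bumps together with [eq_cf]. In the induction
    step [smoothing_unique] treats the coordinate [i0] and asks for equality with a bump of
    arbitrary scale and centre there: hence the induction over all [k] and [c]. *)
Let eq_bor (s : seq I) (k c r : I -> R) :
  \int[P]_w (\prod_i bump_or_ray s k c r i (X i w)) =
  \int[P']_w (\prod_i bump_or_ray s k c r i (X' i w)).
Proof.
elim: s k c => [|i0 s IHs] k c.
  have [d0 [V [Q [zeta [mz cz _]]]]] := iid_normal R I.
  rewrite /bump_or_ray /=.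
  rewrite (bump_cf P k c mX mz cz) (bump_cf P' k c mX' mz cz).
  by apply: eq_Rintegral => v _; exact: eq_cf.
have [i0s|i0s] := boolP (i0 \in s).
  have E i x : bump_or_ray (i0 :: s) k c r i x = bump_or_ray s k c r i x.
    rewrite /bump_or_ray in_cons; case: eqVneq => [->|//].
    by rewrite i0s.
  under eq_Rintegral do under eq_bigr do rewrite E.
  under [RHS]eq_Rintegral do under eq_bigr do rewrite E.
  exact: IHs.
have E (W : I -> R) : \prod_i bump_or_ray (i0 :: s) k c r i (W i) =
    (\prod_(i | i != i0) bump_or_ray s k c r i (W i)) * \1_(`]-oo, r i0[%classic) (W i0).
  rewrite (bigD1 i0)//= mulrC {2}/bump_or_ray mem_head; congr (_ * _).
  by apply: eq_bigr => i ni; rewrite /bump_or_ray in_cons (negbTE ni).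
under eq_Rintegral do rewrite E.
under [RHS]eq_Rintegral do rewrite E.
have mp (d0 : measure_display) (V : measurableType d0) (W : I -> V -> R) :
    (forall i, measurable_fun setT (W i)) ->
    measurable_fun setT (fun w => \prod_(i | i != i0) bump_or_ray s k c r i (W i w)).
  move=> mW; under eq_fun do rewrite big_mkcond.
  apply: measurable_prod => i _; case: (i != i0) => //.
  exact: measurable_bor.
have p01 (W : I -> R) : 0 <= \prod_(i | i != i0) bump_or_ray s k c r i (W i) <= 1.
  rewrite big_mkcond; apply: prod_01 => i; case: ifP => // _.
  by rewrite ler01 lexx.
apply: smoothing_unique => //; try exact: mp.
move=> k0 c0.
pose k' i := if i == i0 then k0 else k i.
pose c' i := if i == i0 then c0 else c i.
have E' (W : I -> R) : (\prod_(i | i != i0) bump_or_ray s k c r i (W i)) *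
    gauss (k0 * (W i0 - c0)) = \prod_i bump_or_ray s k' c' r i (W i).
  rewrite [RHS](bigD1 i0)//= mulrC {2}/bump_or_ray (negbTE i0s) /k' /c' eqxx; congr (_ * _).
  by apply: eq_bigr => i ni; rewrite /bump_or_ray (negbTE ni).
under eq_Rintegral do rewrite E'.
under [RHS]eq_Rintegral do rewrite E'.
exact: IHs.
Qed.

Lemma rays_determined (r : I -> R) :
  P [set w | forall i, X i w < r i] = P' [set w | forall i, X' i w < r i].
Proof.
have G (d0 : measure_display) (V : measurableType d0) (Q : probability V R) (W : I -> V -> R) :
    (forall i, measurable_fun setT (W i)) ->
    Q [set w | forall i, W i w < r i] =
    (\int[Q]_w (\prod_i bump_or_ray (enum I) (cst 0) (cst 0) r i (W i w)))%:E.
  move=> mW.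
  have mA := measurable_rays r mW.
  rewrite -[LHS]mul1e -(integral_cst Q mA 1) integral_mkcond /Rintegral fineK.
    apply: eq_integral => w _; rewrite patchE /bump_or_ray.
    case: ifPn => [/set_mem /= h|]; last first.
      move=> /negP; rewrite inE /= => /existsNP [i0 /negP ni0].
      rewrite (bigD1 i0)//= mem_enum /= indicE memNset ?mul0r//= in_itv /=.
      exact/negP.
    rewrite big1// => i _; rewrite mem_enum /= indicE mem_set//=.
    by rewrite in_itv /=.
  apply: integrable_fin_num => //; apply: bounded_integrable01.
    by apply: measurable_prod_comp => i; apply: measurable_bor.
  by move=> w; apply: prod_01.
by rewrite !G// eq_bor.
Qed.

End law_determined_by_cf.

(** * From ray boxes to all measurable functions of finitely many coordinates *)

Section tuple_boxes.
Context {R : realType} (n : nat).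

Definition ray_box : set (set (n.-tuple (measurableTypeR R))) :=
  [set B | exists r : 'I_n -> R, B = [set t | forall i, tnth t i < r i]].

Lemma measurable_tnth_fun (i : 'I_n) :
  measurable_fun setT (fun t : n.-tuple (measurableTypeR R) => tnth t i).
Proof. exact: measurable_tnth. Qed.

Lemma sub_measurable_ray_box : ray_box `<=` measurable.
Proof.
by move=> B [r ->]; exact: (measurable_rays r measurable_tnth_fun).
Qed.

Lemma ray_box_setI : setI_closed ray_box.
Proof.
move=> _ _ [r ->] [s ->]; exists (fun i => Num.min (r i) (s i)).
apply/seteqP; split => t /=.
  by move=> [h1 h2] i; rewrite lt_min h1 h2.
by move=> h; split => i; have := h i; rewrite lt_min => /andP[].
Qed.

Lemma ray_box_cover :
  \bigcup_k [set t : n.-tuple (measurableTypeR R) | forall i, tnth t i < k%:R] = setT.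
Proof.
rewrite -subTset => t _.
exists (\max_(i < n) (Num.bound `|tnth t i|)) => // i.
apply: (@lt_le_trans _ _ (Num.bound `|tnth t i|)%:R).
  by apply: le_lt_trans (ler_norm _) _; exact: archi_boundP.
by rewrite ler_nat; apply: (@leq_bigmax _ (fun i => Num.bound `|tnth t i|)).
Qed.

(** The half-space where the coordinate [i] is below [x] is the union over [k] of the ray boxes with
    [i]-th end [x] and all other ends [k]; half-spaces generate the sigma-algebra of tuples. *)
Lemma ray_box_generates :
  (measurable : set (set (n.-tuple (measurableTypeR R)))) `<=` <<s ray_box >>.
Proof.
apply: smallest_sub; first exact: smallest_sigma_algebra.
apply: (big_ind (fun S : set (set (n.-tuple (measurableTypeR R))) => S `<=` <<s ray_box >>)).
- by move=> ? [].
- by move=> S S' hS hS' B [/hS|/hS'].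
- move=> i _ B [A mA <-].
  have mA' : (@RGenInftyO.G R).-sigma.-measurable A by rewrite -RGenInftyO.measurableE.
  have : preimage_set_system setT (fun t : n.-tuple (measurableTypeR R) => tnth t i)
      (RGenInftyO.G (R := R)).-sigma.-measurable (setT `&` (fun t => tnth t i) @^-1` A).
    by exists A.
  rewrite -g_sigma_preimageE.
  apply: smallest_sub; first exact: smallest_sigma_algebra.
  move=> _ [_ [x ->] <-].
  rewrite setTI (_ : _ @^-1` _ = \bigcup_k [set t | forall j, tnth t j < (if j == i then x else k%:R)]).
    apply: sigma_algebra_bigcup => k; apply: sub_sigma_algebra.
    by exists (fun j => if j == i then x else k%:R).
  apply/seteqP; split => t /=.
    rewrite in_itv /= => tx.
    have : setT t by [].
    rewrite -ray_box_cover => -[k _ tk]; exists k => // j.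
    by case: eqVneq => [->|_] //; exact: tk.
  by move=> [k _ /(_ i)]; rewrite eqxx in_itv.
Qed.

End tuple_boxes.

(* Measurability of a function of finitely many real coordinates, through the
   library's sigma-algebra on tuples. *)
Definition coord_measurable {R : realType} {I : finType} (F : (I -> R) -> R) : Prop :=
  measurable_fun setT (fun t : #|I|.-tuple (measurableTypeR R) =>
    F (fun i => tnth t (enum_rank i))).

Lemma measurable_mktuple {R : realType} {I : finType} d (V : measurableType d)
    (W : I -> V -> R) : (forall i, measurable_fun setT (W i)) ->
  measurable_fun setT (fun v =>
    [tuple W (enum_val j) v | j < #|I|] : #|I|.-tuple (measurableTypeR R)).
Proof.
move=> mW; apply/measurable_fun_tnthP => j.
rewrite (_ : _ \o _ = W (enum_val j)); first exact: mW.
by apply/funext => w /=; rewrite tnth_mktuple.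
Qed.

Lemma coord_measurable_comp {R : realType} {I : finType} d (V : measurableType d)
    (F : (I -> R) -> R) (W : I -> V -> R) : coord_measurable F ->
  (forall i, measurable_fun setT (W i)) -> measurable_fun setT (fun v => F (W ^~ v)).
Proof.
move=> mF mW.
rewrite (_ : (fun v => _) = (fun t : #|I|.-tuple (measurableTypeR R) =>
    F (fun i => tnth t (enum_rank i))) \o
    (fun v => [tuple W (enum_val j) v | j < #|I|])).
  by apply: measurableT_comp => //; exact: measurable_mktuple.
by apply/funext => v /=; congr F; apply/funext => i; rewrite tnth_mktuple enum_rankK.
Qed.

Section law_determined_tuple.
Context {R : realType} {d d' : measure_display} {Y : measurableType d} {Y' : measurableType d'}.
Variables (P : probability Y R) (P' : probability Y' R).
Context {I : finType}.
Variables (X : I -> Y -> R) (X' : I -> Y' -> R).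
Hypotheses (mX : forall i, measurable_fun setT (X i)).
Hypotheses (mX' : forall i, measurable_fun setT (X' i)).
Hypothesis eq_cf : forall (a : I -> R) (p : R),
  \int[P]_w cos (\sum_i a i * X i w + p) = \int[P']_w cos (\sum_i a i * X' i w + p).

Local Notation Tup := (#|I|.-tuple (measurableTypeR R)).

Let tup {V} (W : I -> V -> R) (v : V) : Tup := [tuple W (enum_val j) v | j < #|I|].

Let mt : measurable_fun setT (tup X) := measurable_mktuple mX.
Let mt' : measurable_fun setT (tup X') := measurable_mktuple mX'.

(** Uniqueness of measures agreeing on the ray boxes, which are stable under intersection, generate
    the sigma-algebra, and exhaust the space through the boxes with all ends equal to [k]. *)
Let law_eq A : measurable A -> pushforward P (tup X) A = pushforward P' (tup X') A.
Proof.
pose m1 := measure_function_pushforward__canonical__measure_function_Measure P mt.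
pose m2 := measure_function_pushforward__canonical__measure_function_Measure P' mt'.
move=> mA; apply: (@g_sigma_algebra_measure_unique _ _ _ (@ray_box R #|I|) _
  (fun k => [set t | forall i, tnth t i < k%:R]) _ _ m1 m2).
- exact: sub_measurable_ray_box.
- by move=> k; exists (fun=> k%:R).
- exact: ray_box_cover.
- exact: ray_box_setI.
- move=> _ [r ->]; rewrite /= /pushforward.
  have E V (W : I -> V -> R) : tup W @^-1` [set t | forall i, tnth t i < r i] =
      [set v | forall i, W i v < r (enum_rank i)].
    apply/seteqP; split => v /= h i.
      by have := h (enum_rank i); rewrite tnth_mktuple enum_rankK.
    by have := h (enum_val i); rewrite tnth_mktuple enum_valK.
  by rewrite !E; exact: (rays_determined mX mX' eq_cf (fun i => r (enum_rank i))).
- move=> k; apply: le_lt_trans (ltry 1); apply: probability_le1.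
  rewrite -[X in measurable X]setTI; apply: mt => //.
  by apply: sub_measurable_ray_box; exists (fun=> k%:R).
- exact: ray_box_generates.
Qed.

Let ge0_law_integral (g : Tup -> \bar R) : measurable_fun setT g -> (forall t, (0 <= g t)%E) ->
  (\int[P]_w g (tup X w) = \int[P']_w g (tup X' w))%E.
Proof.
pose m1 := measure_function_pushforward__canonical__measure_function_Measure P mt.
pose m2 := measure_function_pushforward__canonical__measure_function_Measure P' mt'.
move=> mg g0.
transitivity (\int[m1]_t g t)%E.
  by rewrite (@ge0_integral_pushforward _ _ _ _ _ _ mt P setT g).
transitivity (\int[m2]_t g t)%E.
  by apply: eq_measure_integral => A mA _; exact: law_eq.
by rewrite (@ge0_integral_pushforward _ _ _ _ _ _ mt' P' setT g).
Qed.

Variable F : (I -> R) -> R.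
Hypothesis mF : coord_measurable F.

Let FE V (W : I -> V -> R) v : F (fun i => tnth (tup W v) (enum_rank i)) = F (W ^~ v).
Proof. by congr F; apply/funext => i; rewrite tnth_mktuple enum_rankK. Qed.

(** Positive and negative parts are compared separately as extended integrals, so that for a
    non-integrable [F] both sides still take the same default value. *)
Lemma law_determined : \int[P]_w F (X ^~ w) = \int[P']_w F (X' ^~ w).
Proof.
rewrite /Rintegral; congr fine; rewrite [LHS]integralE [RHS]integralE.
have mFE : measurable_fun setT (fun t : Tup => (F (fun i => tnth t (enum_rank i)))%:E).
  exact/measurable_EFinP.
have Ep : (\int[P]_w (fun w => (F (X ^~ w))%:E)^\+ w = \int[P']_w (fun w => (F (X' ^~ w))%:E)^\+ w)%E.
  have := ge0_law_integral (measurable_funepos mFE) (fun t => funepos_ge0 _ _).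
  under eq_integral do rewrite funeposE FE.
  under [X in _ = X -> _]eq_integral do rewrite funeposE FE.
  move=> h; under eq_integral do rewrite funeposE.
  by under [RHS]eq_integral do rewrite funeposE.
have En : (\int[P]_w (fun w => (F (X ^~ w))%:E)^\- w = \int[P']_w (fun w => (F (X' ^~ w))%:E)^\- w)%E.
  have := ge0_law_integral (measurable_funeneg mFE) (fun t => funeneg_ge0 _ _).
  under eq_integral do rewrite funenegE FE.
  under [X in _ = X -> _]eq_integral do rewrite funenegE FE.
  move=> h; under eq_integral do rewrite funenegE.
  by under [RHS]eq_integral do rewrite funenegE.
by rewrite Ep En.
Qed.

Lemma law_determined_integrable :
  P.-integrable setT (fun w => (F (X ^~ w))%:E) ->
  P'.-integrable setT (fun w => (F (X' ^~ w))%:E).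
Proof.
move=> /integrableP[_ h]; apply/integrableP; split.
  by apply/measurable_EFinP; exact: coord_measurable_comp.
have mFE : measurable_fun setT (fun t : Tup => `|(F (fun i => tnth t (enum_rank i)))%:E|%E).
  by apply: measurableT_comp => //; exact/measurable_EFinP.
have := ge0_law_integral mFE (fun t => abse_ge0 _).
under eq_integral do rewrite FE.
under [X in _ = X -> _]eq_integral do rewrite FE.
by move=> <-.
Qed.

End law_determined_tuple.

Lemma law_determined1 {R : realType} {d d' : measure_display} {Y : measurableType d}
    {Y' : measurableType d'} (P : probability Y R) (P' : probability Y' R)
    (X : Y -> R) (X' : Y' -> R) (f : R -> R) :
  measurable_fun setT X -> measurable_fun setT X' -> measurable_fun setT f ->
  (forall b p, \int[P]_w cos (b * X w + p) = \int[P']_w cos (b * X' w + p)) ->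
  (P.-integrable setT (EFin \o (fun w => f (X w))) ->
   P'.-integrable setT (EFin \o (fun w => f (X' w)))) /\
  \int[P]_w f (X w) = \int[P']_w f (X' w).
Proof.
move=> mX mX' mf eqcf.
have cf (b : unit -> R) (p : R) : \int[P]_w cos (\sum_i b i * X w + p) =
    \int[P']_w cos (\sum_i b i * X' w + p).
  under eq_Rintegral do rewrite sum_unit.
  by under [RHS]eq_Rintegral do rewrite sum_unit.
have mF : coord_measurable (fun x : unit -> R => f (x tt)).
  by apply: measurableT_comp => //; exact: measurable_tnth_fun.
have m1 (_ : unit) := mX; have m2 (_ : unit) := mX'.
split; first exact: (law_determined_integrable m1 m2 cf mF).
exact: (law_determined m1 m2 cf mF).
Qed.

Arguments law_determined1 {R d d' Y Y'} P P' {X X' f}.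

(** * Gaussian families *)

Section bilinear.
Context {R : realType} {I : finType}.
Implicit Types (C : I -> I -> R) (a b c : I -> R).

(** When [C] is the covariance of a family, this is the covariance of its linear combinations with
    coefficients [a] and [b]. *)
Definition bil C a b : R := \sum_i \sum_j C i j * (a i * b j).

Lemma bilDl C a b c : bil C (fun i => a i + b i) c = bil C a c + bil C b c.
Proof.
rewrite -big_split; apply: eq_bigr => i _; rewrite -big_split.
by apply: eq_bigr => j _ /=; ring.
Qed.

Lemma bilZl C (k : R) a b : bil C (fun i => k * a i) b = k * bil C a b.
Proof.
rewrite /bil mulr_sumr; apply: eq_bigr => i _; rewrite mulr_sumr.
by apply: eq_bigr => j _; ring.
Qed.

Lemma bilC C a b : (forall i j, C i j = C j i) -> bil C a b = bil C b a.
Proof.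
move=> sC; rewrite /bil exchange_big; apply: eq_bigr => i _; apply: eq_bigr => j _.
by rewrite sC; ring.
Qed.

Lemma bilDr C a b c : (forall i j, C i j = C j i) ->
  bil C c (fun i => a i + b i) = bil C c a + bil C c b.
Proof. by move=> sC; rewrite bilC// bilDl bilC// (bilC _ b). Qed.

Lemma bilZr C (k : R) a b : (forall i j, C i j = C j i) ->
  bil C b (fun i => k * a i) = k * bil C b a.
Proof. by move=> sC; rewrite bilC// bilZl bilC. Qed.

Lemma bil_deltar C a j : bil C a (fun i => (i == j)%:R) = \sum_i C i j * a i.
Proof.
apply: eq_bigr => i _; rewrite (bigD1 j)//= eqxx mulr1 big1 ?addr0// => k /negPf ->.
by rewrite !mulr0.
Qed.

Lemma bil_delta C i j : bil C (fun k => (k == i)%:R) (fun k => (k == j)%:R) = C i j.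
Proof.
rewrite bil_deltar (bigD1 i)//= eqxx mulr1 big1 ?addr0// => k /negPf ->.
by rewrite mulr0.
Qed.

Lemma bil_id a b : bil (fun i j => (i == j)%:R) a b = \sum_i a i * b i.
Proof.
apply: eq_bigr => i _; rewrite (bigD1 i)//= eqxx mul1r big1 ?addr0// => k.
by rewrite eq_sym => /negPf ->; rewrite mul0r.
Qed.

End bilinear.

Section gaussian_family.
Context {R : realType}.

(* Thanks to the phase [p], real cosines carry the whole characteristic function. *)
Definition gaussian_family {d} {Y : measurableType d} (P : probability Y R)
    {I : finType} (X : I -> Y -> R) (C : I -> I -> R) : Prop :=
  [/\ forall i, measurable_fun setT (X i), forall i j, C i j = C j i &
      forall (a : I -> R) (p : R), \int[P]_w cos (\sum_i a i * X i w + p) =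
        cos p * expR (- (bil C a a / 2))].

Context {d d' : measure_display} {Y : measurableType d} {Y' : measurableType d'}.
Context (P : probability Y R) (Q : probability Y' R) {I J K : finType}.
Variables (X : I -> Y -> R) (C : I -> I -> R) (W : J -> Y' -> R) (D : J -> J -> R).
Hypotheses (gX : gaussian_family P X C) (gW : gaussian_family Q W D).

(** [L] is the transpose of the linear map that produces [V] from [X]: it sends coefficients on [V]
    to coefficients on [X]. *)
Lemma gaussian_family_cf_lin (V : K -> Y -> R) (L : (K -> R) -> (I -> R)) :
  (forall b w, \sum_k b k * V k w = \sum_i L b i * X i w) ->
  forall b p, \int[P]_w cos (\sum_k b k * V k w + p) =
    cos p * expR (- (bil C (L b) (L b) / 2)).
Proof. by move=> E b p; under eq_Rintegral do rewrite E; case: gX. Qed.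

(** On a product space the two families are independent, so their quadratic forms add up. *)
Lemma gaussian_family_cf_prod (V : K -> Y * Y' -> R)
    (L : (K -> R) -> (I -> R)) (M : (K -> R) -> (J -> R)) :
  (forall b w, \sum_k b k * V k w = \sum_i L b i * X i w.1 + \sum_j M b j * W j w.2) ->
  forall b p, \int[(P \x Q)%E]_w cos (\sum_k b k * V k w + p) =
    cos p * expR (- ((bil C (L b) (L b) + bil D (M b) (M b)) / 2)).
Proof.
have [mX _ cX] := gX; have [mW _ cW] := gW.
move=> E b p; under eq_Rintegral do rewrite E.
rewrite (@Rfubini2_bounded _ _ _ _ _ P Q _ 1).
- under eq_Rintegral => y _.
    under eq_Rintegral do rewrite /= -addrA.
    rewrite cX.
    over.
  rewrite /= RintegralZr//; last by apply: integrable_cos; apply: measurable_lin.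
  rewrite cW -mulrA -expRD; congr (_ * expR _); lra.
- apply: measurable_cos_comp; apply: measurable_funD => //; apply: measurable_funD.
    by apply: measurable_sum => i; apply: measurable_funM => //; exact: measurable_fun_fst.
  by apply: measurable_sum => i; apply: measurable_funM => //; exact: measurable_fun_snd.
- by move=> z; exact: cos_le1n.
Qed.

(** An expectation of cosines is at most 1, so the exponent of the characteristic function cannot be
    positive. *)
Lemma gaussian_family_psd (a : I -> R) : 0 <= bil C a a.
Proof.
have [mX _ cX] := gX.
have := cX a 0; rewrite cos0 mul1r => E.
have : expR (- (bil C a a / 2)) <= 1.
{ rewrite -E -[leRHS](Rint_cst P); apply: le_Rint.
  - by apply: integrable_cos; apply: measurable_lin.
  - by apply: (@bounded_integrable _ _ _ _ _ 1) => // x; rewrite normr1.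
  - by move=> x; exact: cos_le1. }
by rewrite -[leRHS]expR0 ler_expR oppr_le0 pmulr_lge0.
Qed.

End gaussian_family.

Lemma gaussian_family_N01 (R : realType) :
  gaussian_family (N01 R) (fun (_ : unit) (x : measurableTypeR R) => x : R) (fun _ _ => 1).
Proof.
split => [_|//|a p]; first exact: measurable_id.
under eq_Rintegral do rewrite sum_unit.
by rewrite N01_cos /bil sum_unit sum_unit mul1r expr2.
Qed.

(** * Conditioning on a linear combination of unit variance *)

Section conditioning.
Context {R : realType} {d : measure_display} {Y : measurableType d} (P : probability Y R).
Context {I : finType} (X : I -> Y -> R) (C : I -> I -> R) (b : I -> R).
Hypotheses (gX : gaussian_family P X C) (b1 : bil C b b = 1).

Let xi w := \sum_i b i * X i w.
Let c i := bil C (fun k => (k == i)%:R) b.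

(* Conditioning on [xi]: replacing [xi] by an independent standard normal
   variable [z] does not change the law of the family. *)
Lemma gaussian_family_resample (F : (I -> R) -> R -> R) :
  coord_measurable (fun x : I + unit -> R => F (fun i => x (inl i)) (x (inr tt))) ->
  (P.-integrable setT (fun w => (F (X ^~ w) (xi w))%:E) ->
   (P \x N01 R)%E.-integrable setT
     (fun w => (F (fun i => X i w.1 + c i * (w.2 - xi w.1)) w.2)%:E)) /\
  \int[P]_w F (X ^~ w) (xi w) =
  \int[(P \x N01 R)%E]_w F (fun i => X i w.1 + c i * (w.2 - xi w.1)) w.2.
Proof.
have [mX sC cX] := gX.
move=> mF.
have mxi : measurable_fun setT xi.
  by apply: measurable_sum => i; apply: measurable_funM.
pose V (k : I + unit) w : R := match k with inl i => X i w | inr _ => xi w end.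
pose V' (k : I + unit) (w : Y * measurableTypeR R) : R :=
  match k with inl i => X i w.1 + c i * (w.2 - xi w.1) | inr _ => w.2 end.
have mV k : measurable_fun setT (V k) by case: k.
have mV' k : measurable_fun setT (V' k).
  rewrite /V'; case: k => [i|k]; last exact: measurable_snd.
  apply: measurable_funD; first exact: measurable_fun_fst.
  apply: measurable_funM => //; apply: measurable_funB; first exact: measurable_snd.
  exact: measurable_fun_fst.
pose u (a : I + unit -> R) i := a (inl i).
(* [s a] is the covariance with [xi] of the combination [u a]. In the resampled family it is the
   coefficient with which [z] replaces [xi]. *)
pose s (a : I + unit -> R) := \sum_i a (inl i) * c i.
have sE a : s a = bil C (u a) b.
  rewrite /s /u /c; under eq_bigr => i _ do rewrite bilC// bil_deltar mulr_sumr.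
  apply: eq_bigr => i _ /=; apply: eq_bigr => j _.
  by rewrite sC; ring.
have cfV := gaussian_family_cf_lin gX (V := V) (L := fun a i => u a i + a (inr tt) * b i).
have cfV' := gaussian_family_cf_prod gX (gaussian_family_N01 R) (V := V')
  (L := fun a i => u a i + (- s a) * b i) (M := fun a _ => s a + a (inr tt)).
have eqcf (a : I + unit -> R) (p : R) :
  \int[P]_w cos (\sum_i a i * V i w + p) = \int[(P \x N01 R)%E]_w cos (\sum_i a i * V' i w + p).
{ rewrite cfV; last first.
    move=> b0 w; rewrite big_sumType sum_unit /= /xi mulr_sumr -big_split.
    by apply: eq_bigr => i _ /=; rewrite /u; ring.
  rewrite cfV'; last first.
    move=> b0 w; rewrite big_sumType sum_unit /= sum_unit.
    under eq_bigr do rewrite mulrDr.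
    under [X in _ = X + _]eq_bigr do rewrite mulrDl.
    rewrite !big_split /=.
    have -> : \sum_i b0 (inl i) * (c i * (w.2 - xi w.1)) = s b0 * (w.2 - xi w.1).
      by rewrite /s mulr_suml; apply: eq_bigr => i _; rewrite mulrA.
    have -> : \sum_i - s b0 * b i * X i w.1 = - s b0 * xi w.1.
      by rewrite /xi mulr_sumr; apply: eq_bigr => i _; rewrite mulrA.
    by rewrite /u; ring.
  congr (_ * expR (- (_ / 2))).
  (* Since [xi] has variance 1, removing it from [u a] lowers the variance by [s a ^+ 2], and the
     independent [z] gives this back. *)
  rewrite /= [X in _ = _ + X]/bil sum_unit sum_unit mul1r.
  rewrite !bilDl !bilDr// !bilZl !bilZr// b1 (bilC b)// -sE; ring. }
have h := law_determined mV mV' eqcf (F := fun x => F (fun i => x (inl i)) (x (inr tt))) mF.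
have h' := law_determined_integrable mV mV' eqcf (F := fun x => F (fun i => x (inl i)) (x (inr tt))) mF.
by split.
Qed.

End conditioning.

(** * Association *)

Section association.
Context {R : realType} {d : measure_display} {Y : measurableType d} (P : probability Y R).
Context {I : finType} (X : I -> Y -> R) (C : I -> I -> R).
Hypothesis gX : gaussian_family P X C.

Lemma gaussian_lin_law (a : I -> R) (f : R -> R) : measurable_fun setT f ->
  ((N01 R).-integrable setT (fun z : measurableTypeR R => (f (Num.sqrt (bil C a a) * z))%:E) ->
   P.-integrable setT (fun w => (f (\sum_i a i * X i w))%:E)) /\
  \int[P]_w f (\sum_i a i * X i w) = \int[N01 R]_z f (Num.sqrt (bil C a a) * z).
Proof.
have [mX sC cX] := gX; move=> mf.
have mV : measurable_fun setT (fun w => \sum_i a i * X i w).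
  by apply: measurable_sum => i; apply: measurable_funM.
have mV' : measurable_fun setT (fun z : measurableTypeR R => Num.sqrt (bil C a a) * z).
  by apply: measurable_funM.
have [|h1 <-] := law_determined1 (N01 R) P mV' mV mf; last by split.
move=> b p; under eq_Rintegral do rewrite mulrA.
under [RHS]eq_Rintegral do rewrite mulr_sumr.
under [RHS]eq_Rintegral do under eq_bigr do rewrite mulrA.
rewrite N01_cos cX bilZl bilZr// exprMn sqr_sqrtr; last exact: gaussian_family_psd gX _.
by rewrite expr2 mulrA.
Qed.

(** [gaussian_family] speaks only of characteristic functions; comparison with a multiple of a
    standard normal variable recovers the second moments. *)
Lemma gaussian_sq (a : I -> R) :
  P.-integrable setT (fun w => ((\sum_i a i * X i w) ^+ 2)%:E) /\
  \int[P]_w ((\sum_i a i * X i w) ^+ 2) = bil C a a.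
Proof.
have msq : measurable_fun setT (fun x : R => x ^+ 2) by apply: measurable_funX.
have i2 := @integrable_N01_sq R.
have [h1 h2] := gaussian_lin_law a msq; split.
  apply: h1; have := integrableZl measurableT (bil C a a) i2.
  apply: eq_integrable => // z _ /=.
  by rewrite exprMn sqr_sqrtr ?EFinM//; exact: gaussian_family_psd gX _.
rewrite h2; under eq_Rintegral do rewrite exprMn.
rewrite RintegralZl// N01_sq mulr1 sqr_sqrtr//; exact: gaussian_family_psd gX _.
Qed.

Lemma sum_deltal (i : I) (x : I -> R) : \sum_k (k == i)%:R * x k = x i.
Proof. by rewrite (bigD1 i)//= eqxx mul1r big1 ?addr0// => k /negPf ->; rewrite mul0r. Qed.

Lemma integrable_abs_coord (j : I) : P.-integrable setT (fun w => (`|X j w|)%:E).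
Proof.
have [mX _ _] := gX.
have [h _] := gaussian_sq (fun k => (k == j)%:R).
have c1 : P.-integrable setT (EFin \o cst (1 : R)).
  by apply: (@bounded_integrable _ _ _ _ _ 1) => // x; rewrite normr1.
apply: le_integrable (integrableD measurableT h c1) => //.
  by apply/measurable_EFinP; apply: measurableT_comp.
move=> w _ /=; rewrite lee_fin sum_deltal normr_id (@ger0_norm _ (_ + _)) ?addr_ge0 ?sqr_ge0//.
rewrite -[X j w ^+ 2]real_normK ?num_real//; move: `|X j w| (normr_ge0 (X j w)) => v v0; nra.
Qed.

(** Write [X i] as a part independent of [X j] plus [C i j * z], with [z] standard normal.
    Monotonicity makes [G * z] at least its value with the shift by [z] removed from [G], both for
    [z >= 0] and for [z < 0]; that value has expectation 0 by independence. *)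
Lemma monotone_covariance (j : I) (S : pred I) (G : (I -> R) -> R) :
  C j j = 1 -> (forall i, S i -> 0 <= C i j) -> coord_measurable G ->
  (forall x, 0 <= G x <= 1) ->
  (forall x y, (forall i, S i -> x i <= y i) -> G x <= G y) ->
  0 <= \int[P]_w (G (X ^~ w) * X j w).
Proof.
move=> Cjj Cij mG G01 Gmon; have [mX sC cX] := gX.
have bjj : bil C (fun k => (k == j)%:R) (fun k => (k == j)%:R) = 1 by rewrite bil_delta.
have mF : coord_measurable (fun x : I + unit -> R => G (fun i => x (inl i)) * x (inr tt)).
  apply: measurable_funM; last exact: measurable_tnth_fun.
  by apply: (coord_measurable_comp mG) => i; exact: measurable_tnth_fun.
have [hi hE] := gaussian_family_resample gX bjj (F := fun x z => G x * z) mF.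
have iz := @integrable_N01_id R.
have izz : (P \x N01 R)%E.-integrable setT (EFin \o (fun w : Y * measurableTypeR R => w.2)).
  exact: (integrable_snd P iz).
have G0 x : 0 <= G x by case/andP: (G01 x).
have mX0 i : measurable_fun setT (fun w => X i w - C i j * X j w).
  by apply: measurable_funB => //; apply: measurable_funM.
have mG0 : measurable_fun setT (fun w => G (fun i => X i w - C i j * X j w)).
  exact: (coord_measurable_comp mG).
have iP : (P \x N01 R)%E.-integrable setT (fun w : Y * measurableTypeR R =>
    (G (fun i => X i w.1 - C i j * X j w.1) * w.2)%:E).
  apply: le_integrable izz => //.
    apply/measurable_EFinP; apply: measurable_funM; last exact: measurable_snd.
    exact: (measurable_fun_fst mG0).
  move=> w _ /=; rewrite lee_fin normrM ger0_norm// ler_piMl//.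
  by case/andP: (G01 (fun i => X i w.1 - C i j * X j w.1)).
under eq_Rintegral => w _ do rewrite -[X in _ * X](sum_deltal j (X ^~ w)).
rewrite hE.
apply: le_trans (_ : \int[(P \x N01 R)%E]_w
    (G (fun i => X i w.1 - C i j * X j w.1) * w.2) <= _).
{ rewrite Rfubini1//.
    under eq_Rintegral => y _.
      rewrite /= RintegralZl// N01_id mulr0.
      over.
    by rewrite Rint_cst.
  move=> w; have := integrableZl measurableT (G (fun i => X i w - C i j * X j w)) iz.
  by apply: eq_integrable. }
apply: (@le_Rint _ _ _ (P \x N01 R)%E) => //.
- apply: hi; apply: le_integrable (integrable_abs_coord j) => //.
    apply/measurable_EFinP; apply: measurable_funM.
      exact: (coord_measurable_comp mG).
    by apply: measurable_sum => i; apply: measurable_funM.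
  move=> w _ /=; rewrite lee_fin normr_id sum_deltal normrM ger0_norm// ler_piMl//.
  by case/andP: (G01 (X ^~ w)).
- move=> [w z] /=; rewrite sum_deltal.
  have [z0|z0] := leP 0 z.
    rewrite ler_wpM2r//; apply: Gmon => i Si; rewrite bil_delta.
    by have := mulr_ge0 (Cij i Si) z0; lra.
  apply: ler_wnM2r; first exact: ltW.
  apply: Gmon => i Si; rewrite bil_delta.
  by have := mulr_ge0_le0 (Cij i Si) (ltW z0); lra.
Qed.

(** The quadratic form of two independent copies is a sum of two equal forms: under a rotation the
    cross terms cancel. *)
Lemma gaussian_rotation (c s : R) (F : (I + I -> R) -> R) : c ^+ 2 + s ^+ 2 = 1 ->
  coord_measurable F ->
  let V (w : Y * Y) (k : I + I) := match k with inl i => X i w.1 | inr i => X i w.2 end in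
  let V' (w : Y * Y) (k : I + I) := match k with
    | inl i => c * X i w.1 - s * X i w.2 | inr i => s * X i w.1 + c * X i w.2 end in
  ((P \x P)%E.-integrable setT (fun w => (F (V w))%:E) ->
   (P \x P)%E.-integrable setT (fun w => (F (V' w))%:E)) /\
  \int[(P \x P)%E]_w F (V w) = \int[(P \x P)%E]_w F (V' w).
Proof.
move=> cs1 mF V V'; have [mX sC cX] := gX.
have mV k : measurable_fun setT (V ^~ k).
  by case: k => i; [exact: measurable_fun_fst|exact: measurable_fun_snd].
have mV' k : measurable_fun setT (V' ^~ k).
  by case: k => i; [apply: measurable_funB|apply: measurable_funD];
    apply: measurable_funM => //; try exact: measurable_fun_fst; exact: measurable_fun_snd.
pose l (b : I + I -> R) i := b (inl i).
pose r (b : I + I -> R) i := b (inr i).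
have cfV := gaussian_family_cf_prod gX gX (V := fun k w => V w k) (L := l) (M := r).
have cfV' := gaussian_family_cf_prod gX gX (V := fun k w => V' w k)
  (L := fun b i => c * l b i + s * r b i) (M := fun b i => (- s) * l b i + c * r b i).
have eqcf (a : I + I -> R) (p : R) :
  \int[(P \x P)%E]_w cos (\sum_i a i * V w i + p) =
  \int[(P \x P)%E]_w cos (\sum_i a i * V' w i + p).
{ rewrite cfV; last by move=> b w; rewrite big_sumType.
  rewrite cfV'; last first.
    move=> b w; rewrite big_sumType /= -!big_split /=.
    by apply: eq_bigr => i _; rewrite /l /r; ring.
  congr (_ * expR (- (_ / 2))).
  rewrite !bilDl !bilDr// !bilZl !bilZr// (bilC (r a) (l a))//.
  transitivity ((c ^+ 2 + s ^+ 2) * (bil C (l a) (l a) + bil C (r a) (r a))); last by ring.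
  by rewrite cs1 mul1r. }
split; last exact: (law_determined (X := fun k w => V w k) (X' := fun k w => V' w k) mV mV' eqcf mF).
exact: (law_determined_integrable (X := fun k w => V w k) (X' := fun k w => V' w k) mV mV' eqcf mF).
Qed.

(* A smooth substitute for the indicator of the event that every coordinate in
   [A] is below a level. *)
Definition soft_below (al be : R) (A : pred I) (x : I -> R) : R :=
  expR (- \sum_(i | A i) expR (al * x i + be)).

Lemma soft_below01 al be A x : 0 <= soft_below al be A x <= 1.
Proof.
rewrite expR_ge0 -[leRHS]expR0 ler_expR oppr_le0 sumr_ge0// => i _; exact: expR_ge0.
Qed.

Lemma soft_below_coord_measurable al be A : coord_measurable (soft_below al be A).
Proof.
apply: measurableT_comp => //; apply: measurableT_comp => //.
under eq_fun do rewrite big_mkcond.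
apply: measurable_sum => i; case: (A i) => //.
apply: measurableT_comp => //; apply: measurable_funD => //.
by apply: measurable_funM => //; exact: measurable_tnth_fun.
Qed.

Lemma soft_below_mon al be (A : pred I) x y : 0 <= al -> (forall i, A i -> x i <= y i) ->
  soft_below al be A y <= soft_below al be A x.
Proof.
move=> al0 xy; rewrite ler_expR lerN2; apply: ler_sum => i Ai.
by rewrite ler_expR lerD2r ler_wpM2l// xy.
Qed.

(** From [expR (- u) * u <= 1]: the unbounded exponential produced by differentiating [soft_below]
    is absorbed by [soft_below] itself. *)
Lemma soft_below_exp_le1 al be (A : pred I) x j : A j ->
  0 <= soft_below al be A x * expR (al * x j + be) <= 1.
Proof.
move=> Aj; rewrite mulr_ge0 ?expR_ge0//=.
apply: le_trans (_ : expR (- expR (al * x j + be)) * expR (al * x j + be) <= _).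
  rewrite ler_wpM2r ?expR_ge0// ler_expR lerN2 (bigD1 j)//= lerDl.
  by apply: sumr_ge0 => i _; exact: expR_ge0.
rewrite -expRD -[leRHS]expR0 ler_expR addrC subr_le0.
by apply: le_trans (expR_ge1Dx _); rewrite lerDr.
Qed.

Lemma is_derive_bigsum (J : finType) (A : pred J) (h : J -> R -> R) (dh : J -> R) (t : R) :
  (forall j, is_derive t 1 (h j) (dh j)) ->
  is_derive t 1 (fun u => \sum_(j | A j) h j u) (\sum_(j | A j) dh j).
Proof.
move=> dhj; have -> : (fun u => \sum_(j | A j) h j u) = \sum_(j | A j) h j.
  by apply/funext => u; rewrite fct_sumE.
apply: (big_ind2 (fun (f : R -> R) (df : R) => is_derive t 1 f df)) => //.
- exact: is_derive_cst.
- by move=> f df g dg h1 h2; exact: is_deriveD.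
Qed.

Lemma is_derive_soft_below al be (A : pred I) (x y : I -> R) (t : R) :
  is_derive t 1 (fun u => soft_below al be A (fun i => cos u * x i + sin u * y i))
    (- \sum_(j | A j) al * (soft_below al be A (fun i => cos t * x i + sin t * y i) *
       expR (al * (cos t * x j + sin t * y j) + be)) * (- sin t * x j + cos t * y j)).
Proof.
have d1 j : is_derive t 1 (fun u => al * (cos u * x j + sin u * y j) + be)
    (al * (- sin t * x j + cos t * y j)).
  by apply: is_derive_eq; rewrite /GRing.scale /=; ring.
have d2 j := is_derive1_comp (is_derive_expR _) (d1 j).
have d3 := is_derive_bigsum A d2.
have d4 : is_derive t 1 (fun u => - \sum_(j | A j) expR (al * (cos u * x j + sin u * y j) + be))
   (- \sum_(j | A j) expR (al * (cos t * x j + sin t * y j) + be) * (al * (- sin t * x j + cos t * y j))).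
  exact: is_deriveN d3.
have := is_derive1_comp (is_derive_expR _) d4.
move/is_derive_eq; apply; rewrite /soft_below /= mulrN mulr_sumr; congr (- _).
by apply: eq_bigr => j _; ring.
Qed.

Section interpolation.
Variables (S : pred I) (al be : R).
Hypotheses (al0 : 0 <= al) (C1 : forall i, C i i = 1) (C0 : forall i j, 0 <= C i j).

(* The expectation of [h t] interpolates between those of [f g] at [t = 0] and of
   two independent copies at [t = pi / 2], and is non-increasing in between. *)
Let f := soft_below al be S.
Let g := soft_below al be (predC S).
Let y (t : R) (w : Y * Y) (j : I) : R := cos t * X j w.1 + sin t * X j w.2.
Let y' (t : R) (w : Y * Y) (j : I) : R := - sin t * X j w.1 + cos t * X j w.2.
Let h (t : R) (w : Y * Y) : R := f (X ^~ w.1) * g (y t w).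
Let e (j : I) (x : I -> R) : R := g x * expR (al * x j + be).
Let dh (t : R) (w : Y * Y) : R :=
  f (X ^~ w.1) * (- \sum_(j | predC S j) al * e j (y t w) * y' t w j).
Let bound (w : Y * Y) : R := al * \sum_j (`|X j w.1| + `|X j w.2|).

Let is_derive_h (t : R) (w : Y * Y) : is_derive t 1 (h ^~ w) (dh t w).
Proof.
have := is_derive_soft_below al be (predC S) (X ^~ w.1) (X ^~ w.2) t.
move=> d1; have := is_deriveZ (f (X ^~ w.1)) d1.
by move/is_derive_eq; apply.
Qed.

Let f01 x : 0 <= f x <= 1. Proof. exact: soft_below01. Qed.
Let g01 x : 0 <= g x <= 1. Proof. exact: soft_below01. Qed.
Let e01 j x : predC S j -> 0 <= e j x <= 1. Proof. exact: soft_below_exp_le1. Qed.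
Let mX i : measurable_fun setT (X i). Proof. by case: gX. Qed.
Let cmf : coord_measurable f. Proof. exact: soft_below_coord_measurable. Qed.
Let cmg : coord_measurable g. Proof. exact: soft_below_coord_measurable. Qed.
Let cme j : coord_measurable (e j).
Proof.
apply: measurable_funM; first exact: cmg.
apply: measurableT_comp => //; apply: measurable_funD => //.
by apply: measurable_funM => //; exact: measurable_tnth_fun.
Qed.

Let my t j : measurable_fun setT (y t ^~ j).
Proof.
apply: measurable_funD; apply: measurable_funM => //.
  exact: measurable_fun_fst.
exact: measurable_fun_snd.
Qed.

Let my' t j : measurable_fun setT (y' t ^~ j).
Proof.
apply: measurable_funD; apply: measurable_funM => //.
  exact: measurable_fun_fst.
exact: measurable_fun_snd.
Qed.

Let mh t : measurable_fun setT (h t).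
Proof.
apply: measurable_funM.
  by apply: (coord_measurable_comp cmf) => i; exact: measurable_fun_fst.
exact: (coord_measurable_comp cmg (W := fun j w => y t w j) (my t)).
Qed.

Let h01 t w : 0 <= h t w <= 1.
Proof.
have /andP[f0 f1] := f01 (X ^~ w.1); have /andP[g0 g1] := g01 (y t w).
by rewrite mulr_ge0//= mulr_ile1.
Qed.

Let integrable_h t : (P \x P)%E.-integrable setT (EFin \o h t).
Proof. exact: (@bounded_integrable01 _ _ _ (P \x P)%E _ (mh t) (h01 t)). Qed.

Let integrable_abs_pair j :
  (P \x P)%E.-integrable setT (fun w => (`|X j w.1| + `|X j w.2|)%:E).
Proof.
have i1 := integrable_fst P (integrable_abs_coord j).
have i2 := integrable_snd P (integrable_abs_coord j).
by apply: eq_integrable (integrableD measurableT i1 i2).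
Qed.

Let integrable_bound : (P \x P)%E.-integrable setT (EFin \o bound).
Proof.
have [i _] := Rint_lin (fun=> al) integrable_abs_pair.
by apply: eq_integrable i => // w _; rewrite /= /bound mulr_sumr.
Qed.

Let y'_le t w j : `|y' t w j| <= `|X j w.1| + `|X j w.2|.
Proof.
apply: le_trans (ler_normD _ _) _; rewrite !normrM normrN.
by apply: lerD; rewrite ler_piMl// ?sin_le1n// cos_le1n.
Qed.

Let dh_le t w : `|dh t w| <= bound w.
Proof.
rewrite /dh normrM normrN; have /andP[f0 f1] := f01 (X ^~ w.1).
rewrite (ger0_norm f0).
apply: le_trans (_ : `|\sum_(j | predC S j) al * e j (y t w) * y' t w j| <= _).
  by rewrite ler_piMl.
apply: le_trans (ler_norm_sum _ _ _) _.
rewrite /bound mulr_sumr [leRHS](bigID (predC S))/= -[leLHS]addr0; apply: lerD.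
  apply: ler_sum => j Sj; have /andP[e0 e1] := e01 (y t w) Sj.
  rewrite 2!normrM (ger0_norm al0) (ger0_norm e0) -mulrA ler_wpM2l//.
  by apply: le_trans (_ : `|y' t w j| <= _); [rewrite ler_piMl|exact: y'_le].
by apply: sumr_ge0 => j _; rewrite mulr_ge0// addr_ge0.
Qed.

Let integrable_term t j : predC S j -> (P \x P)%E.-integrable setT
  (EFin \o (fun w => f (X ^~ w.1) * e j (y t w) * y' t w j)).
Proof.
move=> Sj; apply: le_integrable (integrable_abs_pair j) => //.
  apply/measurable_EFinP; apply: measurable_funM => //; apply: measurable_funM.
    by apply: (coord_measurable_comp cmf) => i; exact: measurable_fun_fst.
  exact: (coord_measurable_comp (cme j) (W := fun i w => y t w i) (my t)).
move=> w _ /=; rewrite lee_fin.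
rewrite [leRHS]ger0_norm ?addr_ge0//.
apply: le_trans (y'_le t w j); rewrite normrM ler_piMl// normrM.
have /andP[f0 f1] := f01 (X ^~ w.1); have /andP[e0 e1] := e01 (y t w) Sj.
by rewrite !ger0_norm// mulr_ile1.
Qed.

(** A rotation by the angle [t] turns [y t] into the first copy, [y' t] into the second, and the
    argument of [f] into [cos t * X i w.1 - sin t * X i w.2]. For a fixed first copy, [f] of this is
    non-decreasing in the second copy because [f] is non-increasing and [sin t >= 0];
    [monotone_covariance] then applies to the inner integral. *)
Let term_ge0 t j : 0 <= cos t -> 0 <= sin t -> predC S j ->
  0 <= \int[(P \x P)%E]_w (f (X ^~ w.1) * e j (y t w) * y' t w j).
Proof.
move=> ct0 st0 Sj.
pose F (v : I + I -> R) := f (fun i => v (inl i)) *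
  e j (fun i => cos t * v (inl i) + sin t * v (inr i)) *
  (- sin t * v (inl j) + cos t * v (inr j)).
have mF : coord_measurable F.
{ apply: measurable_funM.
  - apply: measurable_funM.
      by apply: (coord_measurable_comp cmf) => i; exact: measurable_tnth_fun.
    apply: (coord_measurable_comp (cme j)) => i.
    by apply: measurable_funD; apply: measurable_funM => //; exact: measurable_tnth_fun.
  - by apply: measurable_funD; apply: measurable_funM => //; exact: measurable_tnth_fun. }
have [_ rot] := gaussian_rotation (cos2Dsin2 t) mF.
rewrite -/F in rot *.
have -> : \int[(P \x P)%E]_w (f (X ^~ w.1) * e j (y t w) * y' t w j) =
    \int[(P \x P)%E]_w (e j (X ^~ w.1) *
      (f (fun i => cos t * X i w.1 - sin t * X i w.2) * X j w.2)).
{ rewrite [LHS]rot; apply: eq_Rintegral => w _; rewrite /F /=.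
  have E i : cos t * (cos t * X i w.1 - sin t * X i w.2) +
     sin t * (sin t * X i w.1 + cos t * X i w.2) = X i w.1.
    transitivity ((cos t ^+ 2 + sin t ^+ 2) * X i w.1); first by ring.
    by rewrite cos2Dsin2 mul1r.
  have E' : - sin t * (cos t * X j w.1 - sin t * X j w.2) +
     cos t * (sin t * X j w.1 + cos t * X j w.2) = X j w.2.
    transitivity ((cos t ^+ 2 + sin t ^+ 2) * X j w.2); first by ring.
    by rewrite cos2Dsin2 mul1r.
  rewrite E' (funext E).
  rewrite mulrA; congr (_ * _); exact: mulrC. }
have mfr : measurable_fun setT (fun w : Y * Y => f (fun i => cos t * X i w.1 - sin t * X i w.2)).
  apply: (coord_measurable_comp cmf) => i; apply: measurable_funB; apply: measurable_funM => //.
    exact: measurable_fun_fst.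
  exact: measurable_fun_snd.
have mfr1 x : measurable_fun setT (fun w => f (fun i => cos t * X i x - sin t * X i w)).
  apply: (coord_measurable_comp cmf) => i; apply: measurable_funB => //.
  exact: measurable_funM.
have ifr x : P.-integrable setT (EFin \o (fun w => f (fun i => cos t * X i x - sin t * X i w) * X j w)).
{ apply: le_integrable (integrable_abs_coord j) => //.
    by apply/measurable_EFinP; exact: measurable_funM.
  move=> w _ /=; rewrite lee_fin normr_id normrM.
  have /andP[f0 f1] := f01 (fun i => cos t * X i x - sin t * X i w).
  by rewrite ger0_norm// ler_piMl. }
rewrite Rfubini1.
- apply: Rintegral_ge0 => x _; rewrite /= RintegralZl//.
  have /andP[e0 _] := e01 (X ^~ x) Sj; rewrite mulr_ge0//.
  apply: (@monotone_covariance j S (fun x' => f (fun i => cos t * X i x - sin t * x' i))).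
  + exact: C1.
  + by move=> i _; exact: C0.
  + apply: (coord_measurable_comp cmf) => i; apply: measurable_funB => //.
    by apply: measurable_funM => //; exact: measurable_tnth_fun.
  + by move=> x'; exact: f01.
  + move=> x1 x2 x12; apply: soft_below_mon => // i Si.
    by rewrite lerD2l lerN2 ler_wpM2l// x12.
- apply: le_integrable (integrable_snd P (integrable_abs_coord j)) => //.
    apply/measurable_EFinP; apply: measurable_funM.
      by apply: (coord_measurable_comp (cme j)) => i; exact: measurable_fun_fst.
    by apply: measurable_funM => //; exact: measurable_fun_snd.
  move=> w _ /=; rewrite lee_fin normr_id mulrA normrM.
  have /andP[f0 f1] := f01 (fun i => cos t * X i w.1 - sin t * X i w.2).
  have /andP[e0 e1] := e01 (X ^~ w.1) Sj.
  by rewrite ler_piMl// normrM !ger0_norm// mulr_ile1.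
- move=> x; have := integrableZl measurableT (e j (X ^~ x)) (ifr x).
  by apply: eq_integrable.
Qed.

Let dh_le0 t : 0 <= cos t -> 0 <= sin t -> \int[(P \x P)%E]_w dh t w <= 0.
Proof.
move=> ct0 st0.
pose T j w := if predC S j then f (X ^~ w.1) * e j (y t w) * y' t w j else 0.
have iTj j : (P \x P)%E.-integrable setT (fun w => (T j w)%:E).
  rewrite /T; have [Sj|Sj] := boolP (predC S j); first exact: integrable_term.
  by apply: (@bounded_integrable _ _ _ (P \x P)%E (cst 0) 0) => // w; rewrite normr0.
have E w : dh t w = \sum_j - al * T j w.
  rewrite /dh -mulr_sumr /T -big_mkcond /= !mulr_sumr mulrN mulr_sumr -sumrN; apply: eq_bigr => j _.
  by ring.
under eq_Rintegral do rewrite E.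
have [_ ->] := Rint_lin (fun=> - al) iTj.
apply: sumr_le0 => j _; rewrite mulr_le0_ge0 ?oppr_le0// /T.
have [Sj|Sj] := boolP (predC S j); first exact: term_ge0.
by rewrite Rint_cst.
Qed.

Lemma soft_below_association :
  (\int[P]_w f (X ^~ w)) * (\int[P]_w g (X ^~ w)) <= \int[P]_w (f (X ^~ w) * g (X ^~ w)).
Proof.
pose H t := \int[(P \x P)%E]_w h t w.
have dH (t : R) : is_derive t 1 H (\int[(P \x P)%E]_w dh t w).
{ have tI : `]t - 1, t + 1[%classic t by rewrite /= in_itv /= ltrBlDr ltrDl ltr01.
  have i1 x : `]t - 1, t + 1[%classic x -> (P \x P)%E.-integrable setT (EFin \o h x).
    by move=> _; exact: integrable_h.
  have der (x : R) (w : Y * Y) : `]t - 1, t + 1[%classic x -> setT w -> derivable (h ^~ w) x 1.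
    by move=> _ _; exact: (@ex_derive _ _ _ _ _ _ _ (is_derive_h x w)).
  have d1 x w : partial1of2 h x w = dh x w.
    by rewrite partial1of2E; exact: (@derive_val _ _ _ _ _ _ _ (is_derive_h x w)).
  have b0 w : 0 <= bound w.
    by rewrite mulr_ge0// sumr_ge0// => j _; rewrite addr_ge0.
  have gub (x : R) (w : Y * Y) : `]t - 1, t + 1[%classic x -> setT w ->
      `|partial1of2 h x w| <= bound w.
    by move=> _ _; rewrite d1; exact: dh_le.
  have D := derivable_under_integral measurableT tI i1 der b0 integrable_bound gub.
  have E := differentiation_under_integral measurableT tI i1 der b0 integrable_bound gub.
  apply: DeriveDef; first exact: D.
  by rewrite -derive1E E; apply: eq_Rintegral => w _; rewrite d1. }
have pi20 : 0 < pi / 2 :> R by rewrite divr_gt0// pi_gt0.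
have cH : {within `[0, pi / 2], continuous H}.
  apply: derivable_within_continuous => t _.
  exact: (@ex_derive _ _ _ _ _ _ _ (dH t)).
have [t tI Ht] := @MVT _ H (fun t => \int[(P \x P)%E]_w dh t w) _ _ pi20 (fun t _ => dH t) cH.
have H0 : H 0 = \int[P]_w (f (X ^~ w) * g (X ^~ w)).
{ have mfg : measurable_fun setT (fun w => f (X ^~ w) * g (X ^~ w)).
    apply: measurable_funM; first exact: (coord_measurable_comp cmf).
    exact: (coord_measurable_comp cmg).
  have fg01 w : 0 <= f (X ^~ w) * g (X ^~ w) <= 1.
    have /andP[f0 f1] := f01 (X ^~ w); have /andP[g0 g1] := g01 (X ^~ w).
    by rewrite mulr_ge0//= mulr_ile1.
  rewrite /H (@Rfubini1_bounded _ _ _ _ _ _ _ _ 1)//; last by move=> z; apply: norm01.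
  apply: eq_Rintegral => w _.
  rewrite (_ : (fun v => _) = cst (f (X ^~ w) * g (X ^~ w))) ?Rint_cst//.
  apply/funext => v; rewrite /h /y /= cos0 sin0; congr (_ * g _).
  by apply/funext => i; rewrite mul1r mul0r addr0. }
have H1 : H (pi / 2) = (\int[P]_w f (X ^~ w)) * (\int[P]_w g (X ^~ w)).
{ rewrite /H (@Rfubini1_bounded _ _ _ _ _ _ _ _ 1)//; last by move=> z; apply: norm01.
  have mg : measurable_fun setT (fun w => g (X ^~ w)) by exact: (coord_measurable_comp cmg).
  have mf : measurable_fun setT (fun w => f (X ^~ w)) by exact: (coord_measurable_comp cmf).
  have Hw w : \int[P]_v h (pi / 2) (w, v) = f (X ^~ w) * \int[P]_v g (X ^~ v).
    rewrite -(Rint01Zl P (f (X ^~ w)) mg (fun v => g01 _)).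
    apply: eq_Rintegral => v _; rewrite /h /y /= cos_pihalf sin_pihalf; congr (_ * g _).
    by apply/funext => i; rewrite mul1r mul0r add0r.
  rewrite -(Rint01Zr P (\int[P]_v g (X ^~ v)) mf (fun v => f01 _)).
  by apply: eq_Rintegral => w _; exact: Hw. }
rewrite -H1 -H0 -subr_ge0 -opprB Ht oppr_ge0.
move: tI; rewrite in_itv /= => /andP[t0 t2].
rewrite subr0 mulr_le0_ge0 ?(ltW pi20)//; apply: dh_le0.
  by apply: cos_ge0_pihalf; rewrite (ltW t2) andbT; apply: le_trans (ltW t0); rewrite oppr_le0 ltW.
apply: sin_ge0_pi; rewrite (ltW t0) /=.
by apply: le_trans (ltW t2) _; rewrite ler_pdivrMr// ler_peMr ?pi_ge0// ler1n.
Qed.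

End interpolation.
End association.

Section below_indicator.
Context {R : realType} {I : finType}.

Definition below_ind (r : R) (A : pred I) (x : I -> R) : R :=
  ([forall i, A i ==> (x i < r)] : bool)%:R.

Lemma below_ind01 r A x : 0 <= below_ind r A x <= 1.
Proof. by rewrite /below_ind; case: [forall i, _]; rewrite ?lexx ?ler01. Qed.

Lemma below_ind_indic {V : Type} (X : I -> V -> R) r A w :
  below_ind r A (X ^~ w) = \1_[set w | forall i, A i -> X i w < r] w.
Proof.
rewrite indicE; congr (_%:R); congr nat_of_bool; apply/idP/idP.
  by move/forallP => h; rewrite inE /= => i Ai; have := h i; rewrite Ai.
by rewrite inE /= => h; apply/forallP => i; apply/implyP; exact: h.
Qed.

Lemma below_ind_coord_measurable r A : coord_measurable (below_ind r A).
Proof.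
rewrite /coord_measurable.
rewrite (_ : (fun t => _) = \1_[set t : #|I|.-tuple (measurableTypeR R) |
    forall i, A i -> tnth t (enum_rank i) < r]).
  apply: measurable_indic.
  by apply: measurable_rays_in => i; exact: measurable_tnth_fun.
by apply/funext => t; rewrite (@below_ind_indic _ (fun i t => tnth t (enum_rank i))).
Qed.

Lemma Rint_below_ind {d} {V : measurableType d} (P : probability V R) (X : I -> V -> R) r A :
  (forall i, measurable_fun setT (X i)) ->
  \int[P]_w below_ind r A (X ^~ w) = fine (P [set w | forall i, A i -> X i w < r]).
Proof.
move=> mX; under eq_Rintegral do rewrite below_ind_indic.
rewrite /Rintegral integral_indic ?setIT//; exact: measurable_rays_in.
Qed.

End below_indicator.

Section orthant_association.
Context {R : realType} {d : measure_display} {Y : measurableType d} (P : probability Y R).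
Context {I : finType} (X : I -> Y -> R) (C : I -> I -> R).
Hypothesis gX : gaussian_family P X C.

(** With N = [n.+1%:R], the inner exponent at [v] is N (N (v - r) + 1). The extra N makes it tend to
    +oo at [v = r] as well, so the limit is the indicator of a strict inequality. *)
Lemma cvg_soft_below (r : R) (A : pred I) (x : I -> R) :
  soft_below (n.+1%:R ^+ 2) (n.+1%:R - n.+1%:R ^+ 2 * r) A x @[n --> \oo]
    --> ((([forall i, A i ==> (x i < r)] : bool)%:R) : R).
Proof.
have expn_ge (n : nat) : n.+1%:R <= expR n.+1%:R :> R.
  by apply: le_trans (expR_ge1Dx _); rewrite lerDr.
have expn_le (n : nat) : expR (- n.+1%:R) <= n.+1%:R^-1 :> R.
  by rewrite expRN lef_pV2 ?posrE ?expR_gt0.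
have E (n : nat) (v : R) : n.+1%:R ^+ 2 * v + (n.+1%:R - n.+1%:R ^+ 2 * r) =
    n.+1%:R * (n.+1%:R * (v - r) + 1) by ring.
have [/forallP h|] := boolP [forall i, A i ==> (x i < r)].
- have e0 i : A i -> expR (n.+1%:R ^+ 2 * x i + (n.+1%:R - n.+1%:R ^+ 2 * r)) @[n --> \oo] --> (0 : R).
  { move=> Ai; have xr : x i < r by have := h i; rewrite Ai.
    apply: (@squeeze_cvgr _ _ _ _ (cst 0) (fun n : nat => n.+1%:R^-1)).
    - near=> n; rewrite expR_ge0 /= E; apply: le_trans (expn_le n).
      rewrite ler_expR -[leRHS]mulrN1 ler_pM2l//.
      suff : 2 <= n.+1%:R * (r - x i) by move: (n.+1%:R : R) => v; nra.
      rewrite -ler_pdivrMr ?subr_gt0//; apply: le_trans (_ : n%:R <= _); last by rewrite ler_nat.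
      by near: n; exact: nbhs_infty_ger.
    - exact: cvg_cst.
    - exact: cvg_harmonic. }
  have s0 : \sum_(i | A i) expR (n.+1%:R ^+ 2 * x i + (n.+1%:R - n.+1%:R ^+ 2 * r))
      @[n --> \oo] --> (\sum_(i | A i) 0 : R).
  {
    rewrite (_ : (fun n : nat => _) = \sum_(i | A i) (fun n : nat =>
        expR (n.+1%:R ^+ 2 * x i + (n.+1%:R - n.+1%:R ^+ 2 * r)))); last first.
      by apply/funext => n; rewrite fct_sumE.
    apply: (big_ind2 (fun (u : nat -> R) (l : R) => u @ \oo --> l)).
    - exact: cvg_cst.
    - by move=> u l v k ul vk; apply: (@cvgD _ R^o).
    - by move=> i Ai; exact: e0.
  }
  rewrite big1// in s0.
  have : expR (- \sum_(i | A i) expR (n.+1%:R ^+ 2 * x i + (n.+1%:R - n.+1%:R ^+ 2 * r)))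
      @[n --> \oo] --> expR (- 0 : R).
    apply: (@cvg_comp _ _ _ _ (@expR R)); last exact: continuous_expR.
    by apply: (@cvgN _ R^o).
  by rewrite oppr0 expR0.
- rewrite negb_forall => /existsP[i]; rewrite negb_imply -leNgt => /andP[Ai rx].
  apply: (@squeeze_cvgr _ _ _ _ (cst 0) (fun n : nat => n.+1%:R^-1)).
  + near=> n; rewrite expR_ge0 /=; apply: le_trans (expn_le n).
    rewrite ler_expR lerN2; apply: le_trans (expn_ge n) _.
    rewrite (bigD1 i)//= E; apply: le_trans (_ : expR (n.+1%:R * (n.+1%:R * (x i - r) + 1)) <= _).
      rewrite ler_expR ler_peMr// lerDr mulr_ge0// subr_ge0//.
    by rewrite lerDl; apply: sumr_ge0 => k _; exact: expR_ge0.
  + exact: cvg_cst.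
  + exact: cvg_harmonic.
Unshelve. all: by end_near. Qed.

Let mX i : measurable_fun setT (X i). Proof. by case: gX. Qed.

Lemma cvg_soft_below_integral (r : R) (A : pred I) :
  \int[P]_w soft_below (n.+1%:R ^+ 2) (n.+1%:R - n.+1%:R ^+ 2 * r) A (X ^~ w) @[n --> \oo]
    --> fine (P [set w | forall i, A i -> X i w < r]).
Proof.
rewrite -Rint_below_ind//; apply: fine_cvg; rewrite fineK; last first.
  apply: integrable_fin_num => //; apply: bounded_integrable01; last by move=> w; exact: below_ind01.
  exact: (coord_measurable_comp (below_ind_coord_measurable r A)).
apply: (@dominated_cvg _ _ _ P _ measurableT _ _ (cst 1%E)).
- move=> n; apply/measurable_EFinP.
  exact: (coord_measurable_comp (soft_below_coord_measurable _ _ _)).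
- by move=> w _; apply: cvg_EFin; [exact: nearW|exact: cvg_soft_below].
- by [].
- exact: finite_measure_integrable_cst.
- move=> n w _; rewrite abse_EFin lee_fin; apply: norm01; exact: soft_below01.
Qed.

(* Pitt's inequality for orthants: coordinates of a Gaussian vector with
   non-negative correlations are associated. *)
Lemma orthant_association (S : pred I) (r : R) :
  (forall i, C i i = 1) -> (forall i j, 0 <= C i j) ->
  (P [set w | forall i, S i -> (X i w < r)%R] * P [set w | forall i, ~~ S i -> (X i w < r)%R] <=
   P [set w | forall i, (X i w < r)%R])%E.
Proof.
move=> C1 C0.
have c1 := @cvg_soft_below_integral r S.
have c2 := @cvg_soft_below_integral r (predC S).
have c3 := @cvg_soft_below_integral r predT.
have fn (A : pred I) : P [set w | forall i, A i -> X i w < r] \is a fin_num.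
  by apply: fin_num_measure; exact: measurable_rays_in.
have -> : [set w | forall i, X i w < r] = [set w | forall i, predT i -> X i w < r].
  by apply/seteqP; split => w /= h i; have := h i; auto.
rewrite -[X in (X * _)%E]fineK ?fn// -[X in (_ * X)%E]fineK ?(fn (predC S))// -[leRHS]fineK ?fn//.
rewrite -EFinM lee_fin.
apply: ler_cvg_to (cvgM c1 c2) c3 _; apply: nearW => n.
have := soft_below_association gX S (n.+1%:R - n.+1%:R ^+ 2 * r) (sqr_ge0 (n.+1%:R : R)) C1 C0.
move/le_trans; apply; rewrite le_eqVlt; apply/orP; left; apply/eqP.
apply: eq_Rintegral => w _; rewrite /soft_below -expRD; congr expR.
by rewrite -opprD (bigID S (fun i => true))/=.
Qed.

End orthant_association.

(** * Cameron-Martin shift *)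

Section normal_shift.
Context {R : realType}.
Local Notation mu := (@lebesgue_measure R).

Lemma N01_shift_density (u : R -> R) (x : R) : measurable_fun setT u ->
  (forall z, 0 <= u z <= 1) ->
  \int[N01 R]_z u (z - x) = \int[mu]_z (u z * normal_pdf (- x) 1 z).
Proof.
move=> mu_ u01.
have mid : measurable_fun setT (fun z : measurableTypeR R => z : R) by exact: measurable_id.
have mX : measurable_fun setT (fun z : measurableTypeR R => z - x) by exact: measurable_funB.
have [|_ ->] := law_determined1 (N01 R) (normal_prob (- x) 1) mX mid mu_.
  move=> b p; rewrite (@Rintegral_normal_affine _ (- x) 1)//; last exact: continuous_cos_comp.
  by apply: eq_Rintegral => z _; rewrite mul1r (addrC z).
rewrite Rintegral_normal_prob//; exact: (@bounded_integrable01 _ _ _ (normal_prob (- x) 1)).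
Qed.

(* Cauchy-Schwarz for the density ratio [v], in the form
   [2 u v <= k u + v ^+ 2 / k] for [0 <= u <= 1]. *)
Lemma N01_shift_le (u : R -> R) (x k : R) : measurable_fun setT u ->
  (forall z, 0 <= u z <= 1) -> 0 < k ->
  \int[N01 R]_z u (z - x) <= (k * \int[N01 R]_z u z + expR (x ^+ 2) / k) / 2.
Proof.
move=> mu_ u01 k0; rewrite N01_shift_density//.
have mpdf m := @measurable_normal_pdf R m 1.
have ipdf m := @integrable_normal_pdf R m 1.
have iu m : mu.-integrable setT (EFin \o (fun z => u z * normal_pdf m 1 z)).
{ apply: le_integrable (ipdf m) => //.
    apply/measurable_EFinP; exact: (measurable_funM mu_ (mpdf m)).
  move=> z _ /=; rewrite lee_fin normrM; have /andP[u0 u1] := u01 z.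
  by rewrite ger0_norm// ler_piMl. }
rewrite (@Rintegral_normal_prob _ 0 1 u)//; last exact: (@bounded_integrable01 _ _ _ (N01 R)).
have one m : \int[mu]_z normal_pdf m 1 z = 1.
  by rewrite /Rintegral integral_normal_pdf.
have -> : (k * \int[mu]_z (u z * normal_pdf 0 1 z) + expR (x ^+ 2) / k) / 2 =
    \int[mu]_z ((k / 2) * (u z * normal_pdf 0 1 z) + (expR (x ^+ 2) / k / 2) * normal_pdf (- (2 * x)) 1 z).
{ rewrite RintegralD//; last 2 first.
    exact: (integrableZl measurableT (k / 2) (iu 0)).
    exact: (integrableZl measurableT (expR (x ^+ 2) / k / 2) (ipdf (- (2 * x)))).
  rewrite (@RintegralZl _ _ _ _ _ _ _ _ (iu 0))//.
  rewrite (@RintegralZl _ _ _ _ _ _ _ _ (ipdf (- (2 * x))))//.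
  rewrite one mulr1; field; exact: lt0r_neq0. }
apply: le_Rintegral => //.
- exact: (integrableD measurableT (integrableZl measurableT (k / 2) (iu 0))
    (integrableZl measurableT (expR (x ^+ 2) / k / 2) (ipdf (- (2 * x))))).
- move=> z _; rewrite !normal_pdf_gauss// !invr1 !mul1r sub0r.
  have pk := @normal_peak_ge0 R 1.
  (* [v] is the density of N(- x, 1) relative to N(0, 1). By [E2], [v ^+ 2] times the standard
     density is [expR (x ^+ 2)] times the density of N(- 2 x, 1), so the second moment of [v] is
     [expR (x ^+ 2)]. *)
  pose v := expR (- (x * z) - x ^+ 2 / 2).
  have E1 : gauss (- x - z) = gauss (- z) * v.
    by rewrite /gauss /v -expRD; congr expR; field.
  have E2 : expR (x ^+ 2) * gauss (- (2 * x) - z) = gauss (- z) * v ^+ 2.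
    by rewrite /gauss /v -expRM_natl -!expRD; congr expR; field.
  have -> : expR (x ^+ 2) / k / 2 * (normal_peak 1 * gauss (- (2 * x) - z)) =
     normal_peak 1 * (expR (x ^+ 2) * gauss (- (2 * x) - z)) / k / 2 by ring.
  rewrite E1 E2.
  have := gauss_gt0 (- z); have := u01 z; move: (gauss _) (normal_peak 1) pk v {E1 E2} (u z) => g pk pk0 v u0.
  move=> /andP[u00 u11] g0.
  rewrite -subr_ge0.
  have -> : k / 2 * (u0 * (pk * g)) + pk * (g * v ^+ 2) / k / 2 - u0 * (pk * (g * v)) =
      pk * g * ((k - v) ^+ 2 * u0 + v ^+ 2 * (1 - u0)) / (2 * k).
    field; exact: lt0r_neq0.
  apply: mulr_ge0; last by rewrite invr_ge0 mulr_ge0 ?ltW.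
  apply: mulr_ge0; first by rewrite mulr_ge0// ltW.
  by rewrite addr_ge0// mulr_ge0// ?sqr_ge0// subr_ge0.
Qed.

End normal_shift.

Section orthant_shift.
Context {R : realType} {d : measure_display} {Y : measurableType d} (P : probability Y R).
Context {I : finType} (X : I -> Y -> R) (C : I -> I -> R).
Hypothesis gX : gaussian_family P X C.

(* Cameron-Martin shift by [x] along a unit direction whose covariances with
   the coordinates in [A] are at least [M / x]. *)
Lemma orthant_shift (b : I -> R) (A : pred I) (r M x : R) : bil C b b = 1 ->
  (forall i, A i -> M <= bil C (fun k => (k == i)%:R) b * x) ->
  fine (P [set w | forall i, A i -> X i w < r + M]) ^+ 2 <=
  expR (x ^+ 2) * fine (P [set w | forall i, A i -> X i w < r]).
Proof.
move=> b1 cM; have [mX sC cX] := gX.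
set p' := fine _; set p := fine (P [set w | forall i, A i -> X i w < r]).
pose c i := bil C (fun k => (k == i)%:R) b.
pose xi w := \sum_i b i * X i w.
have mxi : measurable_fun setT xi by apply: measurable_sum => i; apply: measurable_funM.
pose V (i : I) (w : Y * measurableTypeR R) : R := X i w.1 + c i * (w.2 - xi w.1).
have mV i : measurable_fun setT (V i).
  apply: measurable_funD; first exact: measurable_fun_fst.
  apply: measurable_funM => //; apply: measurable_funB; first exact: measurable_snd.
  exact: measurable_fun_fst.
have pE s : fine (P [set w | forall i, A i -> X i w < s]) =
    \int[P]_w \int[N01 R]_z below_ind s A (V ^~ (w, z)).
{ rewrite -Rint_below_ind//.
  have mF : coord_measurable (fun x : I + unit -> R => below_ind s A (fun i => x (inl i))).
    by apply: (coord_measurable_comp (below_ind_coord_measurable s A)) => i; exact: measurable_tnth_fun.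
  have [_ ->] := gaussian_family_resample gX b1 (F := fun x _ => below_ind s A x) mF.
  rewrite (@Rfubini1_bounded _ _ _ _ _ _ _ _ 1)//.
    exact: (coord_measurable_comp (below_ind_coord_measurable s A) mV).
  by move=> z; apply: norm01; exact: below_ind01. }
have p0 : 0 <= p by rewrite fine_ge0.
have p'0 : 0 <= p' by rewrite fine_ge0.
have mb s w : measurable_fun setT (fun z : R => below_ind s A (V ^~ (w, z))).
  apply: (coord_measurable_comp (below_ind_coord_measurable s A)) => i.
  rewrite /V /=; apply: measurable_funD; first exact: measurable_cst.
  apply: measurable_funM; first exact: measurable_cst.
  apply: measurable_funB; [exact: measurable_id|exact: measurable_cst].
have mN s : measurable_fun setT (fun w => \int[N01 R]_z below_ind s A (V ^~ (w, z))).
{ have mf : measurable_fun setT (fun w : Y * measurableTypeR R => (below_ind s A (V ^~ w))%:E).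
    apply/measurable_EFinP.
    exact: (coord_measurable_comp (below_ind_coord_measurable s A) mV).
  have := @measurable_fun_fubini_tonelli_F _ _ _ _ _ (N01 R) _ mf.
  move=> h; apply: measurableT_comp => //; apply: h => w.
  by rewrite lee_fin; case/andP: (below_ind01 s A (V ^~ w)). }
have N01_ s w : 0 <= \int[N01 R]_z below_ind s A (V ^~ (w, z)) <= 1.
{ rewrite Rintegral_ge0/=; last by move=> z _; case/andP: (below_ind01 s A (V ^~ (w, z))).
  rewrite -[leRHS](Rint_cst (N01 R)); apply: le_Rint.
  - exact: (bounded_integrable01 (N01 R) (mb s w) (fun z => below_ind01 _ _ _)).
  - by apply: (@bounded_integrable _ _ _ _ _ 1) => // z; rewrite normr1.
  - by move=> z; case/andP: (below_ind01 s A (V ^~ (w, z))). }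
have iN s := bounded_integrable01 P (mN s) (N01_ s).
have key k : 0 < k -> p' <= (k * p + expR (x ^+ 2) / k) / 2.
{ move=> k0; rewrite /p' /p !pE.
  have [iA EA] := Rint_affine (k / 2) (expR (x ^+ 2) / k / 2) (iN r).
  rewrite mulrDl [k * _ / 2]mulrAC -EA; apply: le_Rint => // w.
  (* Translating [z] by [- x] lowers each coordinate in [A] by [c i * x], hence by at least [M]. *)
  apply: le_trans (_ : \int[N01 R]_z below_ind r A (V ^~ (w, z - x)) <= _).
  { apply: le_Rint.
    + exact: (bounded_integrable01 (N01 R) (mb _ w) (fun z => below_ind01 _ _ _)).
    + apply: (bounded_integrable01 (N01 R) _ (fun z => below_ind01 _ _ _)).
      by apply: (measurableT_comp (mb r w)); apply: measurable_funB.
    + move=> z; rewrite /below_ind ler_nat.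
      case: (boolP [forall i, A i ==> (V i (w, z) < r + M)]) => [/forallP h|_]; last by case: [forall i, _].
      have -> // : [forall i, A i ==> (V i (w, z - x) < r)].
      apply/forallP => i; apply/implyP => Ai; have := h i; rewrite Ai /= /V /=.
      by have := cM _ Ai; rewrite -/(c i); lra. }
  have := N01_shift_le x (mb r w) (fun z => below_ind01 _ _ _) k0.
  by rewrite mulrDl [k * _ / 2]mulrAC. }
(* The bound [key] is optimised in [k]. If [p = 0], the choice below gives [p' <= p' / 2], which is
   absurd for [p' > 0]; otherwise [k = p' / p] makes the first term equal to [p']. *)
have [p'00|p'00] := eqVneq p' 0; first by rewrite p'00 expr0n /= mulr_ge0// expR_ge0.
have p'1 : 0 < p' by rewrite lt_neqAle eq_sym p'00.
have e0 := expR_gt0 (x ^+ 2).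
have [p00|p00] := eqVneq p 0.
  have := key (expR (x ^+ 2) / p') (divr_gt0 e0 p'1).
  rewrite p00 !mulr0 add0r invf_div mulrCA mulfV ?gt_eqF//; lra.
have p1 : 0 < p by rewrite lt_neqAle eq_sym p00.
have := key (p' / p) (divr_gt0 p'1 p1).
rewrite divfK// invf_div => h.
have : p' <= expR (x ^+ 2) * (p / p') by lra.
by rewrite mulrA ler_pdivlMr// expr2.
Qed.

End orthant_shift.

(** * Weakly correlated families *)

Section orthant_upper.
Context {R : realType}.
Local Notation mu := (@lebesgue_measure R).

Lemma normal_unit_itv_gt0 (a : R) : (0 < N01 R `[a, (a + 1)%R]%classic)%E.
Proof.
set c := normal_peak (1 : R) * gauss (`|a| + 1).
have c0 : 0 < c by rewrite mulr_gt0 ?gauss_gt0 ?normal_peak_gt0.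
apply: (@lt_le_trans _ _ c%:E); first by rewrite lte_fin.
have E : (\int[mu]_(x in `[a, (a + 1)%R]%classic) (c%:E) = c%:E)%E.
  by rewrite integral_cst//= lebesgue_measure_itv /= lte_fin ltrDl ltr01 -EFinB addrAC subrr add0r mule1.
rewrite -{1}E /normal_prob; apply: ge0_le_integral => //.
- by move=> x _; rewrite lee_fin ltW.
- by apply/measurable_EFinP/measurable_funTS; exact: measurable_normal_pdf.
- move=> x /=; rewrite in_itv /= => /andP[ax xa].
  rewrite lee_fin normal_pdf01E ler_wpM2l ?normal_peak_ge0// /gauss ler_expR lerN2 ler_pM2r//.
  rewrite -[x ^+ 2]real_normK ?num_real// ler_sqr ?nnegrE ?addr_ge0//.
  by rewrite ler_norml; have := ler_norm a; have := ler_norm (- a); rewrite normrN; move=> h1 h2; apply/andP; split; lra.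
Qed.

(** If X < r and X + W >= r + 1 then W >= 1. So this weight at X + W dominates the indicator of X <
    r times exp(- W^2), and it transfers the event to the noisy variables. *)
Definition tail_weight (r : R) (v : R) : R := if v < r + 1 then 1 else expR (- 1).

Lemma tail_weight01 r v : 0 <= tail_weight r v <= 1.
Proof.
rewrite /tail_weight; case: ifP => _; first by rewrite ler01 lexx.
by rewrite expR_ge0 /= -[leRHS]expR0 ler_expR; lra.
Qed.

Lemma measurable_tail_weight r : measurable_fun setT (tail_weight r).
Proof.
rewrite /tail_weight; apply: measurable_fun_ifT => //.
by apply: measurable_fun_ltr.
Qed.

(** Uniformity in [s]: for [z] in the unit interval starting at [|r| + 1], [s * z >= r + 1] as soon
    as [s >= 1], so the weight equals exp(- 1) on a set of fixed positive mass. *)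
Lemma N01_tail_weight (r : R) : exists2 eta : R, 0 < eta &
  forall s, 1 <= s -> \int[N01 R]_z tail_weight r (s * z) <= 1 - eta.
Proof.
pose a := `|r| + 1.
pose B := (`[a, a + 1]%classic : set (measurableTypeR R)).
have mB : measurable B by exact: measurable_itv.
pose p0 := fine (N01 R B).
have fB : N01 R B \is a fin_num by exact: (fin_num_measure (N01 R)).
have p00 : 0 < p0.
  by rewrite fine_gt0//; apply/andP; split; [exact: normal_unit_itv_gt0|rewrite ltey_eq fB].
have e1 : expR (-1) < 1 :> R by rewrite -[ltRHS]expR0 ltr_expR; lra.
exists ((1 - expR (-1)) * p0); first by rewrite mulr_gt0// subr_gt0.
move=> s s1.
have iB : (N01 R).-integrable setT (EFin \o (\1_B : measurableTypeR R -> R)).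
  exact: integrable_indic.
have [iA EA] := Rint_affine (expR (-1) - 1) 1 iB.
have -> : 1 - (1 - expR (-1)) * p0 = \int[N01 R]_z ((expR (-1) - 1) * \1_B z + 1).
  by rewrite EA /Rintegral integral_indic// setIT -/p0; ring.
apply: le_Rint => //.
- apply: (@bounded_integrable01 _ _ _ (N01 R) (fun z : measurableTypeR R => tail_weight r (s * z))).
    by apply: measurableT_comp; [exact: measurable_tail_weight|exact: measurable_funM].
  by move=> z; exact: tail_weight01.
- move=> z; rewrite indicE /tail_weight; case: (boolP (z \in B)) => [|_] /=; last first.
    by rewrite mulr0 add0r; case: ifP => // _; exact: ltW.
  rewrite inE /B /= in_itv /= => /andP[az _].
  rewrite mulr1 subrK ltNge (_ : r + 1 <= s * z)//.
  have := ler_norm r; have := normr_ge0 r; move: az; rewrite /a => az r0 rr.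
  by apply: (@le_trans _ _ z); [lra|rewrite ler_peMl//; lra].
Qed.

(** Let p be the probability, n the number of variables and W the noise. By [tail_weight], p E exp(-
    sum of W_i^2) is at most the expectation of a product over i.i.d. variables of variance 1 + eps,
    hence at most (1 - eta)^n <= exp(- 2 eps n) with [eps = eta / 2]. Since E exp(- sum of W_i^2) >=
    exp(- eps n), one factor exp(- eps n) remains. *)
Lemma orthant_upper_bound (r : R) : exists2 eps : R, 0 < eps &
  forall (I : finType) (d : measure_display) (Y : measurableType d) (P : probability Y R)
    (X : I -> Y -> R) (C : I -> I -> R),
    gaussian_family P X C -> (forall i, C i i = 1) -> (forall i j, 0 <= C i j) ->
    (forall i, \sum_(j | j != i) C i j <= eps) ->
    fine (P [set w | forall i, X i w < r]) <= expR (- (eps * #|I|%:R)).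
Proof.
have [eta eta0 heta] := N01_tail_weight r.
exists (eta / 2); first by rewrite divr_gt0.
move=> I d Y P X C gX C1 C0; set eps := eta / 2 => rho_eps.
have eps0 : 0 < eps by rewrite divr_gt0.
have [mX sC cX] := gX.
pose rho i := \sum_(j | j != i) C i j.
have [d' [Y' [Q [zeta [mz cz _]]]]] := iid_normal R (I * I)%type.
have gz : gaussian_family Q zeta (fun k l => (k == l)%:R).
{ split => //; first by move=> k l; rewrite eq_sym.
  by move=> a p; rewrite cz bil_id; under eq_bigr do rewrite expr2. }
(* The noise [W] of covariance [(1 + eps) - C]: the variable indexed by [(i, j)]
   cancels the covariance of [i] and [j], the one indexed by [(i, i)] completes
   the variance. *)
pose L (b : I -> R) (k : I * I) : R := if k.1 == k.2 then Num.sqrt (eps - rho k.1) * b k.1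
  else Num.sqrt (C k.1 k.2 / 2) * (b k.1 - b k.2).
have variance b : bil C b b + \sum_k L b k ^+ 2 = (1 + eps) * \sum_i b i ^+ 2.
{ pose D a c := if a == c then 0 else C a c.
  have rhoE a : rho a = \sum_c D a c.
    by rewrite /rho big_mkcond; apply: eq_bigr => c _; rewrite /D eq_sym; case: eqVneq.
  rewrite -(pair_bigA _ (fun a c => L b (a, c) ^+ 2)) /bil -big_split /=.
  (* Each cross term [C a c * (b a * b c)] cancels against that of [C a c / 2 * (b a - b c) ^+ 2].
     The squares left over sum to [rho a * b a ^+ 2], which the diagonal noise completes. *)
  transitivity (\sum_a \sum_c (D a c / 2 * b a ^+ 2 + D a c / 2 * b c ^+ 2 +
      (a == c)%:R * ((1 + eps - rho a) * b a ^+ 2))).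
    apply: eq_bigr => a _; rewrite -big_split /=; apply: eq_bigr => c _.
    rewrite /L /= /D; case: eqVneq => [->|ac].
      by rewrite exprMn sqr_sqrtr ?subr_ge0 ?rho_eps// C1 mul1r /=; ring.
    by rewrite exprMn sqr_sqrtr ?divr_ge0//=; field.
  transitivity (\sum_a (rho a / 2 * b a ^+ 2) + \sum_a (rho a / 2 * b a ^+ 2) +
      \sum_a (1 + eps - rho a) * b a ^+ 2).
  { under eq_bigr do rewrite !big_split /=.
    rewrite !big_split /=; congr (_ + _ + _).
    + by apply: eq_bigr => a _; rewrite rhoE !mulr_suml.
    + rewrite exchange_big; apply: eq_bigr => a _; rewrite rhoE !mulr_suml.
      by apply: eq_bigr => c _; rewrite /D eq_sym sC.
    + apply: eq_bigr => a _; rewrite (bigD1 a)//= eqxx mul1r big1 ?addr0// => c.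
      by rewrite eq_sym => /negPf ->; rewrite mul0r. }
  rewrite -!big_split mulr_sumr; by apply: eq_bigr => a _ /=; field. }
pose de (i j : I) : R := (j == i)%:R.
have sumde (b c : I -> R) (k : I) : \sum_i b i * de i k = b k.
  rewrite (bigD1 k)//= /de eqxx mulr1 big1 ?addr0// => j.
  by rewrite eq_sym => /negPf ->; rewrite mulr0.
have linL b k : \sum_i b i * L (de i) k = L b k.
{ rewrite /L; case: ifP => _.
    by under eq_bigr do rewrite mulrCA; rewrite -mulr_sumr sumde.
  under eq_bigr do rewrite mulrCA; rewrite -mulr_sumr; congr (_ * _).
  by under eq_bigr do rewrite mulrBr; rewrite sumrB !sumde. }
pose W i y := \sum_k L (de i) k * zeta k y.
have mW i : measurable_fun setT (W i).
  by apply: measurable_sum => k; apply: measurable_funM.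
have varW i : Q.-integrable setT (fun y => (W i y ^+ 2)%:E) /\ \int[Q]_y (W i y ^+ 2) = eps.
{ have [h1 h2] := gaussian_sq gz (L (de i)); split => //.
  rewrite h2 bil_id; under eq_bigr do rewrite -expr2.
  have := variance (de i); rewrite {1}/de bil_delta C1.
  have -> : \sum_j de i j ^+ 2 = 1.
    rewrite (bigD1 i)//= {1}/de eqxx expr1n big1 ?addr0// => j.
    by rewrite /de => /negPf ->; rewrite expr0n.
  move=> h; move: h; set S := \sum_i _ => h; move: S h => S h; lra. }
pose s := Num.sqrt (1 + eps).
have s1 : 1 <= s by rewrite -[leLHS]sqrtr1 ler_wsqrtr// lerDl ltW.
have [d1 [Y1 [Q1 [xi [mxi cxi pxi]]]]] := iid_normal R I.
pose V i (w : Y * Y') := X i w.1 + W i w.2.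
have mV i : measurable_fun setT (V i).
  by apply: measurable_funD; [exact: measurable_fun_fst|exact: measurable_fun_snd].
pose V' i y := s * xi i y.
have mV' i : measurable_fun setT (V' i) by apply: measurable_funM.
have eqcf (b : I -> R) (p : R) : \int[(P \x Q)%E]_w cos (\sum_i b i * V i w + p) =
    \int[Q1]_w cos (\sum_i b i * V' i w + p).
{ rewrite (gaussian_family_cf_prod gX gz (V := V) (L := id) (M := L)); last first.
    move=> a w; rewrite /V; under eq_bigr do rewrite mulrDr.
    rewrite big_split /=; congr (_ + _); rewrite /W.
    under eq_bigr do rewrite mulr_sumr.
    rewrite exchange_big; apply: eq_bigr => k _ /=.
    by rewrite -linL mulr_suml; apply: eq_bigr => i _; rewrite mulrA.
  under [RHS]eq_Rintegral do under eq_bigr do rewrite mulrA.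
  rewrite cxi bil_id; under [X in _ + X]eq_bigr do rewrite -expr2.
  rewrite variance mulr_sumr; congr (_ * expR (- (_ / 2))).
  by apply: eq_bigr => i _; rewrite exprMn sqr_sqrtr ?addr_ge0 ?(ltW eps0)// mulrC. }
pose F (x : I -> R) := \prod_i tail_weight r (x i).
have mtw := measurable_tail_weight r.
have mF : coord_measurable F.
  by apply: measurable_prod_comp => i; apply: measurableT_comp => //; exact: measurable_tnth_fun.
have F01 x : 0 <= F x <= 1 by apply: prod_01 => i; exact: tail_weight01.
pose p := fine (P [set w | forall i, X i w < r]).
have pE : p = \int[P]_w below_ind r predT (X ^~ w).
  by rewrite Rint_below_ind// /p; congr (fine (P _)); apply/seteqP; split => w h i //; exact: h.
pose G y := expR (- \sum_i W i y ^+ 2).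
have mS : measurable_fun setT (fun y => \sum_i W i y ^+ 2).
  by apply: measurable_sum => i; apply: measurable_funX.
have mG : measurable_fun setT G.
  by apply: measurableT_comp => //; apply: measurableT_comp.
have G01 y : 0 <= G y <= 1.
  by rewrite expR_ge0 /= -[leRHS]expR0 ler_expR oppr_le0; apply: sumr_ge0 => i _; exact: sqr_ge0.
have mb : measurable_fun setT (fun w => below_ind r predT (X ^~ w)).
  exact: (coord_measurable_comp (below_ind_coord_measurable r predT)).
have b01 w := below_ind01 r predT (X ^~ w).
have mbG : measurable_fun setT (fun z : Y * Y' => below_ind r predT (X ^~ z.1) * G z.2).
  exact: (measurable_funM (measurable_fun_fst mb) (measurable_fun_snd mG)).
have bG01 (z : Y * Y') : 0 <= below_ind r predT (X ^~ z.1) * G z.2 <= 1.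
  have /andP[x0 x1] := b01 z.1; have /andP[y0 y1] := G01 z.2.
  by rewrite mulr_ge0//= mulr_ile1.
have step1 : p * \int[Q]_y G y <= (1 - eta) ^+ #|I|.
{ have -> : p * \int[Q]_y G y = \int[(P \x Q)%E]_w (below_ind r predT (X ^~ w.1) * G w.2).
  { rewrite (@Rfubini1_bounded _ _ _ _ _ _ _ _ 1)//; last by move=> z; apply: norm01.
    under [RHS]eq_Rintegral => w _ do rewrite /= (@Rint01Zl _ _ _ Q _ G mG G01).
    by rewrite (@Rint01Zr _ _ _ P _ _ mb b01) pE. }
  apply: (@le_trans _ _ (\int[(P \x Q)%E]_w F (V ^~ w))).
  { apply: le_Rint.
    - exact: bounded_integrable01.
    - by apply: bounded_integrable01 => //; exact: coord_measurable_comp.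
    - move=> [w y] /=; rewrite /below_ind.
      case: (boolP [forall i, _]) => [/forallP h|_]; last first.
        by rewrite mul0r; case/andP: (F01 (V ^~ (w, y))).
      rewrite mul1r /G -sumrN expR_sum; apply: ler_prod => i _; rewrite expR_ge0 /=.
      rewrite /tail_weight /V /=; case: ltP => [_|hV].
        by rewrite -[leRHS]expR0 ler_expR oppr_le0 sqr_ge0.
      have := h i => /= hX; rewrite ler_expR lerN2.
      have W1 : 1 <= W i y by lra.
      by rewrite -(expr1n R 2) ler_sqr ?nnegrE//; lra. }
  rewrite (law_determined mV mV' eqcf mF) /F /V'.
  rewrite (pxi (fun _ z => tail_weight r (s * z))); last 2 first.
    by move=> _; apply: measurableT_comp => //; apply: measurable_funM.
    by move=> _ z; exact: tail_weight01.
  rewrite prodr_const; apply: lerXn2r; rewrite ?nnegrE ?heta//.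
    by apply: Rintegral_ge0 => z _; case/andP: (tail_weight01 r (s * z)).
  apply: le_trans (heta s s1).
  by apply: Rintegral_ge0 => z _; case/andP: (tail_weight01 r (s * z)). }
pose m := eps * #|I|%:R.
(* Jensen's inequality through the tangent at the mean [m]: exp(- v) >= exp(- m) (1 + m - v). *)
have step2 : expR (- m) <= \int[Q]_y G y.
{ pose S y := \sum_i 1 * W i y ^+ 2.
  have [iS ES] : Q.-integrable setT (EFin \o S) /\ \int[Q]_y S y = m.
  { have [h ->] := Rint_lin (fun=> 1) (fun i => (varW i).1); split => //.
    by under eq_bigr do rewrite (varW _).2 mul1r; rewrite sumr_const -mulr_natr. }
  have [iA EA] := Rint_affine (- expR (- m)) (expR (- m) * (1 + m)) iS.
  have -> : expR (- m) = \int[Q]_y (- expR (- m) * S y + expR (- m) * (1 + m)).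
    by rewrite EA ES; ring.
  apply: le_Rint => //; first exact: bounded_integrable01.
  move=> y; rewrite /G /S; under eq_bigr do rewrite mul1r.
  move: (\sum_i _) => v.
  rewrite mulNr addrC -mulrBr [X in _ <= expR X](_ : - v = - m + (m - v)); last ring.
  by rewrite expRD ler_pM2l ?expR_gt0// -addrA; exact: expR_ge1Dx. }
have p0 : 0 <= p by rewrite fine_ge0.
have eta1 : 0 <= 1 - eta.
  by apply: le_trans (heta s s1); apply: Rintegral_ge0 => z _; case/andP: (tail_weight01 r (s * z)).
have step3 : (1 - eta) ^+ #|I| <= expR (- (2 * m)).
{ have -> : - (2 * m) = #|I|%:R * (- eta) by rewrite /m /eps; field.
  rewrite expRM_natl; apply: lerXn2r; rewrite ?nnegrE ?expR_ge0//.
  by apply: le_trans (expR_ge1Dx _). }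
have : p * expR (- m) <= expR (- m) * expR (- m).
  rewrite -expRD; have -> : - m + - m = - (2 * m) by ring.
  by apply: le_trans step3; apply: le_trans step1; exact: ler_wpM2l.
by rewrite ler_pM2r ?expR_gt0.
Qed.

End orthant_upper.

(** * Supermultiplicative sequences *)

Section fekete.
Context {R : realType} (p : R -> R).
Hypotheses (p_le1 : forall x, p x <= 1) (p_anti : forall x y, x <= y -> p y <= p x).
Hypotheses (p_mul : forall n m : nat, p n%:R * p m%:R <= p (n + m)%:R) (p1_gt0 : 0 < p 1).

Lemma supmul_exp (m k : nat) : 0 < p m%:R -> p m%:R ^+ k.+1 <= p (k.+1 * m)%:R.
Proof.
move=> pm; elim: k => [|k IH]; first by rewrite expr1 mul1n.
rewrite exprS mulSn; apply: le_trans (p_mul _ _).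
by rewrite ler_pM2l.
Qed.

Lemma supmul_gt0 (x : R) : 0 < p x.
Proof.
have pn (n : nat) : 0 < p n.+1%:R.
  by have := @supmul_exp 1 n p1_gt0; rewrite muln1; apply: lt_le_trans; rewrite exprn_gt0.
by apply: lt_le_trans (pn (Num.truncn x)) _; apply: p_anti; rewrite ltW// truncnS_gt.
Qed.

(** Fekete's lemma for [f n = - ln (p n%:R)], with [L] the infimum of f n / n. Monotonicity carries
    it to real x: rounding down to an integer gives the lower bound L (x - 1), and rounding up to a
    multiple of a nearly optimal m gives the upper bound (x / m + 1) f m. *)
Lemma supmul_rate : exists2 L : R, 0 <= L &
  [/\ x^-1 * ln (p x) @[x --> +oo] --> - L,
      forall n : nat, p n%:R <= expR (- (L * n%:R)) &
      forall e, L < e -> exists2 n : nat, (0 < n)%N & expR (- (e * n%:R)) <= p n%:R].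
Proof.
pose f (n : nat) := - ln (p n%:R).
have f0 n : 0 <= f n by rewrite oppr_ge0 ln_le0.
have fE n : p n%:R = expR (- f n) by rewrite opprK lnK ?posrE ?supmul_gt0.
pose S := [set f n.+1 / n.+1%:R | n in [set: nat]].
have lbS : lbound S 0 by move=> _ [n _ <-]; rewrite divr_ge0.
have infS : has_inf S by split; [exists (f 1 / 1), 0%N|exists 0].
pose L := inf S.
have L0 : 0 <= L by apply: lb_le_inf => //; case: infS.
have Lf n : L * n%:R <= f n.
{ case: n => [|n]; first by rewrite mulr0.
  by rewrite -ler_pdivlMr//; apply: ge_inf; [case: infS|exists n]. }
have Le e : L < e -> exists2 n : nat, (0 < n)%N & f n <= e * n%:R.
{ move=> Le; have eL : 0 < e - L by rewrite subr_gt0.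
  have [_ [n _ <-] h] := inf_adherent eL infS.
  exists n.+1 => //; rewrite -ler_pdivrMr// ltW//; move: h; rewrite -/L; move: (f n.+1 / _) => q h; lra. }
exists L => //; split.
- apply/cvgrPdist_le => e e0.
  have [m m0 fm] : exists2 n : nat, (0 < n)%N & f n <= (L + e / 2) * n%:R.
    by apply: Le; rewrite ltrDl divr_gt0.
  have m0' : 0 < m%:R :> R by rewrite ltr0n.
  near=> x.
  have x0 : 0 < x by near: x; exact: nbhs_pinfty_gt.
  have xL : L / e <= x by near: x; apply: nbhs_pinfty_ge; exact: num_real.
  have xf : f m / (e / 2) <= x by near: x; apply: nbhs_pinfty_ge; exact: num_real.
  rewrite ler_pdivrMr// mulrC in xL; rewrite ler_pdivrMr ?divr_gt0// mulrC in xf.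
  have lo : L * (x - 1) <= - ln (p x).
  { have /andP[n1 n2] := truncn_itv (ltW x0); move: n1 n2; set n := Num.truncn x => n1 n2.
    apply: (@le_trans _ _ (f n)); last by rewrite lerN2 ler_ln ?posrE ?supmul_gt0// p_anti.
    apply: le_trans (Lf n); apply: ler_wpM2l => //.
    by rewrite lerBlDr natr1 ltW. }
  have hi : - ln (p x) <= (x / m%:R + 1) * f m.
  { have xm0 : 0 <= x / m%:R by rewrite divr_ge0// ltW.
    have /andP[k1 k2] := truncn_itv xm0; move: k1 k2; set k := Num.truncn _ => k1 k2.
    apply: (@le_trans _ _ (k.+1%:R * f m)).
      rewrite /f mulrN lerN2 mulr_natl -lnXn ?supmul_gt0// ler_ln ?posrE ?exprn_gt0 ?supmul_gt0//.
      apply: le_trans (supmul_exp k (supmul_gt0 _)) _; apply: p_anti.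
      by rewrite natrM -ler_pdivrMr// ltW.
    by apply: ler_wpM2r => //; rewrite -natr1 lerD2r. }
  have hi' : - ln (p x) <= (L + e) * x.
  { apply: le_trans hi _; rewrite mulrDl mul1r.
    have : x / m%:R * f m <= (L + e / 2) * x.
      rewrite mulrAC ler_pdivrMr// -mulrA [x * m%:R]mulrC mulrA [x * f m]mulrC.
      by rewrite ler_wpM2r// ltW.
    lra. }
  rewrite (_ : - L - _ = ((- ln (p x)) - L * x) / x); last by field; rewrite gt_eqF.
  rewrite normrM normfV (gtr0_norm x0) ler_pdivrMr//.
  move: (ln (p x)) lo hi' => l lo hi'.
  by rewrite ler_norml; apply/andP; split; nra.
- by move=> n; rewrite fE ler_expR lerN2.
- by move=> e /Le[n n0 fn]; exists n => //; rewrite fE ler_expR lerN2.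
Unshelve. all: by end_near. Qed.

(** If L were at most 0, some n would satisfy p n >= exp(- eps n / (2 (K + 1))). Its power K + 1
    bounds p ((K + 1) n) from below by exp(- eps n / 2), against the hypothesis. *)
Lemma supmul_rate_gt0 (K : nat) (eps L : R) : 0 < eps ->
  (forall N : nat, p (K.+1 * N)%:R <= expR (- (eps * N%:R))) ->
  (forall e, L < e -> exists2 n : nat, (0 < n)%N & expR (- (e * n%:R)) <= p n%:R) -> 0 < L.
Proof.
move=> eps0 pK Le; rewrite ltNge; apply/negP => L0.
have [|n n0 pn] := Le (eps / 2 / K.+1%:R).
  by apply: le_lt_trans L0 _; rewrite !divr_gt0.
have h := le_trans (supmul_exp K (supmul_gt0 n%:R)) (pK n).
have : expR (- (eps / 2 / K.+1%:R * n%:R)) ^+ K.+1 <= expR (- (eps * n%:R)).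
  by apply: le_trans h; apply: lerXn2r; rewrite ?nnegrE ?expR_ge0// ltW// supmul_gt0.
rewrite -expRM_natl ler_expR mulrN lerN2 mulrA [K.+1%:R * _]mulrC divfK ?pnatr_eq0//.
have : 0 < eps * n%:R by rewrite mulr_gt0 ?ltr0n.
lra.
Qed.

Lemma supmul_rate_eq0 (L : R) : 0 <= L ->
  (forall n : nat, p n%:R <= expR (- (L * n%:R))) ->
  (forall e, 0 < e -> exists2 n : nat, (0 < n)%N & expR (- (e * n%:R)) <= p n%:R) -> L = 0.
Proof.
rewrite le_eqVlt => /orP[/eqP->//|L0] pL pe.
have [|n n0 pn] := pe (L / 2); first by rewrite divr_gt0.
have := le_trans pn (pL n); rewrite ler_expR lerN2.
have : 0 < L * n%:R by rewrite mulr_gt0 ?ltr0n.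
lra.
Qed.

End fekete.

(** * Gaussian processes *)

Section gaussian_laws.
Context {R : realType} {d : measure_display} {Y : measurableType d} (P : probability Y R).

(** Both forms of [gaussian_law] become affine images of a standard normal variable, with [s = 0]
    for a Dirac mass. *)
Lemma gaussian_law_standard (S : Y -> R) : measurable_fun setT S ->
  gaussian_law (pushforward P S) ->
  exists m s : R, forall f : R -> R, measurable_fun setT f ->
    ((N01 R).-integrable setT (EFin \o (fun z : measurableTypeR R => f (m + s * z))) ->
     P.-integrable setT (EFin \o (fun w => f (S w)))) /\
    \int[P]_w f (S w) = \int[N01 R]_z f (m + s * z).
Proof.
move=> mS law.
have mS' : measurable_fun setT (S : Y -> measurableTypeR R) := mS.
pose m1 := measure_function_pushforward__canonical__measure_function_Measure P mS'.
have mc (b p : R) : measurable_fun setT (fun x : measurableTypeR R => cos (b * x + p)).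
  by apply: continuous_measurable_fun; exact: continuous_cos_comp.
have [m [s cf]] : exists m s : R, forall b p, \int[P]_w cos (b * S w + p) =
    \int[N01 R]_z cos (b * (m + s * z) + p).
{ have E b p : \int[P]_w cos (b * S w + p) = fine (\int[m1]_x (cos (b * x + p))%:E).
    rewrite /Rintegral; congr fine.
    rewrite (@integral_pushforward _ _ _ _ _ _ mS' P setT)//.
      by move/measurable_EFinP: (mc b p).
    apply: (@bounded_integrable _ _ _ _ _ 1); last by move=> x; exact: cos_le1n.
    exact: (measurableT_comp (mc b p) mS).
  case: law => [[m hm]|[m [s [s0 hm]]]].
  - exists m, 0 => b p; rewrite E.
    have -> : (\int[m1]_x (cos (b * x + p))%:E =
        \int[\d_(m : measurableTypeR R)]_(x in [set: measurableTypeR R]) (cos (b * x + p)%R)%:E)%E.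
      by apply: eq_measure_integral => B mB _; exact: hm.
    rewrite integral_dirac//; last by move/measurable_EFinP: (mc b p).
    rewrite diracT mul1e /=; under eq_Rintegral do rewrite mul0r addr0.
    by rewrite Rint_cst.
  - exists m, s => b p; rewrite E.
    have -> : (\int[m1]_x (cos (b * x + p))%:E =
        \int[normal_prob m s]_(x in [set: measurableTypeR R]) (cos (b * x + p)%R)%:E)%E.
      by apply: eq_measure_integral => B mB _; exact: hm.
    by rewrite -(@Rintegral_normal_affine _ m s (fun x => cos (b * x + p)))//; exact: continuous_cos_comp. }
exists m, s => f mf.
have mV' : measurable_fun setT (fun z : measurableTypeR R => m + s * z).
  by apply: measurable_funD => //; apply: measurable_funM.
by have [|h <-] := law_determined1 (N01 R) P mV' mS mf.
Qed.

Lemma gaussian_law_moments (S : Y -> R) : measurable_fun setT S ->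
  gaussian_law (pushforward P S) ->
  P.-integrable setT (EFin \o S) /\ P.-integrable setT (EFin \o (fun w => S w ^+ 2)) /\
  (\int[P]_w S w = 0 -> forall p, \int[P]_w cos (S w + p) =
     cos p * expR (- (\int[P]_w (S w ^+ 2) / 2))).
Proof.
move=> mS /(gaussian_law_standard mS)[m [s H]].
have mid : measurable_fun setT (id : R -> R) by [].
have msq : measurable_fun setT (fun x : R => x ^+ 2) by apply: measurable_funX.
have [h1 h2] := H _ mid; have [h3 h4] := H _ msq.
have i1 := @integrable_N01_id R.
have i2 := @integrable_N01_sq R.
have ic (c : R) : (N01 R).-integrable setT (EFin \o (fun _ : R => c)).
  exact: finite_measure_integrable_cst.
have j1 := integrableD measurableT (ic m) (integrableZl measurableT s i1).
have j2 := integrableD measurableT (ic (m ^+ 2)) (integrableZl measurableT (2 * m * s) i1).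
have j3 := integrableD measurableT j2 (integrableZl measurableT (s ^+ 2) i2).
have sqE z : (m + s * z) ^+ 2 = m ^+ 2 + 2 * m * s * z + s ^+ 2 * z ^+ 2 by ring.
split; first exact: h1 j1.
split; first by apply: h3; apply: eq_integrable j3 => // z _; rewrite /= sqE !EFinD !EFinM.
have m_ : \int[N01 R]_z (m + s * z) = m.
  rewrite (RintegralD _ (ic m) (integrableZl measurableT s i1))// (Rint_cst (N01 R)).
  by rewrite (RintegralZl _ _ i1)// N01_id mulr0 addr0.
rewrite h2 m_ => m0 p.
have mcos : measurable_fun setT (fun x : R => cos (x + p)).
  by apply: measurable_cos_comp; exact: measurable_funD.
have [_ ->] := H _ mcos.
rewrite m0; under eq_Rintegral do rewrite add0r.
rewrite N01_cos; congr (_ * expR (- (_ / 2))).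
rewrite h4 m0; under eq_Rintegral do rewrite add0r exprMn.
by rewrite (RintegralZl _ _ i2)// N01_sq mulr1.
Qed.

End gaussian_laws.

Section process_family.
Context {R : realType} {T : set R} {A : R -> R} {d : measure_display} {Omega : measurableType d}.
Context {P : probability Omega R} {Z : R -> {RV P >-> R}}.
Hypotheses (hgauss : gaussian_process T Z) (hcent : centered_process T Z).
Hypothesis hcorr : has_correlation T Z A.

Let lin_law (I : finType) (t a : I -> R) : (forall i, T (t i)) ->
  gaussian_law (pushforward P (fun w => \sum_i a i * Z (t i) w)).
Proof.
move=> Tt; have := @hgauss #|I| (t \o enum_val) (a \o enum_val) (fun i => Tt _).
congr gaussian_law; congr pushforward; apply/funext => w.
by rewrite [RHS](reindex (fun j : 'I_#|I| => enum_val j))//=; exact: onW_bij (@enum_val_bij I).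
Qed.

Let mZ t : measurable_fun setT (Z t).
Proof. exact: measurable_funPT. Qed.

Let Z_integrable t : T t -> P.-integrable setT (EFin \o Z t) /\
  P.-integrable setT (EFin \o (fun w => Z t w ^+ 2)).
Proof.
move=> Tt; have := @lin_law unit (fun=> t) (fun=> 1) (fun=> Tt).
rewrite (_ : (fun w => _) = Z t); last first.
  by apply/funext => w; rewrite sum_unit mul1r.
by move=> /(gaussian_law_moments (mZ t))[h1 [h2 _]].
Qed.

Let ZZ_integrable s t : T s -> T t -> P.-integrable setT (EFin \o (fun w => Z s w * Z t w)).
Proof.
move=> Ts Tt; have [_ h1] := Z_integrable Ts; have [_ h2] := Z_integrable Tt.
apply: le_integrable (integrableD measurableT h1 h2) => //.
  by apply/measurable_EFinP; exact: measurable_funM.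
move=> w _ /=; rewrite lee_fin [leRHS]ger0_norm ?addr_ge0 ?sqr_ge0//.
by rewrite ler_norml; apply/andP; split; move: (Z s w) (Z t w) => x y; nra.
Qed.

(** A linear combination is Gaussian and centred, so its characteristic function depends only on its
    second moment, which expands into correlations. *)
Lemma process_family (I : finType) (t : I -> R) : (forall i, T (t i)) ->
  gaussian_family P (fun i => Z (t i)) (fun i j => A `|t i - t j|).
Proof.
move=> Tt; have [A0 AE] := hcorr; split => //; first by move=> i j; rewrite distrC.
move=> a p.
have mS : measurable_fun setT (fun w => \sum_i a i * Z (t i) w).
  by apply: measurable_sum => i; exact: measurable_funM.
have [_ [_ ->]] := gaussian_law_moments mS (lin_law a Tt); last first.
  have [_ ->] := Rint_lin a (fun i => (Z_integrable (Tt i)).1).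
  rewrite big1// => i _; have := hcent (Tt i); rewrite unlock /Rintegral => ->.
  by rewrite mulr0.
congr (_ * expR (- (_ / 2))).
under eq_Rintegral do rewrite expr2 big_distrlr pair_bigA /=.
have [_] := Rint_lin (fun k : I * I => a k.1 * a k.2) (fun k => ZZ_integrable (Tt k.1) (Tt k.2)).
under eq_Rintegral do under eq_bigr do rewrite mulrACA.
move=> ->; rewrite /bil pair_bigA /=; apply: eq_bigr => -[i j] _ /=.
by have := AE _ _ (Tt i) (Tt j); rewrite unlock /Rintegral => ->; rewrite mulrC.
Qed.

End process_family.

(** * Suprema along sequences as limits of finite orthants *)

Section countable_orthants.
Context {R : realType} {d : measure_display} {Y : measurableType d} (P : probability Y R).

Lemma fine_prob_le (E F : set Y) : measurable E -> measurable F -> E `<=` F ->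
  fine (P E) <= fine (P F).
Proof.
move=> mE mF EF; apply: fine_le; [exact: fin_num_measure..|].
by apply: le_measure; rewrite ?inE.
Qed.

Lemma fine_prob_bigcup_cvg (F : nat -> set Y) : (forall m, measurable (F m)) ->
  (forall m n, (m <= n)%N -> F m `<=` F n) ->
  fine (P (F m)) @[m --> \oo] --> fine (P (\bigcup_m F m)).
Proof.
move=> mF ndF; apply: fine_cvg; rewrite fineK; last first.
  by apply: fin_num_measure; exact: bigcup_measurable.
apply: nondecreasing_cvg_mu => //; first exact: bigcup_measurable.
by move=> m n mn; apply/subsetPset; exact: ndF.
Qed.

Lemma fine_prob_bigcap_ge (F : nat -> set Y) (a : R) : (forall m, measurable (F m)) ->
  (forall m n, (m <= n)%N -> F n `<=` F m) ->
  (forall m, a <= fine (P (F m))) -> a <= fine (P (\bigcap_m F m)).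
Proof.
move=> mF niF aF.
have h : fine (P (F m)) @[m --> \oo] --> fine (P (\bigcap_m F m)).
{ apply: fine_cvg; rewrite fineK; last first.
    by apply: fin_num_measure; apply: bigcap_measurable => //; exists 0%N.
  apply: nonincreasing_cvg_mu => //.
  - by apply: le_lt_trans (ltry 1); exact: probability_le1.
  - by apply: bigcap_measurable => //; exists 0%N.
  - by move=> m n mn; apply/subsetPset; exact: niF. }
by apply: (ler_cvg_to (cvg_cst a) h); exact: nearW.
Qed.

Variable Z : R -> Y -> R.
Hypothesis mZ : forall t, measurable_fun setT (Z t).

Definition below_seq (u : nat -> R) (s : R) : set Y := [set w | forall k, Z (u k) w < s].

(* The supremum of [Z] along [u] is less than [r]. *)
Definition below_sup (u : nat -> R) (r : R) : set Y :=
  \bigcup_m below_seq u (r - m.+1%:R^-1).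

Lemma below_seqE (u : nat -> R) (s : R) : below_seq u s = \bigcap_K [set w | forall i : 'I_K, Z (u i) w < s].
Proof.
apply/seteqP; split => w h; first by move=> K _ i; exact: h.
by move=> k; exact: (h k.+1 Logic.I ord_max).
Qed.

Lemma measurable_below_seq u s : measurable (below_seq u s).
Proof.
rewrite below_seqE; apply: bigcap_measurable => [|K _]; first by exists 0%N.
exact: (measurable_rays (fun=> s) (fun i : 'I_K => mZ (u i))).
Qed.

Lemma measurable_below_sup u r : measurable (below_sup u r).
Proof. by apply: bigcup_measurable => m _; exact: measurable_below_seq. Qed.

Lemma below_seq_ge (u : nat -> R) (s a : R) :
  (forall K, a <= fine (P [set w | forall i : 'I_K, Z (u i) w < s])) ->
  a <= fine (P (below_seq u s)).
Proof.
move=> h; rewrite below_seqE; apply: fine_prob_bigcap_ge => //.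
- by move=> K; exact: (measurable_rays (fun=> s) (fun i : 'I_K => mZ (u i))).
- by move=> m n mn w hw i; have := hw (widen_ord mn i).
Qed.

Lemma below_seq_le (u : nat -> R) (s : R) K :
  fine (P (below_seq u s)) <= fine (P [set w | forall i : 'I_K, Z (u i) w < s]).
Proof.
apply: fine_prob_le; first exact: measurable_below_seq.
  exact: (measurable_rays (fun=> s) (fun i : 'I_K => mZ (u i))).
by move=> w h i; exact: h.
Qed.

Lemma below_sup_cvg u r :
  fine (P (below_seq u (r - m.+1%:R^-1))) @[m --> \oo] --> fine (P (below_sup u r)).
Proof.
apply: fine_prob_bigcup_cvg => [m|m n mn w h k]; first exact: measurable_below_seq.
by apply: lt_le_trans (h k) _; rewrite lerD2l lerN2 lef_pV2 ?posrE ?ltr0n// ler_nat.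
Qed.

Lemma below_seq_le_sup u r m :
  fine (P (below_seq u (r - m.+1%:R^-1))) <= fine (P (below_sup u r)).
Proof.
apply: fine_prob_le; [exact: measurable_below_seq|exact: measurable_below_sup|].
by move=> w h; exists m.
Qed.

Definition merge_seq (u v : nat -> R) (k : nat) : R := if odd k then v k./2 else u k./2.

(** Two limits lift a product inequality from finitely many points: at a fixed level the finite
    events decrease to the event for the whole sequence, and then the levels [r - m.+1%:R^-1]
    increase to [r]. *)
Lemma below_sup_merge (u v v' : nat -> R) (r : R) :
  (forall s K, fine (P [set w | forall i : 'I_K, Z (u i) w < s]) *
    fine (P [set w | forall i : 'I_K, Z (v i) w < s]) <=
    fine (P [set w | (forall i : 'I_K, Z (u i) w < s) /\ (forall i : 'I_K, Z (v' i) w < s)])) ->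
  fine (P (below_sup u r)) * fine (P (below_sup v r)) <=
  fine (P (below_sup (merge_seq u v') r)).
Proof.
move=> H.
have c := cvgM (below_sup_cvg (u := u) (r := r)) (below_sup_cvg (u := v) (r := r)).
apply: (ler_cvg_to (c _) (cvg_cst _)); apply: nearW => m /=.
apply: le_trans (below_seq_le_sup _ _ m); set s := r - _.
apply: below_seq_ge => K.
apply: (@le_trans _ _ (fine (P [set w | forall i : 'I_K, Z (u i) w < s]) *
    fine (P [set w | forall i : 'I_K, Z (v i) w < s]))).
  by apply: ler_pM; rewrite ?fine_ge0 ?below_seq_le.
apply: le_trans (H s K) _; apply: fine_prob_le.
- rewrite [X in measurable X](_ : _ = [set w | forall i : 'I_K, Z (u i) w < s] `&`
    [set w | forall i : 'I_K, Z (v' i) w < s])//.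
  by apply: measurableI; [exact: (measurable_rays (fun=> s) (fun i : 'I_K => mZ (u i)))|
    exact: (measurable_rays (fun=> s) (fun i : 'I_K => mZ (v' i)))].
- exact: (measurable_rays (fun=> s) (fun i : 'I_K => mZ (merge_seq u v' i))).
- move=> w [h1 h2] i; rewrite /merge_seq.
  have iK : (i./2 < K)%N by apply: leq_ltn_trans (ltn_ord i); rewrite -divn2 leq_div.
  by case: ifP => _; [exact: (h2 (Ordinal iK))|exact: (h1 (Ordinal iK))].
Qed.

Lemma below_sup_shift (u : nat -> R) (r M c : R) :
  (forall s K, fine (P [set w | forall i : 'I_K, Z (u i) w < s + M]) ^+ 2 <=
    c * fine (P [set w | forall i : 'I_K, Z (u i) w < s])) -> 0 < c ->
  fine (P (below_sup u (r + M))) ^+ 2 <= c * fine (P (below_sup u r)).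
Proof.
move=> H c0.
have := below_sup_cvg (u := u) (r := r + M) => /cvg_sqr h.
apply: (ler_cvg_to h (cvg_cst _)); apply: nearW => m.
rewrite mulrC -ler_pdivrMr//; apply: le_trans (below_seq_le_sup _ _ m).
apply: below_seq_ge => K; rewrite ler_pdivrMr// mulrC.
apply: le_trans (H _ K); apply: lerXn2r; rewrite ?nnegrE ?fine_ge0//.
by rewrite addrAC below_seq_le.
Qed.

End countable_orthants.

Section process_orthants.
Context {R : realType} {T : set R} {A : R -> R} {d : measure_display} {Omega : measurableType d}.
Context {P : probability Omega R} {Z : R -> {RV P >-> R}}.
Hypotheses (hgauss : gaussian_process T Z) (hcent : centered_process T Z).
Hypotheses (hstat : stationary_process T Z) (hcorr : has_correlation T Z A).
Hypothesis A_ge0 : forall s t, T s -> T t -> 0 <= A `|s - t|.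

Let Cov (I : finType) (t : I -> R) i j := A `|t i - t j|.
Let mZ t : measurable_fun setT (Z t).
Proof. exact: measurable_funPT. Qed.

Lemma process_association (I J : finType) (s : I -> R) (t : J -> R) (r : R) :
  (forall i, T (s i)) -> (forall j, T (t j)) ->
  fine (P [set w | forall i, Z (s i) w < r]) * fine (P [set w | forall j, Z (t j) w < r]) <=
  fine (P [set w | (forall i, Z (s i) w < r) /\ (forall j, Z (t j) w < r)]).
Proof.
move=> Ts Tt.
pose st (k : I + J) := match k with inl i => s i | inr j => t j end.
have Tst k : T (st k) by case: k => k /=.
have := orthant_association (process_family hgauss hcent hcorr Tst) (fun k => if k is inl _ then true else false) r.
have C1 k : A `|st k - st k| = 1 by rewrite subrr normr0; case: hcorr.
move=> /(_ C1 (fun k l => A_ge0 (Tst k) (Tst l))).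
have -> : [set w | forall i, (if i is inl _ then true else false) -> Z (st i) w < r] =
    [set w | forall i, Z (s i) w < r].
  apply/seteqP; split => w h; first by move=> i; exact: (h (inl i)).
  by case=> // i _; exact: h.
have -> : [set w | forall i, ~~ (if i is inl _ then true else false) -> Z (st i) w < r] =
    [set w | forall i, Z (t i) w < r].
  apply/seteqP; split => w h; first by move=> i; exact: (h (inr i)).
  by case=> // i _; exact: h.
have -> : [set w | forall i, Z (st i) w < r] =
    [set w | (forall i, Z (s i) w < r) /\ (forall j, Z (t j) w < r)].
  apply/seteqP; split => w h; last by case: h => h1 h2; case.
  by split => i; [exact: (h (inl i))|exact: (h (inr i))].
have mI (K : finType) (q : K -> R) := measurable_rays (fun=> r) (fun i => mZ (q i)).
have f1 : P [set w | forall i, Z (s i) w < r] \is a fin_num by apply: fin_num_measure; exact: mI.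
have f2 : P [set w | forall i, Z (t i) w < r] \is a fin_num by apply: fin_num_measure; exact: mI.
have f3 : P [set w | (forall i, Z (s i) w < r) /\ (forall j, Z (t j) w < r)] \is a fin_num.
  by apply: fin_num_measure; apply: measurableI; exact: mI.
by move=> h; rewrite -lee_fin EFinM !fineK.
Qed.

(** Stationarity replaces [v] by its translate by [x], and association bounds the joint probability
    from below by the product. *)
Lemma below_sup_supmul (u v : nat -> R) (x r : R) : T x ->
  (forall k, T (u k)) -> (forall k, T (v k)) -> (forall k, T (v k + x)) ->
  fine (P (below_sup Z u r)) * fine (P (below_sup Z v r)) <=
  fine (P (below_sup Z (merge_seq u (fun k => v k + x)) r)).
Proof.
move=> Tx Tu Tv Tvx; apply: below_sup_merge => // s K.
have := @hstat K v x (fun=> `]-oo, s[%classic) (fun i => Tv i) Tx (fun=> measurable_itv _).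
rewrite (_ : [set w | _] = [set w | forall i : 'I_K, Z (v i + x) w < s]); last first.
  by apply/seteqP; split => w h i; have := h i; rewrite /= in_itv.
rewrite [X in _ = P X -> _](_ : _ = [set w | forall i : 'I_K, Z (v i) w < s]); last first.
  by apply/seteqP; split => w h i; have := h i; rewrite /= in_itv.
move=> <-.
exact: (@process_association 'I_K 'I_K (fun i => u i) (fun i => v i + x) s (fun i => Tu i) (fun i => Tvx i)).
Qed.

(** The direction of the shift is S, the sum of the [b i * Z (s i)], with variance v. The unit
    vector S / sqrt v has covariance at least 1 / sqrt v with every [Z (u k)], so a shift by M sqrt
    v lowers them all by at least M and costs exp(M^2 v). *)
Lemma below_sup_cameron_martin (u : nat -> R) (I : finType) (b s : I -> R) (r M : R) :
  (forall k, T (u k)) -> (forall i, T (s i)) -> 0 <= M ->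
  (forall k, 1 <= \sum_i b i * A `|u k - s i|) ->
  fine (P (below_sup Z u (r + M))) ^+ 2 <=
  expR (M ^+ 2 * bil (Cov s) b b) * fine (P (below_sup Z u r)).
Proof.
move=> Tu Ts M0 hb; apply: below_sup_shift => //; last exact: expR_gt0.
move=> q K.
pose t (k : 'I_K + I) := match k with inl k => u k | inr i => s i end.
have Tt k : T (t k) by case: k => k /=.
(* Normalising needs a positive variance. The variance 1 - 2 c + v of [Z (u 0)] minus the
   combination is non-negative and its covariance c is at least 1, so v >= 1. *)
have v1 : 1 <= bil (Cov s) b b.
{ pose t0 (k : unit + I) := match k with inl _ => u 0 | inr i => s i end.
  have Tt0 k : T (t0 k) by case: k => k /=.
  have := gaussian_family_psd (process_family hgauss hcent hcorr Tt0)
    (fun k => match k with inl _ => 1 | inr i => - b i end).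
  rewrite /bil big_sumType sum_unit /= big_sumType sum_unit /= subrr normr0 (proj1 hcorr) !mul1r.
  under [X in _ + X]eq_bigr do rewrite big_sumType sum_unit /=.
  rewrite big_split /=.
  have -> : \sum_i A `|u 0 - s i| * (1 * - b i) = - \sum_i b i * A `|u 0 - s i|.
    by rewrite -sumrN; apply: eq_bigr => i _; ring.
  have -> : \sum_i A `|s i - u 0| * (- b i * 1) = - \sum_i b i * A `|u 0 - s i|.
    by rewrite -sumrN; apply: eq_bigr => i _; rewrite distrC; ring.
  under [X in _ + (_ + X)]eq_bigr do under eq_bigr do rewrite mulrNN.
  rewrite -/(bil (Cov s) b b); have := hb 0.
  move: (\sum_i _) (bil _ _ _) => x y; lra. }
have v0 : 0 < bil (Cov s) b b by apply: lt_le_trans v1.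
set v := bil _ _ _ in v1 v0 *.
pose b' (k : 'I_K + I) := match k with inl k => 0 | inr i => b i / Num.sqrt v end.
have sv0 : 0 < Num.sqrt v by rewrite sqrtr_gt0.
have b1 : bil (fun k l => A `|t k - t l|) b' b' = 1.
{ rewrite /bil big_sumType /= big1 ?add0r => [|k _]; last first.
    by rewrite big1// => l _; rewrite mul0r mulr0.
  transitivity (\sum_i \sum_j (A `|s i - s j| * (b i * b j)) * v^-1).
    apply: eq_bigr => i _; rewrite big_sumType /= big1 ?add0r => [|k _]; last by rewrite !mulr0.
    apply: eq_bigr => j _.
    rewrite -[RHS]mulrA; congr (_ * _); rewrite -[v in RHS](sqr_sqrtr (ltW v0)).
    by field; rewrite gt_eqF.
  under eq_bigr do rewrite -mulr_suml.
  by rewrite -mulr_suml mulfV// gt_eqF. }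
have := @orthant_shift _ _ _ _ _ _ _ (process_family hgauss hcent hcorr Tt) b'
  (fun k => if k is inl _ then true else false) q M (M * Num.sqrt v) b1.
have -> : [set w | forall i, (if i is inl _ then true else false) -> Z (t i) w < q + M] =
    [set w | forall i : 'I_K, Z (u i) w < q + M].
  apply/seteqP; split => w h; first by move=> i; exact: (h (inl i)).
  by case=> // i _; exact: h.
have -> : [set w | forall i, (if i is inl _ then true else false) -> Z (t i) w < q] =
    [set w | forall i : 'I_K, Z (u i) w < q].
  apply/seteqP; split => w h; first by move=> i; exact: (h (inl i)).
  by case=> // i _; exact: h.
rewrite exprMn sqr_sqrtr; last exact: ltW.
apply; case=> // k _.
rewrite bilC; last by move=> i j; rewrite distrC.
rewrite bil_deltar big_sumType /= big1 ?add0r => [|i _]; last by rewrite mulr0.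
rewrite (_ : \sum_i _ = (\sum_i b i * A `|u k - s i|) / Num.sqrt v); last first.
  by rewrite mulr_suml; apply: eq_bigr => i _; rewrite distrC mulrA [A _ * _]mulrC.
rewrite mulrCA divfK ?gt_eqF//; apply: ler_peMr => //; exact: hb.
Qed.

End process_orthants.

(** * From a dense sequence of times to whole paths *)

Section paths.
Context {R : realType} (T : set R).
Hypothesis T_ge0 : forall t, T t -> 0 <= t.

Definition dense_seq (x : R) (u : nat -> R) : Prop :=
  (forall k, T (u k) /\ u k <= x) /\
  (forall t e, T t -> t <= x -> 0 < e -> exists k, `|u k - t| < e).

(** Only non-strict bounds pass from a dense sequence to all times, which is why [below_sup] keeps a
    margin below the level. *)
Lemma dense_seq_bound (x c : R) (u : nat -> R) (z : R -> R) : dense_seq x u ->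
  {within T, continuous z} -> (forall k, z (u k) <= c) -> forall t, T t -> t <= x -> z t <= c.
Proof.
move=> [Tu du] cz zc t Tt tx; rewrite leNgt; apply/negP => ct.
have zt : 0 < z t - c by rewrite subr_gt0.
have /subspace_continuousP/(_ t Tt)/cvgrPdist_lt/(_ _ zt) := cz.
rewrite near_withinE => /nbhs_ballP[e /= e0 he].
have [k uk] := du t e Tt tx e0.
have := he (u k); rewrite /ball /= distrC => /(_ uk (Tu k).1).
by have := zc k; rewrite ltr_norml => zk /andP[_]; rewrite ltrD2l ltrN2 ltNge zk.
Qed.

Lemma dense_seq_merge (x y : R) (u v : nat -> R) :
  (forall s t, T s -> T t -> T (s + t)) -> (forall s t, T s -> T t -> s < t -> T (t - s)) ->
  T x -> 0 <= y -> dense_seq x u -> dense_seq y v ->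
  dense_seq (x + y) (merge_seq u (fun k => v k + x)).
Proof.
move=> T_add T_sub Tx y0 [Tu du] [Tv dv]; split.
- move=> k; rewrite /merge_seq; case: ifP => _.
    have [h1 h2] := Tv k./2; split; first exact: T_add.
    by rewrite addrC lerD2l.
  have [h1 h2] := Tu k./2; split => //.
  by apply: le_trans h2 _; rewrite lerDl.
- move=> t e Tt txy e0; have [tx|xt] := leP t x.
    have [k hk] := du t e Tt tx e0; exists k.*2.
    by rewrite /merge_seq odd_double doubleK.
  have [||k hk] := dv (t - x) e _ _ e0; [exact: T_sub|by rewrite lerBlDl|].
  exists k.*2.+1; rewrite /merge_seq /= odd_double /= uphalf_double.
  by move: hk; rewrite opprB addrA.
Qed.

End paths.

Section persistence.
Context {R : realType} {T : set R} {d : measure_display} {Omega : measurableType d}.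
Context {P : probability Omega R} {Z : R -> {RV P >-> R}}.
Hypothesis T_ge0 : forall t, T t -> 0 <= t.
Hypothesis hcont : ae_continuous_paths T Z.

Local Notation Pc := (@completed_measure_extension _ _ _ P).

Let mZ t : measurable_fun setT (Z t).
Proof. exact: measurable_funPT. Qed.

Lemma below_event_path (u : nat -> R) (x r : R) (w : Omega) : dense_seq T x u ->
  {within T, continuous (fun t => Z t w)} ->
  below_event T Z r x w <-> below_sup Z u r w.
Proof.
move=> du cz; have [Tu _] := du; split.
- rewrite /below_event /=; set S := [set _ | _ in _] => h.
  have Su k : S (Z (u k) w)%:E.
    by exists (u k) => //; split; [rewrite /= in_itv /= T_ge0//; case: (Tu k)|case: (Tu k)].
  have le k : ((Z (u k) w)%:E <= ereal_sup S)%E by exact: ereal_sup_ubound.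
  (* The supremum is a real number: it is less than [r] and at least [Z (u 0) w]. *)
  move: h le; case: (ereal_sup S) => [s|//|_ /(_ 0%N)]; last by rewrite leeNy_eq.
  rewrite lte_fin => sr le; have sr0 : 0 < r - s by rewrite subr_gt0.
  pose m := Num.truncn (r - s)^-1.
  exists m => // k /=; apply: (@le_lt_trans _ _ s); first by rewrite -lee_fin.
  have : m.+1%:R^-1 < r - s by rewrite invf_plt ?posrE ?ltr0n// truncnS_gt.
  by move: (m.+1%:R^-1) => v; lra.
- move=> [m _ hm]; rewrite /below_event /=.
  apply: (@le_lt_trans _ _ (r - m.+1%:R^-1)%:E); last by rewrite lte_fin gtrDl oppr_lt0 invr_gt0.
  apply: ge_ereal_sup => _ [t [/= tx Tt] <-]; rewrite lee_fin.
  move: tx; rewrite in_itv /= => /andP[_ tx].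
  by apply: (dense_seq_bound du cz _ Tt tx) => k; apply: ltW; exact: hm.
Qed.

(** Off a null set [N] containing the discontinuous paths, the two events coincide. The outer
    measure of the possibly non-measurable one is therefore squeezed between the measures of the
    other with [N] removed and with [N] added. *)
Lemma below_eventE (u : nat -> R) (x r : R) : dense_seq T x u ->
  Pc (below_event T Z r x) = P (below_sup Z u r).
Proof.
move=> du; have [N [mN N0 hN]] := hcont.
have mE : measurable (below_sup Z u r) by exact: measurable_below_sup.
have good w : ~ N w -> {within T, continuous (fun t => Z t w)}.
  by move=> Nw; apply: contrapT => h; apply: Nw; exact: hN.
rewrite /completed_measure_extension; apply/eqP; rewrite eq_le; apply/andP; split.
- apply: (@le_trans _ _ (mu_ext P (below_sup Z u r `|` N))).
    apply: le_mu_ext => w h; have [Nw|Nw] := pselect (N w); first by right.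
    by left; apply/(below_event_path _ du (good _ Nw)).
  rewrite measurable_mu_extE; last exact: measurableU.
  have PU : (P (below_sup Z u r `|` N) <= P (below_sup Z u r) + P N)%E := measureU2 _ mE mN.
  by rewrite N0 adde0 in PU.
- apply: (@le_trans _ _ (P (below_sup Z u r `\` N))).
    rewrite (measureDI P mE mN) // [X in (_ + X)%E](_ : _ = 0%E) ?adde0//.
    apply/eqP; rewrite eq_le measure_ge0 andbT -N0.
    by apply: le_measure; rewrite ?inE//; exact: measurableI.
  rewrite -measurable_mu_extE; last exact: measurableD.
  apply: le_mu_ext => w [h Nw].
  by apply/(below_event_path _ du (good _ Nw)).
Qed.

Definition persistence (r x : R) : R := fine (Pc (below_event T Z r x)).

Lemma completed_le1 (E : set Omega) : (Pc E <= 1)%E.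
Proof.
rewrite /completed_measure_extension -(@probability_setT _ _ _ P) -(measurable_mu_extE _ measurableT).
exact: le_mu_ext.
Qed.

Lemma completed_fin_num (E : set Omega) : Pc E \is a fin_num.
Proof. by rewrite ge0_fin_numE ?measure_ge0// (le_lt_trans (completed_le1 _))// ltry. Qed.

Lemma completed_le (E F : set Omega) : E `<=` F ->
  fine (Pc E) <= fine (Pc F).
Proof. by move=> EF; apply: fine_le; rewrite ?completed_fin_num//; exact: le_mu_ext. Qed.

Lemma persistence01 r x : 0 <= persistence r x <= 1.
Proof.
rewrite fine_ge0 ?measure_ge0//= -lee_fin fineK ?completed_le1//; exact: completed_fin_num.
Qed.

Lemma persistence_anti r x y : x <= y -> persistence r y <= persistence r x.
Proof.
move=> xy; apply: completed_le => w /=; apply: le_lt_trans.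
apply: ge_ereal_sup => _ [t [h Tt] <-]; apply: ereal_sup_ubound; exists t => //; split => //.
by move: h; rewrite /= !in_itv /= => /andP[-> h]; exact: le_trans xy.
Qed.

Lemma persistence_fin_le (I : finType) (t : I -> R) r x : (forall i, T (t i)) ->
  (forall i, t i <= x) -> persistence r x <= fine (P [set w | forall i, Z (t i) w < r]).
Proof.
move=> Tt tx; have mE := measurable_rays (fun=> r) (fun i => mZ (t i)).
rewrite -[P _](measurable_mu_extE P mE); apply: completed_le => w h i.
rewrite -lte_fin; apply: le_lt_trans h; apply: ereal_sup_ubound.
by exists (t i) => //; split => //; rewrite /= in_itv /= T_ge0//=.
Qed.

Lemma persistenceE (u : nat -> R) (x r : R) : dense_seq T x u ->
  persistence r x = fine (P (below_sup Z u r)).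
Proof. by move=> du; rewrite /persistence (below_eventE _ du). Qed.

End persistence.

(** * Rate of decay of the persistence probability *)

Section row_sums.
Context {R : numDomainType}.

Definition natdist (i j : nat) : nat := (i - j) + (j - i).

Lemma natdistE (i j : nat) (h : R) : 0 <= h ->
  `|i%:R * h - j%:R * h| = (natdist i j)%:R * h.
Proof.
move=> h0; rewrite -mulrBl normrM (ger0_norm h0) /natdist; congr (_ * _).
have [ij|/ltnW ji] := leqP i j.
  by rewrite distrC -natrB// normr_nat (eqP ij) add0n.
by rewrite -natrB// normr_nat (eqP ji) addn0.
Qed.

(** Each distance to [i] is attained at most once on either side. *)
Lemma row_sum_le (g : nat -> R) (N : nat) (i : 'I_N) : (forall k, 0 <= g k) ->
  \sum_(j < N) g (natdist i j) <= 2 * \sum_(k < N) g k.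
Proof.
move=> g0.
have sub (m : nat) : (m <= N)%N -> \sum_(0 <= k < m) g k <= \sum_(k < N) g k.
  move=> mN; rewrite -(big_mkord xpredT g) (@big_cat_nat _ _ _ m 0 N)//= lerDl.
  by apply: sumr_ge0.
rewrite -(big_mkord xpredT (fun j => g (natdist i j))) (@big_cat_nat _ _ _ i.+1 0 N)//= mulr_natl mulr2n.
apply: lerD.
- rewrite big_nat_rev /= add0n; apply: le_trans (sub i.+1 _) => //.
  rewrite big_nat [leRHS]big_nat; apply: ler_sum => k /andP[_ ki].
  by rewrite (_ : natdist i (i.+1 - k.+1) = k)//; move: ki; rewrite /natdist; lia.
- rewrite -{1}(add0n i.+1) big_addn; apply: le_trans (_ : \sum_(0 <= k < N - i.+1) g k.+1 <= _).
    rewrite big_nat [leRHS]big_nat; apply: ler_sum => k _.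
    by rewrite /natdist addnS -addSn addnK (_ : (i - (k.+1 + i))%N = 0%N) ?add0n//; apply/eqP; rewrite subn_eq0 leq_addl.
  have : \sum_(0 <= k < (N - i.+1).+1) g k <= \sum_(k < N) g k.
    by apply: sub; rewrite -subSn// subSS leq_subr.
  by apply: le_trans; rewrite big_nat_recl// lerDr.
Qed.

(** Among 2 K positions, [j] is an end of a run of K consecutive ones, to its left if [K <= j] and
    to its right otherwise; the distances along it are 0, ..., K - 1. *)
Lemma row_sum_ge (g : nat -> R) (K j : nat) : (forall k, 0 <= g k) -> (j < K + K)%N ->
  \sum_(k < K) g k <= \sum_(i < K) g (natdist j i) + \sum_(i < K) g (natdist j (K + i)).
Proof.
move=> g0 jK.
have -> : \sum_(i < K) g (natdist j i) + \sum_(i < K) g (natdist j (K + i)) =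
    \sum_(0 <= i < K + K) g (natdist j i).
  rewrite (big_mkord xpredT (fun i => g (natdist j i))) big_split_ord /=.
  by congr (_ + _).
rewrite -(big_mkord xpredT g); have [Kj|jK'] := leqP K j.
- rewrite (@big_cat_nat _ _ _ (j.+1 - K)%N 0 (K + K))//=; last by lia.
  rewrite (@big_cat_nat _ _ _ j.+1 (j.+1 - K)%N (K + K))//=; last exact: leq_subr.
  apply: ler_wpDl; first exact: sumr_ge0.
  apply: ler_wpDr; first exact: sumr_ge0.
  rewrite -[X in \sum_(X <= _ < _) g (natdist j _)]add0n big_addn subKn; last exact: leq_trans Kj _.
  rewrite big_nat_rev /= add0n big_nat [leRHS]big_nat; apply: ler_sum => k /andP[_ kK].
  rewrite /natdist (_ : (j - (k + (j.+1 - K)))%N = (K - k.+1)%N); last by lia.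
  by rewrite (_ : (k + (j.+1 - K) - j)%N = 0%N) ?addn0//; lia.
- rewrite [leRHS](@big_cat_nat _ _ _ j 0 (K + K))//=; last exact: ltnW.
  rewrite (@big_cat_nat _ _ _ (j + K)%N j (K + K))//=; [|exact: leq_addr|by rewrite leq_add2r ltnW].
  apply: ler_wpDl; first exact: sumr_ge0.
  apply: ler_wpDr; first exact: sumr_ge0.
  rewrite -[X in \sum_(X <= _ < _) g (natdist j _)]add0n big_addn addKn.
  rewrite big_nat [leRHS]big_nat; apply: ler_sum => k _.
  by rewrite /natdist addnK (_ : (j - (k + j))%N = 0%N) ?add0n//; lia.
Qed.

End row_sums.

(** * The two cases over an abstract time set, covering discrete and continuous time together *)

Section persistence_rate.
Context {R : realType} {T : set R} {A : R -> R} {d : measure_display} {Omega : measurableType d}.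
Context {P : probability Omega R} {Z : R -> {RV P >-> R}}.
Hypotheses (hgauss : gaussian_process T Z) (hcent : centered_process T Z).
Hypotheses (hstat : stationary_process T Z) (hcorr : has_correlation T Z A).
Hypothesis hcont : ae_continuous_paths T Z.
Hypothesis T_ge0 : forall t, T t -> 0 <= t.
Hypothesis T_add : forall s t, T s -> T t -> T (s + t).
Hypothesis T_sub : forall s t, T s -> T t -> s < t -> T (t - s).
Hypothesis T_nat : forall n : nat, T n.+1%:R.
Hypothesis T_dense : forall x, T x -> exists u, dense_seq T x u.
Hypothesis A_ge0 : forall s t, T s -> T t -> 0 <= A `|s - t|.
Hypothesis paths_bounded : forall x, {ae P, forall w, exists c, forall t, T t -> t <= x -> Z t w <= c}.
Hypothesis A_near0 : exists2 delta, T delta /\ 0 < delta & exists2 s, T s &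
  forall t, T t -> t <= delta -> 2^-1 <= A `|t - s|.

Let p := @persistence R T d Omega P Z.

Let p_ge0 r x : 0 <= p r x.
Proof. by case/andP: (persistence01 (T := T) (Z := Z) r x). Qed.

Let p_le1 r x : p r x <= 1.
Proof. by case/andP: (persistence01 (T := T) (Z := Z) r x). Qed.

Let p_anti r x y : x <= y -> p r y <= p r x.
Proof. exact: persistence_anti. Qed.

Let mZ t : measurable_fun setT (Z t).
Proof. exact: measurable_funPT. Qed.

Lemma persistence_mono r r' x : r <= r' -> p r x <= p r' x.
Proof. by move=> rr; apply: completed_le => w h; apply: lt_le_trans h _; rewrite lee_fin. Qed.

Lemma persistence_supmul r x y : T x -> T y -> p r x * p r y <= p r (x + y).
Proof.
move=> Tx Ty; have [u du] := T_dense Tx; have [v dv] := T_dense Ty.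
have dw := dense_seq_merge T_add T_sub Tx (T_ge0 Ty) du dv.
rewrite /p (persistenceE T_ge0 hcont _ du) (persistenceE T_ge0 hcont _ dv) (persistenceE T_ge0 hcont _ dw).
have [[Tu _] [Tv _]] := (du, dv).
apply: (below_sup_supmul hgauss hcent hstat hcorr A_ge0) => // k.
- by case: (Tu k).
- by case: (Tv k).
- by apply: T_add => //; case: (Tv k).
Qed.

Lemma persistence_cameron_martin (I : finType) (b s : I -> R) (r M x : R) : T x ->
  (forall i, T (s i)) -> 0 <= M ->
  (forall t, T t -> t <= x -> 1 <= \sum_i b i * A `|t - s i|) ->
  p (r + M) x ^+ 2 <= expR (M ^+ 2 * bil (fun i j => A `|s i - s j|) b b) * p r x.
Proof.
move=> Tx Ts M0 hb; have [u du] := T_dense Tx; have [Tu _] := du.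
rewrite /p !(persistenceE T_ge0 hcont _ du).
apply: (below_sup_cameron_martin hgauss hcent hcorr) => // k; first by case: (Tu k).
by have [h1 h2] := Tu k; exact: hb.
Qed.

(** Almost every path is bounded above up to time [x], so the events at integer levels increase to a
    set of probability 1. *)
Lemma persistence_level r x e : T x -> 0 < e -> exists2 M, 0 <= M & 1 - e <= p (r + M) x.
Proof.
move=> Tx e0; have [u du] := T_dense Tx; have [Tu _] := du.
have mB m : measurable (below_sup Z u m%:R) by exact: measurable_below_sup.
have ndB m n : (m <= n)%N -> below_sup Z u m%:R `<=` below_sup Z u n%:R.
  move=> mn w [k _ hk]; exists k => // i; apply: lt_le_trans (hk i) _.
  by rewrite lerD2r ler_nat.
have c := fine_prob_bigcup_cvg (P := P) mB ndB.
have U1 : fine (P (\bigcup_m below_sup Z u m%:R)) = 1.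
{ have [N [mN N0 hN]] := paths_bounded x.
  have mU : measurable (\bigcup_m below_sup Z u m%:R) by exact: bigcup_measurable.
  have : (P [set: Omega] <= P (\bigcup_m below_sup Z u m%:R `|` N))%E.
    apply: le_measure; rewrite ?inE//; first exact: measurableU.
    move=> w _; have [Nw|Nw] := pselect (N w); first by right.
    left; have [c0 hc] : exists c0, forall t, T t -> t <= x -> Z t w <= c0.
      by apply: contrapT => h; apply: Nw; exact: hN.
    (* The margin of index 0 is 1, so the level [m.+1] leaves the strict bound [m]. *)
    pose m := (Num.truncn `|c0|).+1; exists m.+1 => //; exists 0%N => // k.
    have [h1 h2] := Tu k; apply: le_lt_trans (hc _ h1 h2) _.
    rewrite invr1 -natr1 addrK; apply: le_lt_trans (ler_norm _) _; exact: truncnS_gt.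
  have PU : (P (\bigcup_m below_sup Z u m%:R `|` N) <= P (\bigcup_m below_sup Z u m%:R) + P N)%E :=
    measureU2 _ mU mN.
  rewrite N0 adde0 in PU; move=> /le_trans/(_ PU); rewrite probability_setT => h.
  have -> // : P (\bigcup_m below_sup Z u m%:R) = 1%E.
  by apply/eqP; rewrite eq_le h andbT probability_le1. }
rewrite U1 in c.
have /cvgrPdist_le/(_ e e0)[m _ /(_ m (leqnn m))] := c; set q := fine _ => hm.
exists (`|m%:R| + `|r|); first by rewrite addr_ge0.
apply: le_trans (persistence_mono x (_ : m%:R <= _)); last first.
  by have := ler_norm (- r); have := ler_norm (m%:R : R); rewrite normrN; lra.
rewrite /p (persistenceE T_ge0 hcont _ du) -/q.
by have := le_trans (ler_norm _) hm; lra.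
Qed.

(** On a short interval all times have correlation at least 1/2 with one time [s], so a shift along
    [2 * Z s] brings the level down to [r] from a height where the probability is at least 1/2.
    Supermultiplicativity then reaches time 1. *)
Lemma persistence1_gt0 r : 0 < p r 1.
Proof.
have [delta [Td d0] [s Ts hs]] := A_near0.
have [M' M'0 hM'] := @persistence_level r delta 2^-1 Td ltac:(lra).
have pd : 0 < p r delta.
{ have := @persistence_cameron_martin unit (fun=> 2) (fun=> s) r M' delta Td (fun=> Ts) M'0.
  move=> h; have {}h := h _; rewrite ltNge; apply/negP => p0.
  have : p (r + M') delta ^+ 2 <= 0.
    apply: le_trans (h _) _; last by rewrite mulr_ge0_le0 ?expR_ge0.
    by move=> t Tt td; rewrite sum_unit; have := hs t Tt td; lra.
  by apply/negP; rewrite -ltNge exprn_gt0//; apply: lt_le_trans hM'; lra. }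
have pk (k : nat) : T (k.+1%:R * delta) /\ p r delta ^+ k.+1 <= p r (k.+1%:R * delta).
{ elim: k => [|k [Tk IH]]; first by rewrite mul1r expr1.
  rewrite -natr1 mulrDl mul1r; split; first exact: T_add.
  apply: le_trans (persistence_supmul r Tk Td); rewrite exprSr ler_pM2r//. }
have [_ h] := pk (Num.truncn delta^-1).
apply: lt_le_trans (exprn_gt0 (Num.truncn delta^-1).+1 pd) _.
apply: le_trans h _; apply: persistence_anti.
by rewrite -ler_pdivrMr// mul1r ltW// truncnS_gt.
Qed.

Lemma persistence_natmul r (n m : nat) : p r n%:R * p r m%:R <= p r (n + m)%:R.
Proof.
case: n => [|n].
  by rewrite add0n ler_piMl.
case: m => [|m]; first by rewrite addn0 ler_piMr.
by rewrite natrD; exact: persistence_supmul.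
Qed.

(** As 0 need not belong to [T], [k%:R * h] is realised as the distance between the times
    [k.+1%:R * h] and [h]. *)
Lemma A_grid (h : R) (k : nat) : 0 < h -> (forall i : nat, T (i.+1%:R * h)) -> 0 <= A (k%:R * h).
Proof.
move=> h0 Th; have := A_ge0 (Th k) (Th 0%N).
by rewrite (@natdistE _ k.+1 1%N h (ltW h0)) (_ : natdist k.+1 1 = k)// /natdist; lia.
Qed.

Lemma persistence_theta r : exists2 L : R, 0 <= L &
  [/\ theta_exists T Z r, theta T Z r = L%:E,
      forall n : nat, p r n%:R <= expR (- (L * n%:R)) &
      forall e, L < e -> exists2 n : nat, (0 < n)%N & expR (- (e * n%:R)) <= p r n%:R].
Proof.
have p_mul := persistence_natmul r.
have [L L0 [cL h1 h2]] := supmul_rate (p_le1 r) (@p_anti r) p_mul (persistence1_gt0 r).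
have cE : log_persistence_rate T Z r x @[x --> +oo] --> (- L)%:E.
{ have -> : log_persistence_rate T Z r = (fun x => (x^-1 * ln (p r x))%:E).
    apply/funext => x; rewrite /log_persistence_rate.
    rewrite -[X in lne X](fineK (completed_fin_num _)) lne_EFin//.
    exact: (supmul_gt0 (@p_anti r) p_mul (persistence1_gt0 r)).
  by apply: cvg_EFin => //; exact: nearW. }
exists L => //; split => //.
- by apply/cvg_ex; exists (- L)%:E.
- by rewrite /theta (cvg_lim _ cE)// EFinN oppeK.
Qed.

(** The step [h] may vary with [N]; only its bound [K.+1] is fixed. The first [N] multiples of [h]
    lie in an interval of length [K.+1 * N], so an exponential bound in [N] is one in time. *)
Lemma theta_gt0 r :
  (forall eps, 0 < eps -> exists K : nat, forall N : nat, exists h,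
     [/\ 0 < h, h <= K.+1%:R, forall i : nat, T (i.+1%:R * h) &
         \sum_(k < N) A (k.+1%:R * h) <= eps]) ->
  theta_exists T Z r /\ (0 < theta T Z r < +oo)%E.
Proof.
move=> hA; have [L L0 [ex -> h1 h2]] := persistence_theta r; split => //.
rewrite ltry andbT lte_fin.
have [eps eps0 heps] := orthant_upper_bound r.
(* Half of [eps], because a row of the covariance matrix may meet each distance on both sides. *)
have [|K hK] := hA (eps / 2); first by rewrite divr_gt0.
apply: (@supmul_rate_gt0 _ (p r) _ _ _ K eps) => //.
- exact: p_anti.
- exact: persistence_natmul.
- exact: persistence1_gt0.
- move=> N; have [h [h0 hK1 Th hs]] := hK N.
  pose t (i : 'I_N) := i.+1%:R * h.
  have Tt i : T (t i) by exact: Th.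
  have gf := process_family hgauss hcent hcorr Tt.
  apply: le_trans (@persistence_fin_le _ _ _ _ _ _ T_ge0 _ t r _ Tt _) _.
    move=> i; rewrite /t natrM mulrC; apply: ler_pM => //; first exact: ltW.
    by rewrite ler_nat.
  have := heps _ _ _ _ _ _ gf; rewrite card_ord; apply.
  + by move=> i; rewrite subrr normr0; case: hcorr.
  + by move=> i j; exact: A_ge0.
  (* Setting [g 0 = 0] removes the diagonal, so the sum over [j != i] becomes a full row sum. *)
  + move=> i; pose g (k : nat) := if k is k'.+1 then A (k'.+1%:R * h) else 0.
    have g0 k : 0 <= g k by case: k => //= k; exact: A_grid.
    rewrite (_ : \sum_(j | j != i) _ = \sum_(j < N) g (natdist i j)); last first.
      rewrite [RHS](bigD1 i)//= {1}/natdist subnn add0r; apply: eq_bigr => j ji.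
      rewrite /t natdistE ?ltW// [natdist i.+1 j.+1]/natdist !subSS -/(natdist i j).
      case E : (natdist i j) => [|k]//; exfalso; move/eqP: ji; apply.
      by apply: ord_inj; move: E; rewrite /natdist; lia.
    apply: le_trans (row_sum_le i g0) _; rewrite mulrC -ler_pdivlMr//.
    apply: le_trans hs; case: N i t {Tt gf} => [[]//|N] i t.
    rewrite big_ord_recl /= add0r big_ord_recr /= lerDl; exact: A_grid.
Qed.

(** [delta] is the spacing of a grid of 2 K points in [0, n], [omega] the error made when a time t
    is moved to a grid point. Put G = [\sum_(k < K) A (k%:R * delta)]. As 2 K omega <= G / 2, every
    t has total covariance at least G / 2 with the grid: hence the weights 2 / G. The variance of
    the weighted sum is at most (2 / G)^2 (8 K G) = 16 n / (delta G), which the last condition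
    bounds by eta n. *)
Lemma theta_eq0 r :
  (forall eta, 0 < eta -> exists (K n : nat) (delta omega : R),
     [/\ (0 < n)%N /\ (0 < K)%N, [/\ 0 < delta, (K + K)%:R * delta = n%:R & forall i : nat, T (i.+1%:R * delta)],
       forall t, T t -> t <= n%:R -> exists2 j, (j < K + K)%N & forall i, (i < K + K)%N ->
         A ((natdist j i)%:R * delta) - omega <= A `|t - i.+1%:R * delta| &
       (K + K)%:R * omega <= (\sum_(k < K) A (k%:R * delta)) / 2 /\
       16 <= eta * delta * \sum_(k < K) A (k%:R * delta)]) ->
  theta_exists T Z r /\ theta T Z r = 0%E.
Proof.
move=> hB; have [L L0 [ex -> h1 h2]] := persistence_theta r; split => //.
have -> // : L = 0.
apply: (@supmul_rate_eq0 _ (p r)) => // eps eps0.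
(* Budget for a total rate [eps]: the raised level has rate at most [eps / 4], doubled by the square
   in the shift inequality, and the shift costs another [eps / 2]. *)
have e1 : 0 < 1 - expR (- (eps / 4)) by rewrite subr_gt0 -[ltRHS]expR0 ltr_expR; lra.
have [M M0 hM] := persistence_level r (T_nat 0) e1.
have {}hM : expR (- (eps / 4)) <= p (r + M) 1 by move: hM; lra.
have M1 : 0 < M ^+ 2 + 1 by rewrite ltr_wpDl ?sqr_ge0.
(* Then [M ^+ 2 * eta <= eps / 2]; the added 1 keeps the quotient meaningful for [M = 0]. *)
pose eta := eps / 2 / (M ^+ 2 + 1).
have eta0 : 0 < eta by rewrite !divr_gt0.
have [K [n [delta [omega [[n0 K0] [d0 Kn Td] hj [hom hG]]]]]] := hB eta eta0.
move: hom hG; set G := \sum_(k < K) _ => hom hG.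
have G0 : 0 < G.
{ rewrite -(pmulr_rgt0 _ (mulr_gt0 eta0 d0)); exact: lt_le_trans hG. }
pose q (i : 'I_K + 'I_K) : nat := match i with inl i => i | inr i => (K + i)%N end.
have qK i : (q i < K + K)%N.
  by case: i => i /=; [apply: leq_trans (ltn_ord i) _; exact: leq_addr|rewrite ltn_add2l].
pose s i := (q i).+1%:R * delta.
have Ts i : T (s i) by exact: Td.
have sE i j : A `|s i - s j| = A ((natdist (q i) (q j))%:R * delta).
  by rewrite /s natdistE ?ltW// {1}/natdist !subSS.
have g0 k : 0 <= A (k%:R * delta) by exact: A_grid.
have cov t : T t -> t <= n%:R -> 1 <= \sum_i (2 / G) * A `|t - s i|.
{ move=> Tt tn; have [j jK hj'] := hj t Tt tn.
  rewrite -mulr_sumr mulrAC ler_pdivlMr// mul1r.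
  have : \sum_i (A ((natdist j (q i))%:R * delta) - omega) <= \sum_i A `|t - s i|.
    by apply: ler_sum => i _; exact: hj'.
  rewrite sumrB sumr_const card_sum card_ord -[omega *+ _]mulr_natl.
  have := row_sum_ge g0 jK; rewrite big_sumType /= -/G.
  lra. }
have var : bil (fun i j => A `|s i - s j|) (fun=> 2 / G) (fun=> 2 / G) <= eta * n%:R.
{ pose C i j := A `|s i - s j|.
  (* The variance of the sum over 2 K points is at most 4 times that over K
     points, since the difference of the two halves has non-negative variance. *)
  pose a (i : 'I_K + 'I_K) : R := if i is inl _ then 1 else -1.
  have psd := gaussian_family_psd (process_family hgauss hcent hcorr Ts) a.
  have sumE : bil C (fun=> 1) (fun=> 1) + bil C a a =
      4 * \sum_(i < K) \sum_(j < K) A ((natdist i j)%:R * delta).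
  { rewrite /bil -big_split /= big_sumType /=.
    have -> : \sum_(i < K) (\sum_j C (inl i) j * (1 * 1) + \sum_j C (inl i) j * (1 * a j)) =
        2 * \sum_(i < K) \sum_(j < K) A ((natdist i j)%:R * delta).
      rewrite mulr_sumr; apply: eq_bigr => i _; rewrite -big_split big_sumType /=.
      rewrite [X in _ + X]big1 ?addr0 => [|j _]; last by ring.
      by rewrite mulr_sumr; apply: eq_bigr => j _; rewrite /C sE /=; ring.
    have -> : \sum_(i < K) (\sum_j C (inr i) j * (1 * 1) + \sum_j C (inr i) j * (-1 * a j)) =
        2 * \sum_(i < K) \sum_(j < K) A ((natdist i j)%:R * delta).
      rewrite mulr_sumr; apply: eq_bigr => i _; rewrite -big_split big_sumType /=.
      rewrite [X in X + _]big1 ?add0r => [|j _]; last by ring.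
      rewrite mulr_sumr; apply: eq_bigr => j _; rewrite /C sE /=.
      rewrite (_ : natdist (K + i) (K + j) = natdist i j); last by rewrite /natdist !subnDl.
      ring.
    ring. }
  have rows : \sum_(i < K) \sum_(j < K) A ((natdist i j)%:R * delta) <= 2 * K%:R * G.
  { apply: (@le_trans _ _ (\sum_(i < K) 2 * G)).
      by apply: ler_sum => i _; exact: (@row_sum_le _ (fun k => A (k%:R * delta)) K i g0).
    by rewrite sumr_const card_ord -[_ *+ K]mulr_natl mulrCA mulrA. }
  have -> : bil C (fun=> 2 / G) (fun=> 2 / G) = (2 / G) ^+ 2 * bil C (fun=> 1) (fun=> 1).
    rewrite /bil mulr_sumr; apply: eq_bigr => i _; rewrite mulr_sumr; apply: eq_bigr => j _; ring.
  have V8 : bil C (fun=> 1) (fun=> 1) <= 8 * K%:R * G.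
    by move: sumE psd rows; rewrite -/C; move: (bil _ _ _) (bil _ _ _) (\sum_i _) => x y z; lra.
  apply: le_trans (ler_wpM2l (sqr_ge0 _) V8) _.
  rewrite -Kn natrD (_ : (2 / G) ^+ 2 * (8 * K%:R * G) = 32 * K%:R / G); last by field; rewrite gt_eqF.
  rewrite ler_pdivrMr//.
  have K0' : 0 <= K%:R :> R by [].
  have := ler_wpM2l K0' hG; lra. }
have cm := @persistence_cameron_martin _ (fun=> 2 / G) s r M _ (T_nat n.-1) Ts M0.
rewrite prednK// in cm; have {}cm := cm cov.
exists n => //.
have p1 : expR (- (eps / 4 * n%:R)) <= p (r + M) n%:R.
{ apply: (@le_trans _ _ (p (r + M) 1 ^+ n)).
    rewrite -mulNr mulrC expRM_natl; apply: lerXn2r; rewrite ?nnegrE ?expR_ge0//.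
  have := @supmul_exp _ (p (r + M)) (persistence_natmul (r + M)) 1 n.-1 (persistence1_gt0 _).
  by rewrite prednK// muln1. }
have : expR (- (eps / 4 * n%:R)) ^+ 2 <= expR (eps / 2 * n%:R) * p r n%:R.
{ apply: (@le_trans _ _ (p (r + M) n%:R ^+ 2)).
    by apply: lerXn2r; rewrite ?nnegrE ?expR_ge0//.
  apply: le_trans cm _; apply: ler_wpM2r => //.
  rewrite ler_expR; apply: le_trans (ler_wpM2l (sqr_ge0 M) var) _.
  rewrite mulrA; apply: ler_wpM2r => //; rewrite /eta mulrCA ler_piMr ?divr_ge0// ?ltW//.
  by rewrite ltr_pdivrMr// mul1r ltrDl. }
move=> h; rewrite -(ler_pM2l (expR_gt0 (eps / 2 * n%:R))) -expRD; apply: le_trans h.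
rewrite -expRM_natl ler_expR; lra.
Qed.

End persistence_rate.

(** * Discrete time *)

Section discrete_time.
Context {R : realType}.
Local Notation T := (positive_naturals R).

Lemma positive_naturalsS (n : nat) : T n.+1%:R.
Proof. by exists n.+1. Qed.

Lemma positive_naturals_ge0 (t : R) : T t -> 0 <= t.
Proof. by move=> [n _ <-]. Qed.

Lemma positive_naturalsD (s t : R) : T s -> T t -> T (s + t).
Proof. by move=> [m m0 <-] [n n0 <-]; exists (m + n)%N; rewrite ?natrD//= addn_gt0 m0. Qed.

Lemma positive_naturalsB (s t : R) : T s -> T t -> s < t -> T (t - s).
Proof.
move=> [m m0 <-] [n n0 <-]; rewrite ltr_nat => mn.
by exists (n - m)%N; [rewrite /= subn_gt0|rewrite natrB// ltnW].
Qed.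

Lemma positive_naturals_dense (x : R) : T x -> exists u, dense_seq T x u.
Proof.
move=> [n n0 <-]; exists (fun k => (minn n k.+1)%:R); split => [k|t e [m m0 <-] mn e0].
  by split; [exists (minn n k.+1) => //=; rewrite leq_min n0|rewrite ler_nat geq_minl].
exists m.-1; rewrite prednK// (minn_idPr _) ?subrr ?normr0//.
by move: mn; rewrite ler_nat.
Qed.

Lemma counting_integral (A : R -> R) : (forall t, T t -> 0 <= A t) ->
  (\int[counting : {measure set (measurableTypeR R) -> \bar R}]_(t in T) (A t)%:E =
   \sum_(k <oo) (A k.+1%:R)%:E)%E.
Proof.
move=> A0.
pose F (k : nat) : set (measurableTypeR R) := [set k.+1%:R].
have TE : T = \bigcup_k F k.
  apply/seteqP; split => t; first by move=> [[//|n] _ <-]; exists n.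
  by move=> [n _ ->]; exact: positive_naturalsS.
have mF k : measurable (F k) by exact: measurable_set1.
rewrite TE ge0_integral_bigcup//.
- apply: eq_eseriesr => k _.
  rewrite (_ : (\int[_]_(x in F k) _)%E = (\int[counting]_(x in F k) (cst (A k.+1%:R)%:E) x)%E); last first.
    by apply: eq_integral => x; rewrite inE => ->.
  have c1 : counting [set (k.+1%:R : R)] = 1%E :> \bar R.
    rewrite /counting asboolT; last exact: finite_set1.
    by rewrite fset_set1 [size _](finmap.cardfs1 (k.+1%:R : R)).
  by rewrite integral_cst// /= c1 mule1.
- apply/measurable_fun_bigcup => // k; exact: measurable_fun_set1.
- by move=> x; rewrite -TE => Tx; rewrite lee_fin; exact: A0.
- apply/trivIsetP => i j _ _ ij; apply/seteqP; split => // x [-> /eqP].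
  by rewrite eqr_nat eqSS (negPf ij).
Qed.

Lemma nneseries_bounded (a : nat -> R) : (forall k, 0 <= a k) ->
  (\sum_(k <oo) (a k)%:E < +oo)%E -> exists L, forall n, \sum_(k < n) a k <= L.
Proof.
move=> a0; set S := (\sum_(k <oo) _)%E => Soo.
exists (fine S) => n.
have S0 : (0 <= S)%E by apply: nneseries_ge0 => k _ _; rewrite lee_fin.
rewrite -lee_fin fineK ?ge0_fin_numE// -sumEFin -(big_mkord xpredT (fun k => (a k)%:E)).
by apply: nneseries_lim_ge => k _ _; rewrite lee_fin.
Qed.

Lemma nneseries_unbounded (a : nat -> R) : (forall k, 0 <= a k) ->
  (\sum_(k <oo) (a k)%:E = +oo)%E -> forall L, exists n, L <= \sum_(k < n) a k.
Proof.
move=> a0 Soo L; apply: contrapT => /forallNP h.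
have : (\sum_(k <oo) (a k)%:E <= L%:E)%E.
  apply: lime_le; first by apply: is_cvg_nneseries => k _ _; rewrite lee_fin.
  apply: nearW => n; rewrite /= big_mkord sumEFin lee_fin ltW// ltNge; exact/negP/h.
by rewrite Soo.
Qed.

(* Sampling a convergent series at the multiples of [K + 1] leaves at most its tail. *)
Lemma sampled_series_small (a : nat -> R) (L eps : R) : (forall k, 0 <= a k) ->
  (forall n, \sum_(k < n) a k <= L) -> 0 < eps ->
  exists K : nat, forall N, \sum_(k < N) a (k * K.+1 + K)%N <= eps.
Proof.
move=> a0 aL eps0.
pose S := [set \sum_(k < n) a k | n in [set: nat]].
have supS : has_sup S by split; [exists (\sum_(k < 0) a k), 0%N|exists L => _ [n _ <-]].
have [_ [K _ <-] hK] := sup_adherent eps0 supS.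
exists K => N.
have mono (m n : nat) : (m <= n)%N -> \sum_(k < m) a k <= \sum_(k < n) a k.
  move=> mn; rewrite -!(big_mkord xpredT a) (@big_cat_nat _ _ _ m 0 n)//= lerDl.
  exact: sumr_ge0.
have : \sum_(k < N) a (k * K.+1 + K)%N + \sum_(k < K) a k <= \sum_(k < N * K.+1 + K) a k.
{ elim: N => [|N IH]; first by rewrite big_ord0 add0r mul0n.
  apply: le_trans (mono (N * K.+1 + K).+1 _ _); last by lia.
  by rewrite !big_ord_recr /= addrAC lerD2r. }
have : \sum_(k < N * K.+1 + K) a k <= sup S by apply: ub_le_sup; [case: supS|exists (N * K.+1 + K)%N].
by move: hK; lra.
Qed.

Section discrete_process.
Context {A : R -> R} {d : measure_display} {Omega : measurableType d}.
Context {P : probability Omega R} {Z : R -> {RV P >-> R}}.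
Hypotheses (hgauss : gaussian_process T Z) (hcent : centered_process T Z).
Hypotheses (hstat : stationary_process T Z) (hcorr : has_correlation T Z A).
Hypothesis hcont : ae_continuous_paths T Z.
Hypothesis hA : forall t, T t -> 0 <= A t.

Let A_dist s t : T s -> T t -> 0 <= A `|s - t|.
Proof.
move=> Ts Tt; have [st|ts|->] := ltgtP s t; last by rewrite subrr normr0 (proj1 hcorr).
  by rewrite distrC gtr0_norm ?subr_gt0//; apply: hA; exact: positive_naturalsB.
by rewrite gtr0_norm ?subr_gt0//; apply: hA; exact: positive_naturalsB.
Qed.

Let paths_bounded x : {ae P, forall w, exists c, forall t, T t -> t <= x -> Z t w <= c}.
Proof.
apply: aeW => w; exists (\sum_(k < (Num.truncn x).+1) `|Z k.+1%:R w|) => t [[//|n] _ <-] nx.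
have nk : (n < (Num.truncn x).+1)%N.
  rewrite -(ltr_nat R); apply: le_lt_trans (truncnS_gt x).
  by apply: le_trans nx; rewrite ler_nat.
rewrite (bigD1 (Ordinal nk))//=; apply: le_trans (ler_norm _) _.
by rewrite lerDl; apply: sumr_ge0.
Qed.

Let A_near0 : exists2 delta, T delta /\ 0 < delta & exists2 s, T s &
  forall t, T t -> t <= delta -> 2^-1 <= A `|t - s|.
Proof.
exists 1; first by split => //; exact: (positive_naturalsS 0).
exists 1; first exact: (positive_naturalsS 0).
move=> _ [[//|n] _ <-]; rewrite (ler_nat R _ 1) ltnS leqn0 => /eqP ->.
by rewrite subrr normr0 (proj1 hcorr); lra.
Qed.

Lemma discrete_theta_gt0 r :
  (\int[counting : {measure set (measurableTypeR R) -> \bar R}]_(t in T) (A t)%:E < +oo)%E ->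
  theta_exists T Z r /\ (0 < theta T Z r < +oo)%E.
Proof.
rewrite counting_integral//.
have a0 (k : nat) : 0 <= A k.+1%:R by apply: hA; exact: positive_naturalsS.
move=> /(nneseries_bounded a0)[L hL].
apply: (theta_gt0 hgauss hcent hstat hcorr hcont positive_naturals_ge0 positive_naturalsD
  positive_naturalsB positive_naturalsS positive_naturals_dense A_dist paths_bounded A_near0).
(* The series starts at time 1, so the index [k * K.+1 + K] stands for the time [k.+1 * K.+1], a
   multiple of the step [K.+1]. *)
move=> eps eps0; have [K hK] := sampled_series_small a0 hL eps0.
exists K => N; exists K.+1%:R; split => //.
  by move=> i; rewrite -natrM mulSn; exact: positive_naturalsS.
apply: le_trans (hK N); apply: ler_sum => k _.
by rewrite -natrM (_ : (k.+1 * K.+1)%N = (k * K.+1 + K).+1)//; lia.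
Qed.

Lemma discrete_theta_eq0 r :
  (\int[counting : {measure set (measurableTypeR R) -> \bar R}]_(t in T) (A t)%:E = +oo)%E ->
  theta_exists T Z r /\ theta T Z r = 0%E.
Proof.
rewrite counting_integral//.
have a0 (k : nat) : 0 <= A k.+1%:R by apply: hA; exact: positive_naturalsS.
move=> /(nneseries_unbounded a0) hL.
apply: (theta_eq0 hgauss hcent hstat hcorr hcont positive_naturals_ge0 positive_naturalsD
  positive_naturalsB positive_naturalsS positive_naturals_dense A_dist paths_bounded A_near0).
move=> eta eta0; have [m hm] := hL (16 / eta).
have GE : \sum_(k < m) A k.+1%:R <= \sum_(k < m.+1) A (k%:R * 1).
  rewrite [leRHS]big_ord_recl mul0r (proj1 hcorr); apply: ler_wpDl => //.
  by apply: ler_sum => k _; rewrite mulr1.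
have G0 : 0 <= 16 / eta by rewrite divr_ge0// ltW.
(* All times lie on the grid of spacing 1, so there is no error; [m.+1] terms because the sum over
   the grid starts with [A 0]. *)
exists m.+1, (m.+1 + m.+1)%N, 1, 0; split => //.
- by split => //; [rewrite mulr1|move=> i; rewrite mulr1; exact: positive_naturalsS].
- move=> _ [[//|n] _ <-]; rewrite ler_nat => nm; exists n => // i _.
  by rewrite subr0 mulr1 mulr1 -[n.+1%:R]mulr1 -[i.+1%:R]mulr1 natdistE// mulr1 /natdist !subSS.
- split; first by rewrite mulr0 divr_ge0//; apply: le_trans GE; exact: le_trans hm.
  rewrite mulr1 mulrC -ler_pdivrMr//; exact: le_trans GE.
Qed.

End discrete_process.
End discrete_time.

(** * Continuous time *)

Section uniform_covariance.
Context {R : realType} {A : R -> R} {d : measure_display} {Omega : measurableType d}.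
Context {P : probability Omega R} {Z : R -> {RV P >-> R}}.
Local Notation T := [set` `[(0 : R), +oo[].
Hypotheses (hgauss : gaussian_process T Z) (hcent : centered_process T Z).
Hypotheses (hcorr : has_correlation T Z A) (hcont : ae_continuous_paths T Z).

Let TE (t : R) : T t = (0 <= t) :> Prop.
Proof. by rewrite /= in_itv /= andbT. Qed.

(* Almost sure continuity at 0 gives convergence of characteristic functions of
   the increments, hence of their variances. *)
Lemma covariance_near0 (e : R) : 0 < e ->
  exists2 delta, 0 < delta & forall t, 0 <= t -> t <= delta -> 1 - A t <= e.
Proof.
move=> e0; apply: contrapT => /forall2NP h.
have h' (n : nat) : exists t : R, [/\ 0 <= t, t <= n.+1%:R^-1 & e < 1 - A t].
{ have [|] := h n.+1%:R^-1; first by rewrite invr_gt0.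
  move=> /existsNP[t /not_implyP[t0 /not_implyP[tn /negP]]].
  by rewrite -ltNge => et; exists t. }
have {h h'} [tau htau] := choice h'.
have mZ t : measurable_fun setT (Z t) by exact: measurable_funPT.
(* The increment has variance [2 * (1 - A (tau n))], halved in the exponent. *)
have cfE n : \int[P]_w cos (Z (tau n) w - Z 0 w) = expR (- (1 - A (tau n))).
{ have [tau0 _ _] := htau n.
  pose t (i : bool) := if i then tau n else 0.
  have Tt i : T (t i) by rewrite TE; case: i.
  have [_ _ cf] := process_family hgauss hcent hcorr Tt.
  have := cf (fun i => if i then 1 else -1) 0.
  under eq_Rintegral do rewrite big_bool /= mul1r mulN1r addr0.
  move=> ->; rewrite cos0 mul1r /bil !big_bool /= !subrr !normr0 (proj1 hcorr) subr0 sub0r normrN.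
  by rewrite (ger0_norm tau0); congr expR; field. }
have lim1 : \int[P]_w cos (Z (tau n) w - Z 0 w) @[n --> \oo] --> (1 : R).
{ have [N [mN N0 hN]] := hcont.
  rewrite -[X in _ --> X](Rint_cst P); apply: fine_cvg.
  rewrite fineK; last by apply: integrable_fin_num => //; exact: finite_measure_integrable_cst.
  have [//|//|||//|_ _] := @dominated_convergence _ _ _ P setT measurableT
    (fun n w => (cos (Z (tau n) w - Z 0 w))%:E) (cst 1%E) (cst 1%E).
  - move=> n; apply/measurable_EFinP.
    by apply: measurable_cos_comp; exact: measurable_funB.
  - exists N; split => // w /= hw; apply: hN => /= cw; apply: hw => _.
    apply: cvg_EFin; first exact: nearW.
    rewrite -[X in _ --> X]cos0; apply: continuous_cvg; first exact: continuous_cos.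
    apply/cvgrPdist_lt => eta eta0.
    have T0 : T 0 by rewrite TE.
    have /subspace_continuousP/(_ 0 T0)/cvgrPdist_lt/(_ eta eta0) := cw.
    rewrite near_withinE => /nbhs_ballP[delta /= d0 hd].
    near=> n; have [t0 tn _] := htau n.
    rewrite sub0r normrN distrC; apply: hd; last by rewrite in_itv /= t0.
    rewrite /ball /= sub0r normrN ger0_norm//; apply: le_lt_trans tn _.
    by near: n; exact: (near_infty_natSinv_lt (PosNum d0)).
  - exact: (finite_measure_integrable_cst P 1).
  - by apply: aeW => w n _; rewrite lee_fin; exact: cos_le1n.
  - by []. }
have : 1 <= expR (- e).
  apply: (ler_cvg_to lim1 (cvg_cst _)); apply: nearW => n.
  by rewrite cfE ler_expR lerN2; have [_ _ /ltW] := htau n.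
by apply/negP; rewrite -ltNge -[ltRHS]expR0 ltr_expR oppr_lt0.
Unshelve. all: by end_near. Qed.

(* Positivity of the covariance matrix at the times [a], [b] and [0]. *)
Lemma covariance_sqr_dist (a b : R) : 0 <= a -> 0 <= b ->
  (A a - A b) ^+ 2 <= 2 * (1 - A `|a - b|).
Proof.
move=> a0 b0.
pose t (i : 'I_3) := nth 0 [:: a; b; 0] i.
have Tt i : T (t i) by rewrite TE /t; case: i => [[|[|[|]]]].
(* The weight [A b - A a] on [Z 0] minimises the variance of [Z a - Z b + c * Z 0] over c; the
   minimum is [2 * (1 - A |a - b|) - (A a - A b) ^+ 2]. *)
have := gaussian_family_psd (process_family hgauss hcent hcorr Tt)
  (fun i => nth 0 [:: 1; -1; A b - A a] i).
rewrite /bil !big_ord_recl !big_ord0 /= /t /= !subrr !normr0 (proj1 hcorr) !subr0 !sub0r !normrN.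
rewrite (ger0_norm a0) (ger0_norm b0) (distrC b a).
move: (A a) (A b) (A `|a - b|) => x y z; nra.
Qed.

Lemma covariance_uniform (e : R) : 0 < e -> exists2 delta, 0 < delta &
  forall a b, 0 <= a -> 0 <= b -> `|a - b| <= delta -> `|A a - A b| <= e.
Proof.
move=> e0; have [|delta d0 hd] := @covariance_near0 (e ^+ 2 / 2).
  by rewrite divr_gt0// exprn_gt0.
exists delta => // a b a0 b0 ab.
have := covariance_sqr_dist a0 b0; have := hd _ (normr_ge0 _) ab.
move=> h1 h2; have : (A a - A b) ^+ 2 <= e ^+ 2 by lra.
by rewrite -[leLHS](@real_normK _ (A a - A b)) ?num_real// ler_sqr ?nnegrE// ltW.
Qed.

Lemma covariance_continuous : continuous (fun x : R => A `|x|).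
Proof.
move=> x; apply/cvgrPdist_le => e /covariance_uniform[delta d0 hd].
near=> y; apply: hd => //; apply: le_trans (ler_dist_dist _ _) _.
near: y; apply/nbhs_ballP; exists delta => // y /= /ltW; exact.
Unshelve. all: by end_near. Qed.

End uniform_covariance.

(** * Sums along arithmetic progressions and Riemann sums *)

Section half_line_integrals.
Context {R : realType} (B : R -> R).
Local Notation mu := (@lebesgue_measure R).
Hypotheses (cB : continuous B) (B_ge0 : forall x, 0 <= B x).

Let mB : measurable_fun setT B := continuous_measurable_fun cB.

Let mBD (D : set R) (c : R) : measurable_fun D (fun x => (c * B x)%:E).
Proof. by apply/measurable_EFinP/measurable_funTS; exact: measurable_funM. Qed.

Lemma integral_scale (c a b : R) : 0 < c -> a <= b ->
  (\int[mu]_(x in `[a, b]) (B (c * x))%:E =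
   \int[mu]_(x in `[(c * a)%R, (c * b)%R]) (c^-1 * B x)%:E)%E.
Proof.
move=> c0 ab.
have da (x : R) : is_derive x 1 (fun x : R => c * x) c.
  by apply: is_derive_eq; rewrite /GRing.scale /=; ring.
have dE : derive1 (fun x : R => c * x) = cst c.
  by apply/funext => x; rewrite derive1E; exact: (@derive_val _ _ _ _ _ _ _ (da x)).
have ca : continuous (fun x : R => c * x).
  by move=> x; apply: cvgM; [exact: cvg_cst|exact: cvg_id].
have := @integration_by_substitution_increasing _ (fun x : R => c * x) (fun x => c^-1 * B x) a b ab.
rewrite dE => ->.
- apply: eq_integral => x _; congr (_%:E); change (B (c * x) = c^-1 * B (c * x) * c).
  by rewrite mulrAC mulVf ?mul1r// gt_eqF.
- by move=> x y _ _ xy; rewrite ltr_pM2l.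
- by move=> x _; exact: cst_continuous.
- exact: is_cvg_cst.
- exact: is_cvg_cst.
- split.
  + by move=> x _; exact: (@ex_derive _ _ _ _ _ _ _ (da x)).
  + by apply: cvg_at_right_filter; exact: ca.
  + by apply: cvg_at_left_filter; exact: ca.
- apply: continuous_subspaceT => x; apply: cvgM; [exact: cvg_cst|exact: cB].
Qed.

(** The condition on k says that [k.+1] lies between x / (2 H) and x / H. With n the integer part of
    x / H, at most n indices qualify, and each contributes at most 2 / n. *)
Lemma harmonic_window (H x : R) (N : nat) : 0 < H ->
  \sum_(k < N) (if k.+1%:R * H <= x <= k.+1%:R * (2 * H) then k.+1%:R^-1 else 0 : R) <= 2.
Proof.
move=> H0; pose n := Num.truncn (x / H).
pose F (k : nat) : R := if (k < n)%N then 2 / n%:R else 0.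
have F0 k : 0 <= F k by rewrite /F; case: ifP => // _; rewrite divr_ge0.
apply: (@le_trans _ _ (\sum_(k < N) F k)).
{ apply: ler_sum => k _; case: ifP => [/andP[kx xk]|_]; last exact: F0.
  have kx' : k.+1%:R <= x / H by rewrite ler_pdivlMr.
  have x0 : 0 <= x / H by apply: le_trans kx'.
  have kn : (k < n)%N.
    have := truncnS_gt (x / H); move=> /(le_lt_trans kx'); rewrite ltr_nat; exact.
  have /andP[nx _] := truncn_itv x0.
  rewrite /F kn -[leLHS]mul1r ler_pdivrMr// mulrAC ler_pdivlMr ?ltr0n ?(leq_ltn_trans _ kn)// mul1r.
  apply: le_trans nx _; rewrite ler_pdivrMr//; apply: le_trans xk _.
  by rewrite mulrCA mulrA. }
rewrite -(big_mkord xpredT F).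
apply: (@le_trans _ _ (\sum_(0 <= k < n + N) F k)).
  rewrite [leRHS](@big_cat_nat _ _ _ N 0 (n + N))//= ?leq_addl// lerDl; exact: sumr_ge0.
rewrite (@big_cat_nat _ _ _ n 0 (n + N))//= ?leq_addr//.
have -> : \sum_(n <= k < n + N) F k = 0.
  by rewrite big_nat big1// => k /andP[nk _]; rewrite /F ltnNge nk.
rewrite addr0.
rewrite big_nat (eq_bigr (fun=> 2 / n%:R)) => [|k kn]; last by case/andP: kn => _ kn; rewrite /F kn.
rewrite -big_nat sumr_const_nat subn0 -[_ *+ n]mulr_natr.
by case: n {F F0} => [|n]; [rewrite mulr0|rewrite divfK].
Qed.

(* By averaging the sum over h in [H, 2 H]. *)
Lemma scaled_sum_small (I H e : R) (N : nat) :
  (\int[mu]_(x in `[0%R, +oo[) (B x)%:E <= I%:E)%E -> 0 < H -> 2 * I < e * H ->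
  exists h, [/\ H <= h, h <= 2 * H & \sum_(k < N) B (k.+1%:R * h) <= e].
Proof.
move=> hI H0 IH; apply: contrapT => /forallNP hN.
have gt_e h : H <= h -> h <= 2 * H -> e < \sum_(k < N) B (k.+1%:R * h).
  move=> h1 h2; rewrite ltNge; apply/negP => h3; exact: (hN h).
have H2 : H <= 2 * H by lra.
have mBk (k : nat) (D : set R) : measurable_fun D (fun x => (B (k.+1%:R * x))%:E).
  by apply/measurable_EFinP/measurable_funTS; apply: measurableT_comp => //; exact: measurable_funM.
have lower : ((e * H)%:E <= \int[mu]_(x in `[H, (2 * H)%R]) (\sum_(k < N) (B (k.+1%:R * x))%:E))%E.
{ have -> : (e * H)%:E = (\int[mu]_(x in `[H, (2 * H)%R]) (cst e%:E) x)%E.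
    rewrite integral_cst//= lebesgue_measure_itv /= lte_fin ifT; last by lra.
    by rewrite -EFinB -EFinM; congr (_%:E); ring.
  have e0 : 0 <= e.
    have I0 : 0 <= I by rewrite -lee_fin; apply: le_trans hI; apply: integral_ge0 => x _; rewrite lee_fin.
    have : 0 < e * H by apply: le_lt_trans IH; rewrite mulr_ge0.
    by rewrite pmulr_lgt0// => /ltW.
  apply: ge0_le_integral => //.
  - by apply: emeasurable_sum => k; exact: mBk.
  - by move=> x; rewrite /= in_itv /= => /andP[h1 h2]; rewrite sumEFin lee_fin ltW// gt_e. }
have upper : (\int[mu]_(x in `[H, (2 * H)%R]) (\sum_(k < N) (B (k.+1%:R * x))%:E) <= (2 * I)%:E)%E.
{ rewrite ge0_integral_sum//; [|by move=> k; exact: mBk|by move=> k x _; rewrite lee_fin].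
  (* Substituting [k.+1%:R * x] turns the k-th integral into one over [D k] with weight
     [k.+1%:R^-1]; by [harmonic_window] these weights add up to at most 2 at every point. *)
  pose D (k : nat) := (`[(k.+1%:R * H)%R, (k.+1%:R * (2 * H))%R]%classic : set R).
  pose g (k : 'I_N) (x : measurableTypeR R) : \bar R := (((fun x => (k.+1%:R^-1 * B x)%:E) \_ (D k)) x)%E.
  have mg k : measurable_fun setT (g k).
    have mD : measurable (D k : set (measurableTypeR R)) by exact: measurable_itv.
    have [h _] := measurable_restrictT (fun x : measurableTypeR R => (k.+1%:R^-1 * B x)%:E) mD; apply: h; exact: mBD.
  have -> : (\sum_(k < N) \int[mu]_(x in `[H, (2 * H)%R]) (B (k.+1%:R * x))%:E =
      \sum_(k < N) \int[mu]_x (g k x))%E.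
    by apply: eq_bigr => k _; rewrite integral_scale// -integral_mkcond.
  have g0 k x : setT x -> (0 <= g k x)%E.
    by move=> _; rewrite /g patchE; case: ifP => // _; rewrite lee_fin mulr_ge0.
  have -> : (\sum_(k < N) \int[mu]_x (g k x) = \int[mu]_x (\sum_(k < N) g k x))%E.
    by rewrite (ge0_integral_sum _ measurableT mg g0).
  apply: (@le_trans _ _ (\int[mu]_x (((fun x => (2 * B x)%:E) \_ `[0%R, +oo[) x))%E).
  - apply: ge0_le_integral => //.
    + by move=> x _; apply: sume_ge0 => k _; exact: g0.
    + by apply: emeasurable_sum => k; exact: mg.
    + have mD : measurable (`[0%R, +oo[%classic : set (measurableTypeR R)) by exact: measurable_itv.
      have [h _] := measurable_restrictT (fun x : measurableTypeR R => (2 * B x)%:E) mD; apply: h; exact: mBD.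
    + move=> x _; rewrite patchE /g.
      under eq_bigr do rewrite patchE.
      have -> : (\sum_(k < N) (if x \in D k then (k.+1%:R^-1 * B x)%:E else 0) =
          ((\sum_(k < N) (if (k.+1%:R * H <= x <= k.+1%:R * (2 * H))%R then k.+1%:R^-1 else 0)) * B x)%:E)%E.
        rewrite mulr_suml -sumEFin; apply: eq_bigr => k _; rewrite mem_setE in_itv /=.
        by case: ifP => _; rewrite ?mul0r.
      rewrite mem_setE in_itv /= andbT; case: ifP => [x0|x0]; rewrite lee_fin.
        by apply: ler_wpM2r => //; exact: harmonic_window.
      rewrite big1 ?mul0r// => k _; case: ifP => // /andP[kx _]; exfalso.
      by move/negP: x0; apply; apply: le_trans kx; rewrite mulr_ge0// ltW.
  - rewrite -integral_mkcond; under eq_integral do rewrite EFinM.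
    rewrite ge0_integralZl//; last by move=> x _; rewrite lee_fin.
      by rewrite EFinM lee_pmul2l.
    by apply/measurable_EFinP/measurable_funTS. }
have := le_trans lower upper; rewrite lee_fin; lra.
Qed.

Lemma riemann_upper (delta omega : R) (K : nat) : 0 < delta -> 0 <= omega ->
  (forall (k : nat) x, k%:R * delta <= x -> x <= k.+1%:R * delta -> B x <= B (k%:R * delta) + omega) ->
  (\int[mu]_(x in `[0%R, (K%:R * delta)%R[) (B x)%:E <=
   (delta * \sum_(k < K) B (k%:R * delta)%R + K%:R * delta * omega)%:E)%E.
Proof.
move=> d0 om0 hB; elim: K => [|K IH].
  by rewrite !mul0r big_ord0 mulr0 addr0 set_itvxx integral_set0.
have mBI D : measurable_fun D (fun x => (B x)%:E) by apply/measurable_EFinP/measurable_funTS.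
have KK : K%:R * delta <= K.+1%:R * delta by rewrite ler_pM2r// ler_nat.
have K0 : 0 <= K%:R * delta by rewrite mulr_ge0// ltW.
rewrite (@itv_bndbnd_setU _ _ _ (BLeft (K%:R * delta)))//.
have disj : [disjoint `[0%R, (K%:R * delta)%R[%classic & `[(K%:R * delta)%R, (K.+1%:R * delta)%R[%classic].
  apply/disj_setPLR => x /=; rewrite !in_itv /= => /andP[_ xK]; apply/negP.
  by rewrite negb_and -ltNge xK.
rewrite (ge0_integral_setU mu (measurable_itv _) (measurable_itv _) (mBI _) _ disj); last first.
  by move=> x _; rewrite lee_fin.
rewrite big_ord_recr /=.
have -> : delta * (\sum_(k < K) B (k%:R * delta) + B (K%:R * delta)) + K.+1%:R * delta * omega =
    (delta * (\sum_(k < K) B (k%:R * delta)) + K%:R * delta * omega) +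
    (B (K%:R * delta) + omega) * delta by rewrite -natr1; ring.
rewrite EFinD; apply: leeD => //.
have -> : ((B (K%:R * delta) + omega) * delta)%:E =
    (\int[mu]_(x in `[(K%:R * delta)%R, (K.+1%:R * delta)%R[) (cst (B (K%:R * delta) + omega)%:E) x)%E.
  rewrite integral_cst//= lebesgue_measure_itv /= lte_fin ifT; last by rewrite ltr_pM2r// ltr_nat.
  by rewrite -EFinB -EFinM -natr1; congr (_%:E); ring.
apply: ge0_le_integral => //.
- by move=> x _; rewrite lee_fin.
- exact: mBI.
- by move=> x; rewrite /= in_itv /= => /andP[h1 h2]; rewrite lee_fin hB// ltW.
Qed.

Lemma integral_half_line_unbounded (C : R) : (\int[mu]_(x in `[0%R, +oo[) (B x)%:E = +oo)%E ->
  exists m : nat, (C%:E <= \int[mu]_(x in `[0%R, m%:R[) (B x)%:E)%E.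
Proof.
move=> Ioo; apply: contrapT => /forallNP h.
pose F (i : nat) := (`[0%R, i%:R[%classic : set (measurableTypeR R)).
have mBI D : measurable_fun D (fun x => (B x)%:E) by apply/measurable_EFinP/measurable_funTS.
have ndF : nondecreasing_seq F.
  move=> i j ij; apply/subsetPset => x; rewrite /F /= !in_itv /= => /andP[-> xi] /=.
  by apply: lt_le_trans xi _; rewrite ler_nat.
have B0 i x : F i x -> (0 <= (B x)%:E)%E by move=> _; rewrite lee_fin.
have := @ge0_nondecreasing_set_cvg_integral _ (measurableTypeR R) R F (fun x => (B x)%:E)
  lebesgue_measure ndF (fun i => measurable_itv _) (fun i => mBI _) B0.
rewrite (_ : \bigcup_i F i = `[0%R, +oo[%classic); last first.
  apply/seteqP; split => x; first by move=> [i _]; rewrite /F /= !in_itv /= andbT => /andP[].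
  rewrite /= in_itv /= andbT => x0; exists (Num.truncn x).+1 => //.
  by rewrite /F /= in_itv /= x0 truncnS_gt.
rewrite Ioo => hc.
have : (+oo <= C%:E)%E.
  apply: (cvge_le _ hc); apply: nearW => m; apply: ltW; rewrite ltNge; exact/negP/h.
by [].
Qed.

End half_line_integrals.

Section continuous_time.
Context {R : realType}.
Local Notation T := [set` `[(0 : R), +oo[].
Context {A : R -> R} {d : measure_display} {Omega : measurableType d}.
Context {P : probability Omega R} {Z : R -> {RV P >-> R}}.
Hypotheses (hgauss : gaussian_process T Z) (hcent : centered_process T Z).
Hypotheses (hstat : stationary_process T Z) (hcorr : has_correlation T Z A).
Hypothesis hcont : ae_continuous_paths T Z.
Hypothesis hA : forall t, T t -> 0 <= A t.

Let TE (t : R) : T t = (0 <= t) :> Prop.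
Proof. by rewrite /= in_itv /= andbT. Qed.

Let T_ge0 t : T t -> 0 <= t.
Proof. by rewrite TE. Qed.

Let T_add s t : T s -> T t -> T (s + t).
Proof. by rewrite !TE; exact: addr_ge0. Qed.

Let T_sub s t : T s -> T t -> s < t -> T (t - s).
Proof. by rewrite !TE => _ _ /ltW; rewrite subr_ge0. Qed.

Let T_nat (n : nat) : T n.+1%:R.
Proof. by rewrite TE. Qed.

Let T_dense x : T x -> exists u, dense_seq T x u.
Proof.
rewrite TE => x0.
(* Non-negative rationals i / (j + 1) cut off at [x], enumerated through pairs; a code without a
   pair yields 0. *)
pose u (k : nat) : R := let ij := odflt (0, 0)%N (unpickle k) in
  Num.min x (ij.1%:R / ij.2.+1%:R).
exists u; split => [k|t e].
  by rewrite TE /u le_min x0 divr_ge0//= ge_min lexx.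
rewrite TE => t0 tx e0; pose j := Num.truncn e^-1.
have je : j.+1%:R^-1 < e by rewrite invf_plt ?posrE ?ltr0n// truncnS_gt.
have tj0 : 0 <= t * j.+1%:R by rewrite mulr_ge0.
exists (pickle (Num.truncn (t * j.+1%:R), j)).
rewrite /u pickleK /=; have /andP[i1 i2] := truncn_itv tj0.
move: i1 i2; set i := Num.truncn _ => i1 i2.
have h1 : i%:R / j.+1%:R <= t by rewrite ler_pdivrMr.
have h2 : t < i%:R / j.+1%:R + j.+1%:R^-1 by rewrite -[X in _ + X]mul1r -mulrDl natr1 ltr_pdivlMr.
rewrite (min_idPr _); last exact: le_trans tx.
have key (y v : R) : y <= t -> t < y + v -> v < e -> `|y - t| < e.
  by move=> yt ty ve; rewrite ler0_norm; lra.
exact: key h1 h2 je.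
Qed.

Let A_dist s t : T s -> T t -> 0 <= A `|s - t|.
Proof. by move=> _ _; apply: hA; rewrite TE. Qed.

Let paths_bounded x : {ae P, forall w, exists c, forall t, T t -> t <= x -> Z t w <= c}.
Proof.
apply: filterS hcont => w cw; have [x0|x0] := leP 0 x; last first.
  by exists 0 => t; rewrite TE => t0 tx; have := le_lt_trans (le_trans t0 tx) x0; rewrite ltxx.
have [|c _ hc] := @EVT_max R (fun t => Z t w) 0 x x0.
  by apply: continuous_subspaceW cw => t; rewrite /= !in_itv /= andbT => /andP[].
by exists (Z c w) => t; rewrite TE => t0 tx; apply: hc; rewrite in_itv /= t0.
Qed.

Let A_near0 : exists2 delta, T delta /\ 0 < delta & exists2 s, T s &
  forall t, T t -> t <= delta -> 2^-1 <= A `|t - s|.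
Proof.
have [|delta d0 hd] := covariance_near0 hgauss hcent hcorr hcont (e := 2^-1); first by lra.
exists delta; first by rewrite TE ltW.
exists 0; first by rewrite TE.
by move=> t; rewrite TE => t0 td; rewrite subr0 ger0_norm//; have := hd t t0 td; lra.
Qed.

(** The even extension: continuous on the whole line, whatever [A] does at negative arguments. *)
Let B (x : R) : R := A `|x|.

Let cB : continuous B := covariance_continuous hgauss hcent hcorr hcont.

Let B_ge0 x : 0 <= B x.
Proof. by apply: hA; rewrite TE. Qed.

Let integralB : (\int[lebesgue_measure]_(t in T) (A t)%:E =
  \int[lebesgue_measure]_(t in `[0%R, +oo[) (B t)%:E)%E.
Proof.
by apply: eq_integral => t; rewrite mem_setE in_itv /= andbT => t0; rewrite /B ger0_norm.
Qed.

Lemma continuous_theta_gt0 r :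
  (\int[lebesgue_measure]_(t in T) (A t)%:E < +oo)%E ->
  theta_exists T Z r /\ (0 < theta T Z r < +oo)%E.
Proof.
rewrite integralB => Ioo.
apply: (theta_gt0 hgauss hcent hstat hcorr hcont T_ge0 T_add T_sub T_nat T_dense
  A_dist paths_bounded A_near0).
move=> eps eps0; set I := (\int[_]_(t in _) _)%E in Ioo.
have I0 : (0 <= I)%E by apply: integral_ge0 => x _; rewrite lee_fin.
have fI : I \is a fin_num by rewrite ge0_fin_numE.
pose H : R := (Num.truncn (2 * fine I / eps)).+1%:R.
have H0 : 0 < H by [].
have IH : 2 * fine I < eps * H by rewrite [eps * H]mulrC -ltr_pdivrMr//; exact: truncnS_gt.
(* Its successor is 2 H, the upper end of the range of steps. *)
exists ((Num.truncn (2 * fine I / eps)).+1.*2.-1) => N.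
have [|h [h1 h2 hs]] := @scaled_sum_small _ B cB B_ge0 (fine I) H eps N _ H0 IH.
  by rewrite fineK.
have h0 : 0 < h by apply: lt_le_trans h1.
exists h; split => //.
- by apply: le_trans h2 _; rewrite prednK// -muln2 natrM mulrC.
- by move=> i; rewrite TE mulr_ge0// ltW.
- apply: le_trans hs; apply: ler_sum => k _.
  by rewrite /B ger0_norm// mulr_ge0// ltW.
Qed.

Lemma continuous_theta_eq0 r :
  (\int[lebesgue_measure]_(t in T) (A t)%:E = +oo)%E ->
  theta_exists T Z r /\ theta T Z r = 0%E.
Proof.
rewrite integralB => Ioo.
apply: (theta_eq0 hgauss hcent hstat hcorr hcont T_ge0 T_add T_sub T_nat T_dense
  A_dist paths_bounded A_near0).
(* With [omega = C / (8 * m%:R)] the total error over a length [m] is C / 8. So delta G >= 7 C / 8,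
   whence eta delta G >= 28, and 2 K omega delta = C / 4 is below delta G / 2. *)
move=> eta eta0; pose C := 32 / eta.
have C0 : 0 < C by rewrite divr_gt0.
have [m hm] := integral_half_line_unbounded cB B_ge0 C Ioo.
have m0 : (0 < m)%N.
  case: m hm => // ; rewrite set_itvxx integral_set0 lee_fin => h.
  by have := lt_le_trans C0 h; rewrite ltxx.
have m0' : 0 < m%:R :> R by rewrite ltr0n.
pose omega := C / (8 * m%:R).
have om0 : 0 < omega by rewrite divr_gt0// mulr_gt0.
have [delta0 d00 hd0] := covariance_uniform hgauss hcent hcorr hcont om0.
(* The spacing is the inverse of an integer, so that K points span exactly the length [m]. *)
pose q := (Num.truncn delta0^-1).+1.
pose delta : R := q%:R^-1.
have d0 : 0 < delta by rewrite invr_gt0.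
have dd0 : delta <= delta0.
  by apply: ltW; rewrite invf_plt ?posrE ?ltr0n// truncnS_gt.
pose K := (m * q)%N.
have Kd : K%:R * delta = m%:R by rewrite /K /delta natrM mulfK// pnatr_eq0.
have K0 : (0 < K)%N by rewrite muln_gt0 m0.
have B_unif a b : 0 <= a -> 0 <= b -> `|a - b| <= delta -> B a <= B b + omega.
{ move=> a0 b0 ab; rewrite /B (ger0_norm a0) (ger0_norm b0) -lerBlDl.
  by apply: le_trans (hd0 a b a0 b0 (le_trans ab dd0)); exact: ler_norm. }
have kd0 (k : nat) : 0 <= k%:R * delta by rewrite mulr_ge0// ltW.
have BE (k : nat) : B (k%:R * delta) = A (k%:R * delta) by rewrite /B ger0_norm.
pose G := \sum_(k < K) A (k%:R * delta).
have hG : C <= delta * G + m%:R * omega.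
{ rewrite -lee_fin; apply: le_trans hm _; rewrite -Kd.
  have := @riemann_upper _ B cB B_ge0 delta omega K d0 (ltW om0).
  rewrite /G; under eq_bigr do rewrite BE; apply => k x kx xk.
  apply: B_unif => //; first exact: le_trans kx.
  rewrite ger0_norm ?subr_ge0//; move: xk; rewrite -natr1 mulrDl mul1r; lra. }
have mom : m%:R * omega = C / 8.
  by rewrite /omega; field; rewrite gt_eqF.
rewrite mom in hG.
exists K, (m + m)%N, delta, omega; split.
- by rewrite addn_gt0 m0.
- split => //; first by rewrite natrD mulrDl Kd natrD.
  by move=> i; rewrite TE.
- move=> t; rewrite TE natrD => t0 tm.
  (* Grid point number j sits at [j.+1%:R * delta], the first one to the right of [t]. Only the
     right end of the interval falls beyond the last index; it is itself the last grid point. *)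
  pose j0 := Num.truncn (t / delta).
  have /andP[j1 j2] : j0%:R <= t / delta < j0.+1%:R by apply: truncn_itv; rewrite divr_ge0// ltW.
  rewrite ler_pdivlMr// in j1; rewrite ltr_pdivrMr// in j2.
  have [j jK tj] : exists2 j, (j < K + K)%N & `|j.+1%:R * delta - t| <= delta.
  { have [jK|Kj] := ltnP j0 (K + K).
      exists j0 => //; rewrite ger0_norm; last by rewrite subr_ge0 ltW.
      by move: j1; rewrite -natr1 mulrDl mul1r; lra.
    exists (K + K).-1; first by rewrite prednK// addn_gt0 K0.
    rewrite prednK ?addn_gt0 ?K0// natrD mulrDl Kd.
    have : (K + K)%:R * delta <= j0%:R * delta by rewrite ler_pM2r// ler_nat.
    rewrite natrD mulrDl Kd => h.
    by rewrite (_ : _ - t = 0) ?normr0 ?ltW//; lra. }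
  exists j => // i _; rewrite lerBlDr -BE.
  have -> : A `|t - i.+1%:R * delta| = B `|t - i.+1%:R * delta| by rewrite /B normr_id.
  apply: B_unif => //.
  rewrite (_ : (natdist j i)%:R * delta = `|j.+1%:R * delta - i.+1%:R * delta|); last first.
    by rewrite natdistE ?ltW// /natdist !subSS.
  apply: le_trans (ler_dist_dist _ _) _.
  by rewrite opprB addrA subrK.
- rewrite -/G; split.
    have : (K + K)%:R * delta * omega <= delta * G / 2.
      by rewrite natrD mulrDl Kd mulrDl mom; lra.
    by rewrite mulrAC mulrC -mulrA ler_pM2l.
  have : eta * C = 32 by rewrite /C mulrCA mulfV ?mulr1// gt_eqF.
  have : eta * (C - C / 8) <= eta * (delta * G) by rewrite ler_pM2l//; lra.
  rewrite mulrA; move: (eta * delta * G) => g h hC.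
  lra.
Qed.

End continuous_time.

Theorem lemma3p2 (R : realType) (T : set R)
  (mu : {measure set (measurableTypeR R) -> \bar R})
  (hT : (T = positive_naturals R /\ mu = counting)
        \/ (T = [set` `[0, +oo[] /\ mu = lebesgue_measure))
  (A : R -> R) (hA : forall t, T t -> 0 <= A t)
  (d : measure_display) (Omega : measurableType d) (P : probability Omega R)
  (Z : R -> {RV P >-> R})
  (hgauss : gaussian_process T Z)
  (hcent : centered_process T Z)
  (hstat : stationary_process T Z)
  (hcorr : has_correlation T Z A)
  (hcont : ae_continuous_paths T Z) :
  ((\int[mu]_(t in T) (A t)%:E < +oo)%E ->
     forall r : R, theta_exists T Z r /\ (0 < theta T Z r < +oo)%E)
  /\
  ((\int[mu]_(t in T) (A t)%:E = +oo)%E ->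
     forall r : R, theta_exists T Z r /\ theta T Z r = 0%E).
Proof.
case: hT => -[TE ->]; subst T; split => h r.
- exact: (discrete_theta_gt0 hgauss hcent hstat hcorr hcont hA r h).
- exact: (discrete_theta_eq0 hgauss hcent hstat hcorr hcont hA r h).
- exact: (continuous_theta_gt0 hgauss hcent hstat hcorr hcont hA r h).
- exact: (continuous_theta_eq0 hgauss hcent hstat hcorr hcont hA r h).
Qed.
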